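(* Let $T_0$ be the block Toeplitz operator in $\mathcal H_+=\ell^2(\mathbb Z_+,\mathbb C^N)$ associated with a family $(A_j)_{j\in\mathbb Z}$ of $N\times N$ complex matrices satisfying $\sum_{j\in\mathbb Z}\|A_j\|<\infty$ and $A_{-j}=A_j^*$ for all $j\in\mathbb Z$, and assume that its symbol $h$ has a holomorphic extension to an open annulus $\{z\in\mathbb C: 1/r<|z|<r\}$ for some $r>1$. Let $v$ be a compact symmetric operator in $\mathcal H_+$ such that $$\int_1^{\infty}\|\theta(\langle\mathbf N\rangle/r)v\|\,dr<\infty ,$$ and assume in addition that $v$ extends to a bounded operator from $\mathcal K_+^{*\circ}$ to $\mathcal K_+$. Let $T=T_0+v$ and let $P_{ac}(T_0)$ be the spectral projector of $T_0$ on its purely absolutely continuous component. Then the wave operators $$\Omega^\pm(T,T_0)=\operatorname*{s-lim}_{t\to\pm\infty}e^{iTt}e^{-iT_0t}P_{ac}(T_0)$$ exist and they are complete, i.e. their ranges equal the absolutely continuous subspace $\mathcal H_{ac}(T)$ of $T$.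
   Context: $N\ge1$ is an integer, $\mathbb Z_+=\{0,1,2,\dots\}$, and $\mathcal H_+=\ell^2(\mathbb Z_+,\mathbb C^N)$ with its usual scalar product. The Toeplitz operator is $(T_0\psi)_n=\sum_{m=0}^{\infty}A_{n-m}\psi_m$, $n\ge0$; it is bounded and self-adjoint. Its symbol is $h(e^{ip})=\sum_{m\in\mathbb Z}A_me^{imp}$, $p\in\mathbb R$. $\mathbf N$ is the operator $(\mathbf N\psi)_j=j\psi_j$ in $\mathcal H_+$ with natural domain $D(\mathbf N)$; $\langle x\rangle=\sqrt{1+x^2}$; $\theta\in C_0^\infty(\mathbb R)$ is a fixed function with $\theta(x)>0$ if $1<x<2$ and $\theta(x)=0$ otherwise. Spaces: $\mathcal K_+=(D(\mathbf N),\mathcal H_+)_{1/2,1}$ is the real interpolation space; an equivalent norm is $\|\psi_0\|+\sum_{k\ge0}2^{k/2}\big(\sum_{2^k\le n<2^{k+1}}\|\psi_n\|^2\big)^{1/2}$. $\mathcal K_+^*$ is its dual (antidual), and identifying $\mathcal H_+$ with its dual by Riesz, $\mathcal K_+\subset\mathcal H_+\subset\mathcal K_+^*$ continuously. $\mathcal K_+^{*\circ}$ is the closure of $\mathcal H_+$ in $\mathcal K_+^*$. *)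

(* Defs.v *)
From HB Require Import structures.
From mathcomp Require Import all_boot all_order all_algebra complex.
From mathcomp Require Import all_classical all_reals all_analysis.

Set Implicit Arguments.
Unset Strict Implicit.
Unset Printing Implicit Defensive.

Import Order.TTheory GRing.Theory Num.Theory.
Import numFieldNormedType.Exports.

Local Open Scope classical_set_scope.
Local Open Scope ring_scope.

(* The alias makes the topology that the library puts on every [numFieldType]
   available on R[i]. *)
Definition Cplx (R : realType) : numClosedFieldType := R[i].

Definition cofR (R : realType) (x : R) : Cplx R := (x%:C)%C.

(* The library's norm on a normed module over R[i] takes its values in R[i]. *)
Definition rnorm (R : realType) (V : normedModType (Cplx R)) (x : V) : R :=
  complex.Re `|x|.

Section Minkowski.
Variable R : rcfType.

Lemma cauchy_schwarz_sum (I : Type) (s : seq I) (a b : I -> R) :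
  (\sum_(i <- s) a i * b i) ^+ 2 <=
  (\sum_(i <- s) a i ^+ 2) * (\sum_(i <- s) b i ^+ 2).
Proof.
elim: s => [|i s IH]; first by rewrite !big_nil expr0n /= mul0r.
rewrite !big_cons.
move: IH; set P := \sum_(j <- s) a j * b j.
set A := \sum_(j <- s) a j ^+ 2; set B := \sum_(j <- s) b j ^+ 2 => IH.
have A0 : 0 <= A by apply: sumr_ge0 => j _; exact: sqr_ge0.
have B0 : 0 <= B by apply: sumr_ge0 => j _; exact: sqr_ge0.
set x := a i; set y := b i.
have key : 2 * (x * y * P) <= x ^+ 2 * B + y ^+ 2 * A.
  have h : `|P| <= Num.sqrt A * Num.sqrt B.
    by rewrite -sqrtrM// -sqrtr_sqr ler_sqrt// mulr_ge0.
  apply: (@le_trans _ _ (2 * (`|x| * `|y| * (Num.sqrt A * Num.sqrt B)))).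
    rewrite ler_pM2l//; apply: (le_trans (ler_norm _)).
    by rewrite !normrM ler_wpM2l// mulr_ge0.
  have := sqr_ge0 (`|x| * Num.sqrt B - `|y| * Num.sqrt A).
  rewrite sqrrB !exprMn !real_normK ?num_real// !sqr_sqrtr//.
  rewrite addrAC subr_ge0; apply: le_trans.
  by rewrite mulr_natl [X in _ <= X *+ 2]mulrACA (mulrC (Num.sqrt B)).
rewrite sqrrD exprMn mulrDl !mulrDr -addrA -[leRHS]addrA lerD2l addrA lerD//.
by rewrite -mulr_natl (mulrC A).
Qed.

Lemma minkowski_sum (I : Type) (s : seq I) (a b : I -> R) :
  Num.sqrt (\sum_(i <- s) (a i + b i) ^+ 2) <=
  Num.sqrt (\sum_(i <- s) a i ^+ 2) + Num.sqrt (\sum_(i <- s) b i ^+ 2).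
Proof.
set A := \sum_(j <- s) a j ^+ 2; set B := \sum_(j <- s) b j ^+ 2.
have A0 : 0 <= A by apply: sumr_ge0 => j _; exact: sqr_ge0.
have B0 : 0 <= B by apply: sumr_ge0 => j _; exact: sqr_ge0.
have S0 : 0 <= Num.sqrt A + Num.sqrt B by rewrite addr_ge0 ?sqrtr_ge0.
rewrite -[leRHS](ger0_norm S0) -sqrtr_sqr ler_sqrt ?sqr_ge0//.
under eq_bigr do rewrite sqrrD.
rewrite !big_split /= sqrrD !sqr_sqrtr// lerD2r lerD2l.
rewrite -mulr2n lerMn2r /=.
apply: (le_trans (ler_norm _)); rewrite -sqrtr_sqr -sqrtrM//.
by rewrite ler_sqrt ?mulr_ge0//; exact: cauchy_schwarz_sum.
Qed.

End Minkowski.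

Section EuclideanNorm.
Variables (R : realType) (N : nat).
Local Notation C := (Cplx R).

(* The library's own norm on ['cV_N] is the maximum norm. *)
Definition enorm (x : 'cV[C]_N) : R :=
  Num.sqrt (\sum_(i < N) rnorm (x i ord0 : C) ^+ 2).

Definition mxopnorm (M : 'M[C]_N) : \bar R :=
  ereal_sup [set (enorm (M *m x))%:E | x in [set x : 'cV[C]_N | enorm x <= 1]].

Lemma rnormE (z : C) : cofR (rnorm z) = `|z|.
Proof. by rewrite /cofR /rnorm RRe_real// ger0_real. Qed.

Lemma rnorm_ge0 (z : C) : 0 <= rnorm z.
Proof. by have := normr_ge0 z; rewrite -rnormE -[0]/(cofR 0) lecR. Qed.

Lemma rnormD (y z : C) : rnorm (y + z) <= rnorm y + rnorm z.
Proof.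
rewrite -(@lecR R) rmorphD /= -!/(cofR _) !rnormE; exact: ler_normD.
Qed.

Lemma rnormM (y z : C) : rnorm (y * z) = rnorm y * rnorm z.
Proof.
by apply: (@complexI R); rewrite rmorphM /= -!/(cofR _) !rnormE normrM.
Qed.

Lemma rnorm_eq0 (z : C) : rnorm z = 0 -> z = 0.
Proof. by move=> h; apply/normr0_eq0; rewrite -rnormE h. Qed.

Lemma enorm_ge0 x : 0 <= enorm x.
Proof. exact: sqrtr_ge0. Qed.

Lemma enormD x y : enorm (x + y) <= enorm x + enorm y.
Proof.
apply: le_trans (minkowski_sum _ _ _).
rewrite ler_sqrt; last by apply: sumr_ge0 => i _; exact: sqr_ge0.
apply: ler_sum => i _; rewrite mxE ler_sqr ?nnegrE ?addr_ge0 ?rnorm_ge0//.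
exact: rnormD.
Qed.

Lemma enormZ (a : C) x : enorm (a *: x) = rnorm a * enorm x.
Proof.
rewrite /enorm; under eq_bigr do rewrite mxE rnormM exprMn.
by rewrite -mulr_sumr sqrtrM ?sqr_ge0// sqrtr_sqr ger0_norm// rnorm_ge0.
Qed.

Lemma enorm_eq0 x : enorm x = 0 -> x = 0.
Proof.
move=> /eqP; rewrite sqrtr_eq0 => h.
have /eqP : \sum_(i < N) rnorm (x i ord0 : C) ^+ 2 = 0.
  by apply/eqP; rewrite eq_le h sumr_ge0// => i _; exact: sqr_ge0.
rewrite psumr_eq0 => [/allP h0|i _]; last exact: sqr_ge0.
apply/matrixP => i j; rewrite (ord1 j) mxE; apply: rnorm_eq0; apply/eqP.
by have := h0 i (mem_index_enum _); rewrite sqrf_eq0.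
Qed.

Definition sqsum (psi : nat -> 'cV[C]_N) : \bar R :=
  (\sum_(n <oo) (enorm (psi n) ^+ 2)%:E)%E.

Definition sqsummable : pred (nat -> 'cV[C]_N) :=
  [pred psi | (sqsum psi < +oo)%E].

End EuclideanNorm.

Record l2 (R : realType) (N : nat) := L2 {
  l2seq :> nat -> 'cV[Cplx R]_N;
  l2P : l2seq \in @sqsummable R N }.

Section HilbertSpace.
Variables (R : realType) (N : nat).
Local Notation C := (Cplx R).
Implicit Types psi phi : nat -> 'cV[C]_N.

Lemma sqsum_ge0 psi : (0 <= sqsum psi)%E.
Proof. by apply: nneseries_ge0 => n _ _; rewrite lee_fin sqr_ge0. Qed.

Lemma sqsum_le psi (M : R) : 0 <= M ->
  (forall n, Num.sqrt (\sum_(0 <= k < n) enorm (psi k) ^+ 2) <= M) ->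
  (sqsum psi <= (M ^+ 2)%:E)%E.
Proof.
move=> M0 h; apply: lime_le.
  by apply: is_cvg_nneseries => n _ _; rewrite lee_fin sqr_ge0.
apply: nearW => n; rewrite sumEFin lee_fin.
have S0 : 0 <= \sum_(0 <= k < n) enorm (psi k) ^+ 2.
  by apply: sumr_ge0 => k _; exact: sqr_ge0.
by rewrite -(sqr_sqrtr S0) ler_sqr ?nnegrE ?sqrtr_ge0.
Qed.

Lemma sqsum_part psi n : (sqsum psi < +oo)%E ->
  Num.sqrt (\sum_(0 <= k < n) enorm (psi k) ^+ 2) <=
  Num.sqrt (fine (sqsum psi)).
Proof.
move=> h; rewrite ler_sqrt; last by rewrite fine_ge0// sqsum_ge0.
rewrite -lee_fin fineK; last by rewrite ge0_fin_numE// sqsum_ge0.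
rewrite -sumEFin; apply: nneseries_lim_ge => k _ _.
by rewrite lee_fin sqr_ge0.
Qed.

Lemma sqsumD psi phi : (sqsum psi < +oo)%E -> (sqsum phi < +oo)%E ->
  (sqsum (psi + phi)%R <=
   ((Num.sqrt (fine (sqsum psi)) + Num.sqrt (fine (sqsum phi))) ^+ 2)%R%:E)%E.
Proof.
move=> h1 h2; apply: sqsum_le => [|n]; first by rewrite addr_ge0 ?sqrtr_ge0.
apply: le_trans (lerD (sqsum_part n h1) (sqsum_part n h2)).
apply: le_trans (minkowski_sum _ _ _).
rewrite ler_sqrt; last by apply: sumr_ge0 => i _; exact: sqr_ge0.
apply: ler_sum => i _; rewrite ler_sqr ?nnegrE ?addr_ge0 ?enorm_ge0//.
exact: enormD.
Qed.

Lemma sqsumZ (a : C) psi : sqsum (a *: psi) = ((rnorm a ^+ 2)%:E * sqsum psi)%E.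
Proof.
rewrite /sqsum -nneseriesZl => [|n _]; last by rewrite lee_fin sqr_ge0.
by apply: eq_eseriesr => n _; rewrite -EFinM -exprMn -enormZ.
Qed.

Lemma sqsum0 : sqsum (0 : nat -> 'cV[C]_N) = 0%E.
Proof.
rewrite -(scale0r (0 : nat -> 'cV[C]_N)) sqsumZ /rnorm normr0 /=.
by rewrite expr0n mul0e.
Qed.

Lemma sqsummable_submod_closed : submod_closed (@sqsummable R N).
Proof.
split=> [|a psi phi]; rewrite !inE; first by rewrite sqsum0.
move=> h1 h2; apply: le_lt_trans (ltry _); apply: sqsumD => //.
by rewrite sqsumZ lte_mul_pinfty ?lee_fin ?sqr_ge0.
Qed.

HB.instance Definition _ :=
  GRing.isSubmodClosed.Build C _ (@sqsummable R N) sqsummable_submod_closed.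

HB.instance Definition _ := [isSub for @l2seq R N].
HB.instance Definition _ := [Choice of l2 R N by <:].
HB.instance Definition _ := [SubChoice_isSubLmodule of l2 R N by <:].

Definition l2norm (psi : l2 R N) : R := Num.sqrt (fine (sqsum psi)).

Let cnorm (psi : l2 R N) : C := cofR (l2norm psi).

Lemma l2norm_fin (psi : l2 R N) : (sqsum psi < +oo)%E.
Proof. exact: (l2P psi). Qed.

Let cnormD (psi phi : l2 R N) : cnorm (psi + phi) <= cnorm psi + cnorm phi.
Proof.
rewrite /cnorm /cofR -rmorphD lecR -[leRHS]ger0_norm; last first.
  by rewrite addr_ge0 ?sqrtr_ge0.
rewrite -sqrtr_sqr ler_sqrt ?sqr_ge0// -lee_fin fineK.
  exact: sqsumD (l2norm_fin _) (l2norm_fin _).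
by rewrite ge0_fin_numE ?sqsum_ge0// l2norm_fin.
Qed.

Let cnormZ (a : C) (psi : l2 R N) : cnorm (a *: psi) = `|a| * cnorm psi.
Proof.
rewrite -rnormE /cnorm /cofR -rmorphM; congr (real_complex _ _).
rewrite /l2norm (_ : l2seq (a *: psi) = a *: (psi : nat -> 'cV[C]_N))//.
rewrite sqsumZ fineM//; last by rewrite ge0_fin_numE ?sqsum_ge0// l2norm_fin.
by rewrite sqrtrM ?sqr_ge0//= sqrtr_sqr ger0_norm// rnorm_ge0.
Qed.

Let cnorm_eq0 (psi : l2 R N) : cnorm psi = 0 -> psi = 0.
Proof.
move=> /(@complexI R) /eqP; rewrite sqrtr_eq0 => h; apply/val_inj/funext => n.
apply: enorm_eq0; apply/eqP; rewrite -sqrf_eq0 eq_le sqr_ge0 andbT.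
apply: le_trans h; rewrite -lee_fin fineK; last first.
  by rewrite ge0_fin_numE ?sqsum_ge0// l2norm_fin.
apply: le_trans (nneseries_lim_ge n.+1 _); last first.
  by move=> k _ _; rewrite lee_fin sqr_ge0.
rewrite sumEFin lee_fin big_nat_recr//= lerDr.
by apply: sumr_ge0 => k _; exact: sqr_ge0.
Qed.

HB.instance Definition _ :=
  Lmodule_isNormed.Build C (l2 R N) cnormD cnormZ cnorm_eq0.

Lemma l2normE (psi : l2 R N) : rnorm psi = l2norm psi.
Proof. by []. Qed.

End HilbertSpace.

Section Operators.
Variables (R : realType) (N : nat).
Local Notation C := (Cplx R).
Local Notation H := (l2 R N).

Definition inner (phi psi : H) : C :=
  limn (series (fun n => \sum_(i < N) (phi n i ord0)^* * psi n i ord0)).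

Definition opnorm (S : H -> H) : \bar R :=
  ereal_sup [set (rnorm (S psi))%:E | psi in [set psi : H | rnorm psi <= 1]].

Definition symmetric_op (S : H -> H) :=
  forall phi psi : H, inner phi (S psi) = inner (S phi) psi.

Definition compact_op (S : H -> H) :=
  precompact (S @` [set psi : H | rnorm psi <= 1]).

(* Here and in [weight_op] the default value 0 is returned when the sequence is
   not square summable, which does not happen when sum_j ||A_j|| is finite,
   resp. when psi is in the domain of the operator. *)
Definition toeplitz (A : int -> 'M[C]_N) (psi : H) : H :=
  insubd (0 : H)
    (fun n : nat => limn (series (fun m : nat => A (n%:Z - m%:Z) *m psi m))).

Definition symbol (A : int -> 'M[C]_N) (p : R) : 'M[C]_N :=
  limn (fun n : nat => \sum_(k < n.*2.+1)
    let m := k%:Z - n%:Z in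
    (Complex (cos (m%:~R * p)) (sin (m%:~R * p)) : C) *: A m).

Definition symbol_extends_holomorphically (A : int -> 'M[C]_N) (r : R) :=
  exists g : C -> 'M[C]_N,
    (forall z : C, r^-1 < rnorm z < r -> derivable g z 1) /\
    (forall p : R, g (Complex (cos p) (sin p)) = symbol A p).

Definition weight_seq (f : nat -> R) (psi : H) : nat -> 'cV[C]_N :=
  fun j => cofR (f j) *: psi j.

Definition weight_op (f : nat -> R) (psi : H) : H :=
  insubd (0 : H) (weight_seq f psi).

Definition dom_number : set H :=
  [set psi | weight_seq (fun j => j%:R) psi \in @sqsummable R N].

Definition number_op : H -> H := weight_op (fun j => j%:R).

(* f(N) in the functional calculus of the number operator *)
Definition fun_number_op (f : R -> R) : H -> H := weight_op (fun j => f j%:R).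

Definition japanese (x : R) : R := Num.sqrt (1 + x ^+ 2).

Definition exp_itop (S : H -> H) (t : R) (psi : H) : H :=
  limn (series (fun k => (('i * cofR t) ^+ k / k`!%:R) *: iter k S psi)).

End Operators.

Definition test_function (R : realType) (f : R -> R) :=
  (forall (n : nat) (x : R), derivable (derive1n n f) x 1) /\
  compact (closure [set x | f x != 0]).

Section Interpolation.
Variables (R : realType) (N : nat).
Local Notation C := (Cplx R).
Local Notation H := (l2 R N).
Local Notation leb := (@lebesgue_measure R).

Definition graph_norm (psi : H) : R := rnorm psi + rnorm (number_op psi).

(* Peetre's K-functional of the couple (D(N), H) *)
Definition Kfunctional (t : R) (psi : H) : R :=
  inf [set graph_norm a + t * rnorm (psi - a) | a in @dom_number R N].

(* The norm of (D(N), H)_{1/2,1} *)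
Definition interp_norm (psi : H) : \bar R :=
  (\int[leb]_(t in `]0%R, +oo[) (t `^ (- 2^-1) * Kfunctional t psi / t)%:E)%E.

Definition Kplus := {psi : H | (interp_norm psi < +oo)%E}.

Definition dual_norm (l : Kplus -> C) : \bar R :=
  ereal_sup [set (rnorm (l x : C))%:E
            | x in [set x : Kplus | (interp_norm (val x) <= 1)%E]].

Definition antilinear (l : Kplus -> C) :=
  forall (a : C) (x y z : Kplus), val z = a *: val x + val y ->
    l z = a^* * l x + l y.

Definition Kplus_dual : set (Kplus -> C) :=
  [set l | antilinear l /\ (dual_norm l < +oo)%E].

(* The embedding of H into the antidual of Kplus *)
Definition riesz (phi : H) : Kplus -> C := fun x => inner (val x) phi.

Definition Kplus_dual0 : set (Kplus -> C) :=
  [set l | Kplus_dual l /\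
    forall e : R, 0 < e ->
      exists phi : H, (dual_norm (fun x => (l x - riesz phi x)%R) < e%:E)%E].

Definition extends_to_Kplus (v : H -> H) :=
  exists V : (Kplus -> C) -> Kplus,
    [/\ forall (a : C) (l m : Kplus -> C), Kplus_dual0 l -> Kplus_dual0 m ->
          val (V (fun x => a * l x + m x)) = a *: val (V l) + val (V m),
        exists c : R, forall l : Kplus -> C, Kplus_dual0 l ->
          (interp_norm (val (V l)) <= c%:E * dual_norm l)%E
      & forall phi : H, val (V (riesz phi)) = v phi].

End Interpolation.

Section SpectralTheory.
Variables (R : realType) (N : nat).
Local Notation H := (l2 R N).
Local Notation leb := (@lebesgue_measure R).

Definition scalar_spectral (E : set R -> H -> H) (psi : H) : set R -> \bar R :=
  fun B => (complex.Re (inner psi (E B psi)))%:E.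

(* E is the projection-valued Borel measure of the bounded self-adjoint
   operator S, i.e. S is the integral of x dE(x); the values of E on sets that
   are not Borel are irrelevant.  Requiring x to be integrable for every psi
   forces E to have bounded support. *)
Record spectral_measure_of (S : H -> H) (E : set R -> {linear H -> H}) : Prop :=
  SpectralMeasureOf {
    sm_symmetric : forall B : set (measurableTypeR R),
      measurable B -> symmetric_op (E B);
    sm_setT : forall psi, E setT psi = psi;
    sm_setI : forall B D : set (measurableTypeR R),
      measurable B -> measurable D -> forall psi,
        E (B `&` D) psi = E B (E D psi);
    sm_integral : forall psi,
      exists mu : {measure set (measurableTypeR R) -> \bar R},
        [/\ forall B, measurable B -> mu B = scalar_spectral E psi B,
            mu.-integrable setT (EFin : R -> \bar R)
          & inner psi (S psi) = cofR (\int[mu]_x x)%R] }.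

Definition ac_subspace (S : H -> H) : set H :=
  [set psi | exists2 E, spectral_measure_of S E &
                        scalar_spectral E psi `<< leb].

(* The orthogonal projection onto a closed subspace M *)
Definition orth_proj (M : set H) (psi : H) : H :=
  xget 0 [set phi | M phi /\ forall chi, M chi -> inner chi (psi - phi) = 0].

Definition ac_proj (S : H -> H) : H -> H := orth_proj (ac_subspace S).

Definition is_wave_operator (F : set_system R) (S S0 W : H -> H) :=
  forall psi : H,
    exp_itop S t (exp_itop S0 (- t) (ac_proj S0 psi)) @[t --> F] --> W psi.

End SpectralTheory.

(* Main.v *)
(* The integrability condition in dimension one is a trace condition: since theta
   is bounded below on [5/4, 7/4], integrating over disjoint intervals gives
   sum_k |v e_k| < oo for the standard basis (e_k).  So the theorem is an instance
   of the Kato-Rosenblum theorem for bounded operators.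

   The latter is proved for the unitary operators U = exp(i tau T) and
   U0 = exp(i tau T0) with tau small.  Call phi a Bessel vector of U0 when
   sum_n |<g, U0^n phi>|^2 <= c |g|^2.  By the spectral theorem the absolutely
   continuous subspace is the closure of the Bessel vectors: truncating the
   density of the spectral measure yields Bessel vectors, and conversely a Bessel
   vector has a spectral measure bounded by a multiple of Lebesgue measure.  For a
   Bessel vector the increments of U^(-n) U0^n phi are sums of <K U0^n phi, y_n>
   with K = U - U0, and Cauchy-Schwarz bounds them by the tails of a series
   dominated by sum_k |K e_k|.  This sum is finite because T0, being a Toeplitz
   operator with summable coefficients, satisfies Schur's test in the basis
   (e_k).  Continuous time follows from tau -> 0, and completeness by exchanging
   T and T0. *)

Require Import Defs.
From HB Require Import structures.
From mathcomp Require Import all_boot all_order all_algebra complex.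
From mathcomp Require Import all_classical all_reals all_analysis.
From mathcomp Require Import ring lra measurable_realfun.

Set Implicit Arguments.
Unset Strict Implicit.
Unset Printing Implicit Defensive.

Import Order.TTheory GRing.Theory Num.Theory.
Import numFieldNormedType.Exports.

Local Open Scope classical_set_scope.
Local Open Scope ring_scope.

(** * Norms and complex scalars *)

(** The definition of [ac_subspace] quantifies existentially over the resolution E, so two things
    must be settled before scattering begins. A resolution has to exist, otherwise the subspace
    would be empty. It is built from the growth of orbits: for a positive operator A the range of
    the spectral projection on ]-oo, l] consists of the x with |A^n x| <= l^n |x|, a description
    free of functional calculus. And the subspace must not depend on E; Bessel vectors settle this
    too, because their definition mentions S only through its exponential. For the same reason an
    isometric intertwiner maps Bessel vectors to Bessel vectors, so wave limits are absolutely
    continuous. The delicate point of the Cauchy estimate is uniformity in the lag d. The overlap of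
    W (m + d) and W m tends to |phi|^2 for each fixed d, at a rate depending on d; the telescoping
    sum from m to n is bounded independently of d and n, so n can go to infinity after d is fixed.
    Smallness of tau is used twice: the spectrum must fit into ]-pi/tau, pi/tau], and times between
    grid points are reached by norm continuity. *)

Lemma cvgr_dist0P (R : realType) (T : Type) (F : set_system T) (FF : Filter F)
    (u : T -> R) (l : R) :
  u @ F --> l <-> (fun t => `|u t - l|) @ F --> (0 : R).
Proof.
split=> h; first by apply/norm_cvg0P; apply/subr_cvg0.
by apply/subr_cvg0; apply/norm_cvg0P.
Qed.

Section RealNorm.
Variables (R : realType) (V : normedModType (Cplx R)).
Local Notation C := (Cplx R).
Implicit Types x y : V.

Lemma normrE x : `|x| = cofR (rnorm x).
Proof. by rewrite /cofR /rnorm RRe_real// ger0_real. Qed.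

Lemma cofR_inj : injective (@cofR R).
Proof. exact: complexI. Qed.

Lemma le_cofR (a b : R) : (cofR a <= cofR b) = (a <= b).
Proof. exact: lecR. Qed.

Lemma lt_cofR (a b : R) : (cofR a < cofR b) = (a < b).
Proof. exact: ltcR. Qed.

Lemma cofRD (a b : R) : cofR (a + b) = cofR a + cofR b.
Proof. exact: rmorphD. Qed.

Lemma cofRN (a : R) : cofR (- a) = - cofR a.
Proof. exact: rmorphN. Qed.

Lemma cofRM (a b : R) : cofR (a * b) = cofR a * cofR b.
Proof. exact: rmorphM. Qed.

Lemma rnormv_ge0 x : 0 <= rnorm x.
Proof. by rewrite -le_cofR -normrE /cofR rmorph0. Qed.

Lemma rnormv0 : rnorm (0 : V) = 0.
Proof. by rewrite /rnorm normr0. Qed.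

Lemma rnormvD x y : rnorm (x + y) <= rnorm x + rnorm y.
Proof. by rewrite -le_cofR cofRD -!normrE ler_normD. Qed.

Lemma rnormvZ (a : C) x : rnorm (a *: x) = rnorm a * rnorm x.
Proof. by apply: cofR_inj; rewrite cofRM -!normrE normrZ Defs.rnormE. Qed.

Lemma rnormvN x : rnorm (- x) = rnorm x.
Proof. by rewrite /rnorm normrN. Qed.

Lemma rnormvB x y : rnorm (x - y) = rnorm (y - x).
Proof. by rewrite -rnormvN opprB. Qed.

Lemma rnormv_eq0 x : (rnorm x == 0) = (x == 0).
Proof.
apply/idP/idP => [/eqP h|/eqP ->]; last by rewrite rnormv0.
by rewrite -normr_eq0 normrE h /cofR rmorph0.
Qed.

Lemma rnormv_dist (x y z : V) : rnorm (x - z) <= rnorm (x - y) + rnorm (y - z).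
Proof. by rewrite -[x - z](subrKA y) rnormvD. Qed.

Lemma rnormv_sum (I : Type) (r : seq I) (P : pred I) (F : I -> V) :
  rnorm (\sum_(i <- r | P i) F i) <= \sum_(i <- r | P i) rnorm (F i).
Proof.
elim/big_ind2 : _ => [|x1 x2 y1 y2 h1 h2|//]; first by rewrite rnormv0.
by rewrite (le_trans (rnormvD _ _))// lerD.
Qed.

Lemma rnormv_lip x y : `|rnorm x - rnorm y| <= rnorm (x - y).
Proof.
rewrite ler_norml; apply/andP; split.
  by have := rnormvD (y - x) x; rewrite subrK [rnorm (y - x)]rnormvB; lra.
by have := rnormvD (x - y) y; rewrite subrK; lra.
Qed.

Lemma cvg_rnormP (T : Type) (F : set_system T) (FF : Filter F) (u : T -> V)
    (l : V) :
  u @ F --> l <-> (fun t => rnorm (u t - l)) @ F --> (0 : R).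
Proof.
split=> h.
- apply/cvgrPdist_lt => e e0.
  have e0' : 0 < cofR e by rewrite -[0]/(cofR 0) lt_cofR.
  move/cvgrPdist_lt : h => /(_ _ e0'); apply: filterS => t.
  by rewrite normrE lt_cofR sub0r normrN ger0_norm ?rnormv_ge0// rnormvB.
- apply/cvgrPdist_lt => e e0.
  (* Distances in V take values in the complex numbers, so e is complex; positivity in the partial
     order forces it to be real. *)
  have [e' ee] : exists e', e = cofR e'.
    by exists (complex.Re e); rewrite /cofR RRe_real// gtr0_real.
  move: e0; rewrite ee -[0]/(cofR 0) lt_cofR => e0.
  move/cvgrPdist_lt : h => /(_ _ e0); apply: filterS => t.
  by rewrite normrE lt_cofR sub0r normrN ger0_norm ?rnormv_ge0// rnormvB.
Qed.

Lemma cvg_rnorm (T : Type) (F : set_system T) (FF : Filter F) (u : T -> V)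
    (l : V) :
  u @ F --> l -> (fun t => rnorm (u t)) @ F --> rnorm l.
Proof.
move=> /cvg_rnormP h; apply/cvgrPdist_lt => e e0.
move/cvgrPdist_lt : h => /(_ _ e0); apply: filterS => t; apply: le_lt_trans.
rewrite sub0r normrN [leRHS]ger0_norm ?rnormv_ge0// rnormvB.
exact: rnormv_lip.
Qed.

Lemma cvgn_rnormP (u : nat -> V) (l : V) :
  u @ \oo --> l <->
  forall e : R, 0 < e -> exists n0, forall n, (n0 <= n)%N -> rnorm (u n - l) <= e.
Proof.
rewrite cvg_rnormP; split=> [h e e0|h].
  move/cvgrPdist_le : h => /(_ _ e0) [n0 _ hn]; exists n0 => n /hn /=.
  by rewrite sub0r normrN ger0_norm// rnormv_ge0.
apply/cvgrPdist_le => e /h [n0 hn]; exists n0 => // n /hn /=.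
by rewrite sub0r normrN ger0_norm// rnormv_ge0.
Qed.

Lemma cvg_rnorm_le (u : nat -> V) (l : V) (e : R) :
  u @ \oo --> l -> (exists n0, forall n, (n0 <= n)%N -> rnorm (u n) <= e) ->
  rnorm l <= e.
Proof.
move=> /cvg_rnorm ul [n0 h]; apply: (cvgr_to_le ul).
by exists n0.
Qed.

End RealNorm.

Section ComplexField.
Variable R : realType.
Local Notation C := (Cplx R).
Local Notation Re := (@complex.Re R).
Local Notation Im := (@complex.Im R).
Implicit Types z w : C.

Lemma ReD z w : Re (z + w) = Re z + Re w.
Proof. exact: (raddfD (@complex.Re R)). Qed.

Lemma ReN z : Re (- z) = - Re z.
Proof. exact: (raddfN (@complex.Re R)). Qed.

Lemma ReB z w : Re (z - w) = Re z - Re w.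
Proof. exact: (raddfB (@complex.Re R)). Qed.

Lemma ImB z w : Im (z - w) = Im z - Im w.
Proof. exact: (raddfB (@complex.Im R)). Qed.

Lemma Re_sum (I : Type) (r : seq I) (P : pred I) (F : I -> C) :
  Re (\sum_(i <- r | P i) F i) = \sum_(i <- r | P i) Re (F i).
Proof. exact: (raddf_sum (@complex.Re R)). Qed.

Lemma Re_conj z : Re z^* = Re z.
Proof. by case: z. Qed.

Lemma rnorm_conj z : rnorm z^* = rnorm z.
Proof. by apply: (@cofR_inj R); rewrite -!normrE norm_conjC. Qed.

Lemma rnormcE z : rnorm z = Num.sqrt (Re z ^+ 2 + Im z ^+ 2).
Proof. by rewrite /rnorm; case: z => a b; rewrite normc_def. Qed.

Lemma rnorm_cofR (a : R) : rnorm (cofR a) = `|a|.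
Proof. by rewrite rnormcE /= expr0n addr0 sqrtr_sqr. Qed.

Lemma normr_Re z : `|Re z| <= rnorm z.
Proof.
by rewrite rnormcE -sqrtr_sqr ler_sqrt ?lerDl ?sqr_ge0// addr_ge0 ?sqr_ge0.
Qed.

Lemma normr_Im z : `|Im z| <= rnorm z.
Proof.
by rewrite rnormcE -sqrtr_sqr ler_sqrt ?lerDr ?sqr_ge0// addr_ge0 ?sqr_ge0.
Qed.

Lemma rnorm_ReIm z : rnorm z <= `|Re z| + `|Im z|.
Proof.
rewrite rnormcE -[leRHS]ger0_norm ?addr_ge0// -sqrtr_sqr ler_sqrt ?sqr_ge0//.
by rewrite sqrrD !real_normK ?num_real// lerD2r lerDl mulrn_wge0// mulr_ge0.
Qed.

Lemma conj_cofR (a : R) : (cofR a : C)^* = cofR a.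
Proof. by apply/eqP; rewrite eq_complex /= oppr0 !eqxx. Qed.

Lemma Re_cofRM (a : R) z : Re (cofR a * z) = a * Re z.
Proof. by case: z => p q /=; rewrite mul0r subr0. Qed.

Lemma sqr_rnorm_conj z : z^* * z = cofR (rnorm z ^+ 2).
Proof. by rewrite -normCKC normrE /cofR -rmorphXn. Qed.

Lemma cvg_conj (T : Type) (F : set_system T) (FF : Filter F) (u : T -> C)
    (l : C) :
  u @ F --> l -> (fun t => (u t)^*) @ F --> l^*.
Proof.
move=> /cvg_rnormP h; apply/cvg_rnormP; apply: cvg_trans h.
by apply: near_eq_cvg; apply: nearW => t; rewrite -rmorphB rnorm_conj.
Qed.

(** Real and imaginary parts converge absolutely by comparison with b. *)
Lemma is_cvg_series_rnorm (u : nat -> C) (b : nat -> R) :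
  (forall n, rnorm (u n) <= b n) -> cvgn (series b) -> cvgn (series u).
Proof.
move=> ub cb.
have part (f : C -> R) : (forall z, `|f z| <= rnorm z) ->
    cvgn (series (fun n => f (u n))).
  move=> fz; apply: normed_cvg; apply: series_le_cvg cb => n //=.
    by apply: le_trans (ub n); exact: rnormv_ge0.
  exact: le_trans (ub n).
have /cvg_ex[/= a ha] := part _ normr_Re.
have /cvg_ex[/= b' hb] := part _ normr_Im.
suff : series u @ \oo --> (Complex a b' : C) by move=> /cvgP.
apply/cvg_rnormP.
have h0 : (fun n => `|series (fun n => Re (u n)) n - a| +
    `|series (fun n => Im (u n)) n - b'|) @ \oo --> (0 : R).
  rewrite -[0]addr0; apply: cvgD.
    exact: (proj1 (cvgr_dist0P _ _ _) ha).
  exact: (proj1 (cvgr_dist0P _ _ _) hb).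
apply: (squeeze_cvgr _ (cvg_cst 0) h0); apply: nearW => n.
rewrite rnormv_ge0/=; apply: le_trans (rnorm_ReIm _) _.
rewrite ReB ImB /series /= Re_sum.
by rewrite (raddf_sum (@complex.Im R)).
Qed.

End ComplexField.

Lemma inv_succ_small (R : realType) (c e : R) : 0 < e ->
  exists n0, forall n, (n0 <= n)%N -> c * n.+1%:R^-1 <= e.
Proof.
move=> e0; exists (Num.bound `|c / e|) => n hn.
rewrite ler_pdivrMr ?ltr0n// mulrC -ler_pdivrMr//.
apply: le_trans (ler_norm _) (ltW _); apply: lt_le_trans (archi_boundP _) _ => //.
by rewrite ler_nat ltnW.
Qed.

Lemma inv_succ_itv (R : realType) n : 0 < (n.+1%:R^-1 : R) <= 1.
Proof. by rewrite invr_gt0 ltr0n invf_le1 ?ler1n ?ltr0n. Qed.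

Lemma ler_sqr_nneg (R : realType) (a b : R) : 0 <= a -> a <= b ->
  a ^+ 2 <= b ^+ 2.
Proof.
by move=> a0 ab; rewrite ler_pXn2r ?nnegrE// (le_trans a0).
Qed.

Lemma cvg_sumv (K : numFieldType) (V : normedModType K) (I T : Type)
    (r : seq I) (P : pred I) (F : set_system T) (FF : Filter F)
    (f : I -> T -> V) (l : I -> V) :
  (forall i, P i -> f i @ F --> l i) ->
  (fun t => \sum_(i <- r | P i) f i t) @ F --> \sum_(i <- r | P i) l i.
Proof.
move=> h; elim: r => [|i r IH].
  by under eq_fun do rewrite big_nil; rewrite big_nil; exact: cvg_cst.
under eq_fun do rewrite big_cons; rewrite big_cons.
by case: ifPn => // Pi; apply: cvgD => //; exact: h.
Qed.

(** * Hilbert spaces *)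

Section Inner.
Variables (R : realType) (N : nat).
Local Notation C := (Cplx R).
Local Notation H := (l2 R N).
Local Notation Re := (@complex.Re R).
Implicit Types (x y z : 'cV[C]_N) (phi psi chi : H).

Definition dot x y : C := \sum_(i < N) (x i ord0)^* * y i ord0.

Lemma dotD x y z : dot x (y + z) = dot x y + dot x z.
Proof.
by rewrite /dot -big_split; apply: eq_bigr => i _; rewrite mxE mulrDr.
Qed.

Lemma dotZ (a : C) x y : dot x (a *: y) = a * dot x y.
Proof. by rewrite /dot mulr_sumr; apply: eq_bigr => i _; rewrite mxE mulrCA. Qed.

Lemma dot_conj x y : (dot x y)^* = dot y x.
Proof.
rewrite /dot rmorph_sum; apply: eq_bigr => i _.
by rewrite rmorphM /= conjCK mulrC.
Qed.

Lemma dotxx x : dot x x = cofR (enorm x ^+ 2).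
Proof.
rewrite /enorm sqr_sqrtr ?sumr_ge0// => [|i _]; last exact: sqr_ge0.
rewrite /cofR raddf_sum; apply: eq_bigr => i _.
by rewrite -normCKC normrE /cofR -rmorphXn.
Qed.

Lemma rnorm_dot x y : rnorm (dot x y) <= enorm x * enorm y.
Proof.
apply: le_trans (rnormv_sum _ _ _) _.
rewrite /enorm -sqrtrM ?sumr_ge0// => [|i _]; last exact: sqr_ge0.
rewrite -[leLHS]ger0_norm ?sumr_ge0// => [|i _]; last exact: rnormv_ge0.
rewrite -sqrtr_sqr ler_sqrt ?mulr_ge0 ?sumr_ge0// => [|i _|i _]; last 2 first.
- exact: sqr_ge0.
- exact: sqr_ge0.
under eq_bigr do rewrite rnormM rnorm_conj.
exact: cauchy_schwarz_sum.
Qed.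

Lemma rnorm_coord x i : rnorm (x i ord0) <= enorm x.
Proof.
rewrite -[leLHS]ger0_norm ?rnormv_ge0// -sqrtr_sqr ler_sqrt.
  by rewrite (bigD1 i)//= lerDl sumr_ge0// => j _; exact: sqr_ge0.
by apply: sumr_ge0 => j _; exact: sqr_ge0.
Qed.

Lemma cvg_l2norm psi :
  series (fun n => enorm (psi n) ^+ 2) @ \oo --> rnorm psi ^+ 2.
Proof.
have pos n : (0 <= (enorm (psi n) ^+ 2)%:E)%E by rewrite lee_fin sqr_ge0.
have h : (fun n => \sum_(0 <= i < n) (enorm (psi i) ^+ 2)%:E)%E @ \oo -->
    sqsum psi by apply: is_cvg_nneseries => n _ _.
rewrite l2normE /l2norm sqr_sqrtr ?fine_ge0 ?sqsum_ge0//.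
rewrite -[sqsum psi]fineK ?ge0_fin_numE ?sqsum_ge0 ?l2norm_fin// in h.
move/fine_cvgP : h => [_]; apply: cvg_trans; apply: near_eq_cvg.
by apply: nearW => n /=; rewrite sumEFin.
Qed.

Lemma is_cvg_inner phi psi : cvgn (series (fun n => dot (phi n) (psi n))).
Proof.
apply: (@is_cvg_series_rnorm _ _
  (fun n => enorm (phi n) ^+ 2 + enorm (psi n) ^+ 2)) => [n|].
  apply: le_trans (rnorm_dot _ _) _.
  (* Expanding this square gives ab <= a^2 + b^2, a summable majorant. *)
  have := sqr_ge0 (enorm (phi n) - enorm (psi n)).
  have := sqr_ge0 (enorm (phi n)); have := sqr_ge0 (enorm (psi n)).
  by rewrite sqrrB; nra.
apply: is_cvg_seriesD; apply: cvgP; exact: cvg_l2norm.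
Qed.

Lemma cvg_inner_series phi psi :
  series (fun n => dot (phi n) (psi n)) @ \oo --> (inner phi psi : C).
Proof. exact: is_cvg_inner. Qed.

Lemma inner_unique phi psi (l : C) :
  series (fun n => dot (phi n) (psi n)) @ \oo --> l -> inner phi psi = l.
Proof. by move=> h; apply: cvg_lim => //; exact: norm_hausdorff. Qed.

Lemma innerDZr phi psi chi (a : C) :
  inner phi (a *: psi + chi) = a * inner phi psi + inner phi chi.
Proof.
apply: inner_unique.
have -> : series (fun n => dot (phi n) ((a *: psi + chi : H) n)) =
    a *: series (fun n => dot (phi n) (psi n)) +
    series (fun n => dot (phi n) (chi n)).
  apply/funext => n; rewrite /series /= -[RHS]/(a * _ + _) mulr_sumr -big_split.
  by apply: eq_bigr => k _; rewrite /= -dotZ -dotD.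
by apply: cvgD; [apply: cvgZr|]; exact: cvg_inner_series.
Qed.

Lemma inner_conj phi psi : (inner phi psi)^* = inner psi phi.
Proof.
apply/esym/inner_unique.
rewrite (_ : series _ = fun n => (series (fun n => dot (phi n) (psi n)) n)^*).
  by apply: cvg_conj; exact: cvg_inner_series.
apply/funext => n; rewrite /series /= raddf_sum.
by apply: eq_bigr => k _; rewrite /= dot_conj.
Qed.

Lemma innerxx psi : inner psi psi = cofR (rnorm psi ^+ 2).
Proof.
apply: inner_unique.
rewrite (_ : series _ = fun n => cofR (series (fun n => enorm (psi n) ^+ 2) n)).
  apply/cvg_rnormP; have /cvgr_dist0P := @cvg_l2norm psi.
  by apply: cvg_trans; apply: near_eq_cvg; apply: nearW => n /=;
    rewrite -cofRN -cofRD rnorm_cofR.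
apply/funext => n; rewrite /series /= /cofR raddf_sum.
by apply: eq_bigr => k _; rewrite /= dotxx.
Qed.

End Inner.

Section Completeness.
Variables (R : realType) (N : nat).
Local Notation C := (Cplx R).
Local Notation H := (l2 R N).
Local Notation Re := (@complex.Re R).
Local Notation Im := (@complex.Im R).
Implicit Types (psi phi : H).

Definition cauchy_sequence (V : normedModType C) (u : nat -> V) :=
  forall e : R, 0 < e -> exists n0, forall m n, (n0 <= m)%N -> (n0 <= n)%N ->
    rnorm (u m - u n) <= e.

Lemma real_cauchy_cvg (u : nat -> R) :
  (forall e : R, 0 < e -> exists n0, forall m n, (n0 <= m)%N -> (n0 <= n)%N ->
    `|u m - u n| <= e) -> cvgn u.
Proof.
move=> h; apply: cauchy_cvg; apply: cauchy_exP => e e0.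
have /h[n0 hn] : 0 < e / 2 by rewrite divr_gt0.
exists (u n0); exists n0 => // n /= n0n; rewrite /ball /=.
by apply: le_lt_trans (hn _ _ (leqnn _) n0n) _; lra.
Qed.

Lemma complex_cauchy_cvg (u : nat -> C) :
  cauchy_sequence (u : nat -> C^o) -> exists l : C, u @ \oo --> l.
Proof.
move=> cu.
have part (f : C -> R) : (forall z w : C, `|f z - f w| <= rnorm (z - w)) ->
    cvgn (fun n => f (u n)).
  move=> fz; apply: real_cauchy_cvg => e /cu[n0 hn]; exists n0 => m n nm nn.
  exact: le_trans (fz _ _) (hn _ _ nm nn).
have /part/cvg_ex[/= a ha] : forall z w : C, `|Re z - Re w| <= rnorm (z - w).
  by move=> z w; rewrite -ReB normr_Re.
have /part/cvg_ex[/= b hb] : forall z w : C, `|Im z - Im w| <= rnorm (z - w).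
  by move=> z w; rewrite -ImB normr_Im.
suff : u @ \oo --> (Complex a b : C) by move=> h; exists (Complex a b).
apply/cvg_rnormP.
have h0 : (fun n => `|Re (u n) - a| + `|Im (u n) - b|) @ \oo --> (0 : R).
  rewrite -[0]addr0; apply: cvgD.
    exact: (proj1 (cvgr_dist0P _ _ _) ha).
  exact: (proj1 (cvgr_dist0P _ _ _) hb).
apply: (squeeze_cvgr _ (cvg_cst 0) h0); apply: nearW => n.
rewrite rnormv_ge0/=; apply: le_trans (rnorm_ReIm _) _.
by rewrite ReB ImB.
Qed.

Lemma enorm_sqr (x : 'cV[C]_N) :
  enorm x ^+ 2 = \sum_(i < N) rnorm (x i ord0) ^+ 2.
Proof. by rewrite sqr_sqrtr// sumr_ge0// => i _; exact: sqr_ge0. Qed.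

Lemma sum_enorm_le psi (K : nat) :
  \sum_(0 <= k < K) enorm (psi k) ^+ 2 <= rnorm psi ^+ 2.
Proof.
have := sqsum_part K (l2norm_fin psi).
rewrite l2normE -[X in _ <= X]/(l2norm psi) => h.
rewrite -[leLHS]sqr_sqrtr ?sumr_ge0// => [|i _]; last exact: sqr_ge0.
by rewrite ler_pXn2r ?nnegrE ?sqrtr_ge0.
Qed.

Lemma enorm_le_rnorm psi n : enorm (psi n) <= rnorm psi.
Proof.
rewrite -(@ler_pXn2r _ 2) ?nnegrE ?enorm_ge0 ?rnormv_ge0//.
apply: le_trans (sum_enorm_le psi n.+1); rewrite big_nat_recr//= lerDr.
by rewrite sumr_ge0// => k _; exact: sqr_ge0.
Qed.

Lemma rnorm_le_partial psi (M : R) : 0 <= M ->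
  (forall K, \sum_(0 <= k < K) enorm (psi k) ^+ 2 <= M ^+ 2) -> rnorm psi <= M.
Proof.
move=> M0 h; rewrite l2normE /l2norm -[leRHS]ger0_norm// -sqrtr_sqr.
rewrite ler_sqrt ?sqr_ge0// -lee_fin fineK ?ge0_fin_numE ?sqsum_ge0 ?l2norm_fin//.
apply: sqsum_le => // K; rewrite -[leRHS]ger0_norm// -sqrtr_sqr.
by rewrite ler_sqrt ?sqr_ge0.
Qed.

Lemma sqsummable_partial (u : nat -> 'cV[C]_N) (M : R) : 0 <= M ->
  (forall K, \sum_(0 <= k < K) enorm (u k) ^+ 2 <= M ^+ 2) -> u \in @sqsummable R N.
Proof.
move=> M0 h; rewrite inE; apply: le_lt_trans (ltry (M ^+ 2)).
apply: sqsum_le => // K; rewrite -[leRHS]ger0_norm// -sqrtr_sqr.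
by rewrite ler_sqrt ?sqr_ge0.
Qed.

(** Coordinates converge, and the Cauchy estimate on the first K terms survives the limit in the
    second index. Its uniformity in K yields both membership of the limit in [l2] and convergence in
    norm. *)
Theorem l2_complete (u : nat -> H) : cauchy_sequence u ->
  exists l : H, u @ \oo --> l.
Proof.
move=> cu.
have /choice[f hf] (n : nat) : exists x : 'cV[C]_N,
    forall i, (fun m => (u m n : 'cV[C]_N) i ord0) @ \oo --> (x i ord0 : C).
  have /choice[g hg] (i : 'I_N) : exists z : C,
      (fun m => (u m n : 'cV[C]_N) i ord0) @ \oo --> z.
    apply: complex_cauchy_cvg => e /cu[n0 hn]; exists n0 => m p nm np.
    apply: le_trans (hn _ _ nm np); apply: le_trans (enorm_le_rnorm _ n).
    apply: le_trans (rnorm_coord _ i).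
    by rewrite !mxE.
  by exists (\col_i g i) => i; rewrite mxE.
have part (e : R) : 0 < e -> exists n0, forall m, (n0 <= m)%N -> forall K,
    \sum_(0 <= k < K) enorm (u m k - f k) ^+ 2 <= e ^+ 2.
  move=> e0; have [n0 hn] := cu _ e0; exists n0 => m nm K.
  have lim : (fun p => \sum_(0 <= k < K) enorm ((u m - u p : H) k) ^+ 2) @ \oo -->
      \sum_(0 <= k < K) enorm (u m k - f k) ^+ 2.
    apply: cvg_sumv => k _; rewrite enorm_sqr.
    under eq_fun do rewrite enorm_sqr.
    apply: cvg_sumv => i _.
    under eq_fun do rewrite expr2 !mxE.
    by rewrite expr2 !mxE; apply: cvgM; apply: cvg_rnorm; apply: cvgB;
      [exact: cvg_cst|exact: hf|exact: cvg_cst|exact: hf].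
  apply: (cvgr_to_le lim); exists n0 => // p /= np.
  apply: (le_trans (sum_enorm_le (u m - u p) K)).
  by rewrite ler_pXn2r ?nnegrE ?rnormv_ge0 ?(ltW e0)//; exact: hn.
have fP : f \in @sqsummable R N.
  have [n0 hn] := part _ ltr01.
  (* The limit differs from one term of the sequence by a square summable sequence. *)
  have -> : f = (u n0 : nat -> 'cV[C]_N) - (fun k => u n0 k - f k).
    by apply/funext => k; rewrite /= subKr.
  rewrite rpredB//; first exact: l2P.
  by apply: (@sqsummable_partial _ 1) => // K; exact: hn.
exists (L2 fP); apply/cvgn_rnormP => e e0.
have [n0 hn] := part _ e0; exists n0 => n nn.
by apply: rnorm_le_partial; [exact: ltW|move=> K; exact: hn].
Qed.

End Completeness.

(** Separates the operator theory from coordinates: only the Toeplitz part and the final conversion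
    return to [l2]. As for [inner], the product is conjugate linear on the left. *)
Record hilbert (R : realType) := Hilbert {
  hsort :> normedModType (Cplx R);
  ip : hsort -> hsort -> Cplx R;
  ipDZr : forall x y z (a : Cplx R), ip x (a *: y + z) = a * ip x y + ip x z;
  ip_conj : forall x y, (ip x y)^* = ip y x;
  ipxx : forall x, ip x x = cofR (rnorm x ^+ 2);
  hilbert_complete : forall u : nat -> hsort, cauchy_sequence u ->
    exists l : hsort, u @ \oo --> l }.

Definition l2_hilbert (R : realType) (N : nat) : hilbert R :=
  @Hilbert R (l2 R N) (@inner R N) (@innerDZr R N) (@inner_conj R N)
    (@innerxx R N) (@l2_complete R N).

Section Inner.
Variables (R : realType) (H : hilbert R).
Local Notation C := (Cplx R).
Local Notation Re := (@complex.Re R).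
Implicit Types (phi psi chi x y z : H).

Definition hsymmetric (S : H -> H) := forall x y, ip x (S y) = ip (S x) y.

Lemma ipDr phi psi chi : ip phi (psi + chi) = ip phi psi + ip phi chi.
Proof. by rewrite -{1}[psi]scale1r ipDZr mul1r. Qed.

Lemma ip0r phi : ip phi 0 = 0.
Proof. by apply: (addrI (ip phi 0)); rewrite -ipDr !addr0. Qed.

Lemma ipZr phi psi (a : C) : ip phi (a *: psi) = a * ip phi psi.
Proof. by rewrite -[a *: psi]addr0 ipDZr ip0r addr0. Qed.

Lemma ipNr phi psi : ip phi (- psi) = - ip phi psi.
Proof. by rewrite -scaleN1r ipZr mulN1r. Qed.

Lemma ipBr phi psi chi : ip phi (psi - chi) = ip phi psi - ip phi chi.
Proof. by rewrite ipDr ipNr. Qed.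

Lemma ipDl phi psi chi : ip (phi + psi) chi = ip phi chi + ip psi chi.
Proof. by rewrite -ip_conj ipDr rmorphD /= !ip_conj. Qed.

Lemma ipZl phi psi (a : C) : ip (a *: phi) psi = a^* * ip phi psi.
Proof. by rewrite -ip_conj ipZr rmorphM /= ip_conj. Qed.

Lemma ipNl phi psi : ip (- phi) psi = - ip phi psi.
Proof. by rewrite -ip_conj ipNr rmorphN /= ip_conj. Qed.

Lemma ipBl phi psi chi : ip (phi - psi) chi = ip phi chi - ip psi chi.
Proof. by rewrite ipDl ipNl. Qed.

Lemma ip0l phi : ip 0 phi = 0.
Proof. by rewrite -ip_conj ip0r rmorph0. Qed.

Lemma ip_sumr (I : Type) (r : seq I) (P : pred I) (F : I -> H) phi :
  ip phi (\sum_(i <- r | P i) F i) = \sum_(i <- r | P i) ip phi (F i).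
Proof. exact: (big_morph _ (ipDr phi) (ip0r phi)). Qed.

Lemma ip_suml (I : Type) (r : seq I) (P : pred I) (F : I -> H) phi :
  ip (\sum_(i <- r | P i) F i) phi = \sum_(i <- r | P i) ip (F i) phi.
Proof.
elim/big_rec2 : _ => [|i a b _ <-]; first exact: ip0l.
exact: ipDl.
Qed.

Lemma Re_ipC phi psi : Re (ip phi psi) = Re (ip psi phi).
Proof. by rewrite -ip_conj Re_conj. Qed.

Lemma rnorm_ipC phi psi : rnorm (ip phi psi) = rnorm (ip psi phi).
Proof. by rewrite -ip_conj rnorm_conj. Qed.

Lemma Re_ipxx psi : Re (ip psi psi) = rnorm psi ^+ 2.
Proof. by rewrite ipxx. Qed.

Lemma rnormD_sqr phi psi : rnorm (phi + psi) ^+ 2 =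
  rnorm phi ^+ 2 + rnorm psi ^+ 2 + 2 * Re (ip phi psi).
Proof.
rewrite -!Re_ipxx ipDr !ipDl !ReD (Re_ipC psi phi); ring.
Qed.

Lemma rnormB_sqr phi psi : rnorm (phi - psi) ^+ 2 =
  rnorm phi ^+ 2 + rnorm psi ^+ 2 - 2 * Re (ip phi psi).
Proof. by rewrite rnormD_sqr rnormvN ipNr ReN; ring. Qed.

Lemma parallelogram phi psi : rnorm (phi + psi) ^+ 2 + rnorm (phi - psi) ^+ 2 =
  2 * rnorm phi ^+ 2 + 2 * rnorm psi ^+ 2.
Proof. by rewrite rnormD_sqr rnormB_sqr; ring. Qed.

Lemma rnormD_orth phi psi : ip phi psi = 0 ->
  rnorm (phi + psi) ^+ 2 = rnorm phi ^+ 2 + rnorm psi ^+ 2.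
Proof. by move=> h; rewrite rnormD_sqr h /= mulr0 addr0. Qed.

End Inner.

(** * Cauchy-Schwarz for forms that are nonnegative on a subspace *)

Section PositiveForm.
Variables (R : realType) (H : hilbert R).
Local Notation C := (Cplx R).
Local Notation Re := (@complex.Re R).

(** Discriminant argument. The subspace V matters because later operators have a sign or a bound
    only on the range of some other operator. *)
Lemma form_cauchy_schwarz (A : {linear H -> H}) (V : set H) :
  hsymmetric A ->
  (forall (a : C) x y, V x -> V y -> V (a *: x + y)) ->
  (forall x, V x -> 0 <= Re (ip x (A x))) ->
  forall x y, V x -> V y ->
    rnorm (ip x (A y)) ^+ 2 <= Re (ip x (A x)) * Re (ip y (A y)).
Proof.
move=> sA VV A0 x y Vx Vy.
set b := ip x (A y).
have sqb : b^* * b = cofR (rnorm b ^+ 2) by exact: sqr_rnorm_conj.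
(* The form at y - t b x with t real: the factor b turns the cross terms into -2 t |b|^2. *)
have key (t : R) : 0 <= Re (ip x (A x)) * (t ^+ 2 * rnorm b ^+ 2) +
    Re (ip y (A y)) - 2 * t * rnorm b ^+ 2.
  have := A0 _ (VV (- (cofR t * b)) x y Vx Vy).
  set a := - _; rewrite linearD linearZ /= ipDr !ipDl !ipZr !ipZl.
  have -> : ip y (A x) = b^* by rewrite /b ip_conj sA.
  rewrite -/b /a rmorphN rmorphM /=.
  have -> : (cofR t : C)^* = cofR t by exact: conj_cofR.
  set u := ip x (A x); set w := ip y (A y).
  have -> : - (cofR t * b) * (- (cofR t * b^*) * u) + - (cofR t * b) * b^* +
    (- (cofR t * b^*) * b + w) =
    cofR (t ^+ 2 * rnorm b ^+ 2) * u + w - cofR (2 * t * rnorm b ^+ 2).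
    rewrite (cofRM (t ^+ 2) (rnorm b ^+ 2)) (cofRM (2 * t)) (cofRM 2 t) -sqb.
    rewrite /cofR rmorphXn rmorph_nat /=; ring.
  by rewrite ReB ReD Re_cofRM /= (mulrC _ (Re u)).
have [b0|b0] := eqVneq (rnorm b) 0.
  by rewrite b0 expr0n mulr_ge0 ?A0.
have b2 : 0 < rnorm b ^+ 2 by rewrite exprn_gt0// lt_neqAle eq_sym b0 rnormv_ge0.
move: key (A0 _ Vx) (A0 _ Vy) b2.
set p := Re _; set q := Re _; set s := rnorm b ^+ 2 => key p0 q0 s0.
have [p00|pn0] := eqVneq p 0.
  (* With p = 0 the quadratic is the affine function q - 2 t s, negative at this t. *)
  exfalso; have := key ((q + 1) / s); rewrite p00 mul0r add0r.
  rewrite -mulrA divfK ?gt_eqF//; lra.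
have pp : 0 < p by rewrite lt_neqAle eq_sym pn0.
(* The minimum of the quadratic in t. *)
have := key p^-1.
rewrite -(ler_pM2r pp) mul0r mulrDl mulrDl mulNr.
have -> : p * (p^-1 ^+ 2 * s) * p = s by field.
have -> : 2 * p^-1 * s * p = 2 * s by field.
by rewrite (mulrC q); lra.
Qed.

Lemma ip_cauchy_schwarz (x y : H) : rnorm (ip x y) <= rnorm x * rnorm y.
Proof.
have := @form_cauchy_schwarz idfun setT (fun _ _ => erefl) (fun _ _ _ _ _ => I).
move=> /(_ _ x y I I) /=; rewrite !Re_ipxx -exprMn => h.
rewrite -(@ler_pXn2r _ 2) ?nnegrE ?mulr_ge0 ?rnormv_ge0//; apply: h.
by move=> z _; rewrite Re_ipxx sqr_ge0.
Qed.

Lemma Re_ip_le (x y : H) : Re (ip x y) <= rnorm x * rnorm y.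
Proof.
by apply: le_trans (ip_cauchy_schwarz x y); apply: le_trans (normr_Re _);
  exact: ler_norm.
Qed.

(* Apply Cauchy-Schwarz for the form of A to x and A x. *)
Lemma form_bound_rnorm (A : {linear H -> H}) (V : set H) (l : R) :
  hsymmetric A ->
  (forall (a : C) x y, V x -> V y -> V (a *: x + y)) ->
  (forall x, V x -> V (A x)) -> 0 <= l ->
  (forall x, V x -> 0 <= Re (ip x (A x)) <= l * rnorm x ^+ 2) ->
  forall x, V x -> rnorm (A x) <= l * rnorm x.
Proof.
move=> sA VV VA l0 bA x Vx.
have := @form_cauchy_schwarz A V sA VV _ (A x) x (VA _ Vx) Vx.
rewrite ipxx rnorm_cofR => /(_ (fun z Vz => proj1 (andP (bA z Vz)))).
rewrite ger0_norm ?sqr_ge0// => h.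
have /andP[a0 al] := bA _ (VA _ Vx); have /andP[b0 bl] := bA _ Vx.
have {}h : (rnorm (A x) ^+ 2) ^+ 2 <= (l * rnorm (A x) ^+ 2) * (l * rnorm x ^+ 2).
  by apply: le_trans h _; exact: ler_pM.
have [->|Ax0] := eqVneq (rnorm (A x)) 0; first by rewrite mulr_ge0 ?rnormv_ge0.
have Axp : 0 < rnorm (A x) ^+ 2.
  by rewrite exprn_gt0// lt_neqAle eq_sym Ax0 rnormv_ge0.
rewrite -(@ler_pXn2r _ 2) ?nnegrE ?mulr_ge0 ?rnormv_ge0//.
by rewrite -(ler_pM2l Axp); apply: le_trans h _; rewrite exprMn; nra.
Qed.

Lemma ip_eq0P (x : H) : (forall y, ip y x = 0) -> x = 0.
Proof.
move=> /(_ x)/(congr1 Re); rewrite Re_ipxx /= => /eqP.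
by rewrite sqrf_eq0 rnormv_eq0 => /eqP.
Qed.

Lemma cvg_ip (T : Type) (F : set_system T) (FF : Filter F) (u : T -> H)
    (l x : H) :
  u @ F --> l -> (fun t => ip x (u t)) @ F --> (ip x l : C).
Proof.
move=> /cvg_rnormP h; apply/cvg_rnormP.
have h0 : (fun t => rnorm x * rnorm (u t - l)) @ F --> (0 : R).
  by rewrite -(mulr0 (rnorm x)); apply: cvgMr.
apply: (squeeze_cvgr _ (cvg_cst 0) h0); apply: nearW => t.
by rewrite rnormv_ge0/= -ipBr ip_cauchy_schwarz.
Qed.

End PositiveForm.

Section Linear.
Variables (R : realType) (H : hilbert R).
Local Notation C := (Cplx R).
Local Notation Re := (@complex.Re R).
Implicit Types (x y z : H).

Definition linear_of (f : H -> H)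
    (lf : forall (a : C) x y, f (a *: x + y) = a *: f x + f y) :
    {linear H -> H} :=
  HB.pack f (@GRing.isLinear.Build C H H *:%R f lf).

Definition op_bound (f : H -> H) (m : R) := forall x, rnorm (f x) <= m * rnorm x.

Lemma cvg_bounded (f : {linear H -> H}) (m : R) (T : Type) (F : set_system T)
    (FF : Filter F) (u : T -> H) (l : H) :
  op_bound f m -> u @ F --> l -> (fun t => f (u t)) @ F --> f l.
Proof.
move=> bf /cvg_rnormP h; apply/cvg_rnormP.
have h0 : (fun t => m * rnorm (u t - l)) @ F --> (0 : R).
  by rewrite -(mulr0 m); apply: cvgMr.
apply: (squeeze_cvgr _ (cvg_cst 0) h0); apply: nearW => t.
by rewrite rnormv_ge0/= -linearB; exact: bf.
Qed.

Lemma op_boundW (f : H -> H) (m m' : R) :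
  m <= m' -> op_bound f m -> op_bound f m'.
Proof.
by move=> mm h x; apply: le_trans (h x) _; rewrite ler_wpM2r ?rnormv_ge0.
Qed.

Lemma op_bound_iter (f : H -> H) (m : R) k :
  0 <= m -> op_bound f m -> op_bound (iter k f) (m ^+ k).
Proof.
move=> m0 h; elim: k => [|k IH] x; first by rewrite expr0 mul1r.
by rewrite iterS exprS -mulrA (le_trans (h _))// ler_wpM2l.
Qed.

Lemma cvg_uniq (u : nat -> H) x y : u @ \oo --> x -> u @ \oo --> y -> x = y.
Proof. by move=> hx hy; exact: (cvg_unique (@norm_hausdorff _ _) hx hy). Qed.

End Linear.

(** * Orthogonal projection onto a closed subspace *)

Section Projection.
Variables (R : realType) (H : hilbert R).
Local Notation C := (Cplx R).
Local Notation Re := (@complex.Re R).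
Implicit Types (x y z : H) (V : set H).

Record closed_subspace V : Prop := ClosedSubspace {
  cs0 : V 0;
  csDZ : forall (a : C) x y, V x -> V y -> V (a *: x + y);
  cs_cvg : forall (u : nat -> H) x, (forall n, V (u n)) -> u @ \oo --> x -> V x }.

Lemma csD V x y : closed_subspace V -> V x -> V y -> V (x + y).
Proof. by move=> VV Vx Vy; rewrite -[x]scale1r; exact: csDZ. Qed.

Lemma csZ V (a : C) x : closed_subspace V -> V x -> V (a *: x).
Proof. by move=> VV Vx; rewrite -[_ *: x]addr0; apply: csDZ => //; exact: cs0. Qed.

Lemma csB V x y : closed_subspace V -> V x -> V y -> V (x - y).
Proof. by move=> VV Vx Vy; rewrite addrC -scaleN1r; exact: csDZ. Qed.

(** A minimizing sequence is Cauchy by the parallelogram identity, because the midpoint of two of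
    its terms stays in V and is no closer to x than the infimum d. *)
Lemma nearest_point V x : closed_subspace V ->
  exists2 p, V p & forall z, V z -> rnorm (x - p) <= rnorm (x - z).
Proof.
move=> VV; pose D := [set rnorm (x - z) | z in V].
have hD : has_inf D.
  split; first by exists (rnorm (x - 0)), 0 => //; exact: cs0.
  by exists 0 => _ [z _ <-]; exact: rnormv_ge0.
pose d := inf D.
have d0 : 0 <= d.
  by apply: lb_le_inf => [|_ [z _ <-]]; [exact: hD.1|exact: rnormv_ge0].
have dle z : V z -> d <= rnorm (x - z) by move=> Vz; apply: ge_inf; [exact: hD.2|exists z].
have /choice[u hu] (n : nat) : exists z, V z /\ rnorm (x - z) <= d + n.+1%:R^-1.
  have n0 : 0 < n.+1%:R^-1 :> R by rewrite invr_gt0.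
  by have [_ [z Vz <-] /ltW h] := inf_adherent n0 hD; exists z.
have near m n : rnorm (u m - u n) ^+ 2 <=
    4 * (d * (m.+1%:R^-1 + n.+1%:R^-1)) + 2 * (m.+1%:R^-1 ^+ 2 + n.+1%:R^-1 ^+ 2).
  have [Vm hm] := hu m; have [Vn hn] := hu n.
  have := parallelogram (x - u m) (x - u n).
  have -> : x - u m - (x - u n) = - (u m - u n) by rewrite !opprB addrC addrA subrK.
  rewrite rnormvN.
  have -> : x - u m + (x - u n) = cofR 2 *: (x - 2^-1 *: (u m + u n)).
    rewrite /cofR rmorph_nat.
    rewrite scalerBr scalerA divff ?pnatr_eq0// scale1r scaler_nat mulr2n.
    by rewrite opprD addrACA.
  have /dle hd : V (2^-1 *: (u m + u n)) by apply: csZ => //; exact: csD.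
  rewrite rnormvZ rnorm_cofR ger0_norm// => hp.
  have a0 : 0 < m.+1%:R^-1 :> R by rewrite invr_gt0.
  have b0 : 0 < n.+1%:R^-1 :> R by rewrite invr_gt0.
  move: hp hd hm hn a0 b0 (dle _ Vm) (dle _ Vn).
  set p := rnorm (u m - u n); set q := rnorm (x - 2^-1 *: _).
  set a := rnorm (x - u m); set b := rnorm (x - u n).
  set s := m.+1%:R^-1; set t := n.+1%:R^-1 => hp hd hm hn a0 b0 da db.
  have {hD dle hu} := d0.
  clearbody p q a b s t d => d0'.
  have ha : a ^+ 2 <= (d + s) ^+ 2 by apply: ler_sqr_nneg; lra.
  have hb : b ^+ 2 <= (d + t) ^+ 2 by apply: ler_sqr_nneg; lra.
  have hq : d ^+ 2 <= q ^+ 2 by apply: ler_sqr_nneg; lra.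
  rewrite exprMn in hp; move: hp ha hb hq {hd hm hn a0 b0 da db}.
  rewrite !sqrrD; lra.
have cu : cauchy_sequence u.
  move=> e e0.
  (* With s = 1 / (m + 1) and t = 1 / (n + 1), both at most 1, the bound of [near] is at most (4 d +
     2)(s + t), hence at most e^2 once (8 d + 4) s and (8 d + 4) t are. *)
  have [n0 hn0] := inv_succ_small (8 * d + 4) (exprn_gt0 2 e0).
  exists n0 => m n /hn0 ha /hn0 hb.
  rewrite -(@ler_pXn2r _ 2) ?nnegrE ?rnormv_ge0 ?(ltW e0)//.
  apply: le_trans (near m n) _.
  have /andP[a0 a1] := inv_succ_itv R m; have /andP[b0 b1] := inv_succ_itv R n.
  move: a0 a1 ha b0 b1 hb d0; set s := m.+1%:R^-1; set t := n.+1%:R^-1.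
  move: (e ^+ 2) => e2; clearbody s t d; clear; nra.
have [p up] := hilbert_complete cu.
exists p => [|z Vz]; first by apply: (cs_cvg VV _ up) => n; exact: (hu n).1.
apply: le_trans (dle _ Vz).
have h1 : (fun n => x - u n) @ \oo --> x - p by apply: cvgB => //; exact: cvg_cst.
have h2 : (fun n => d + n.+1%:R^-1) @ \oo --> d + 0.
  by apply: cvgD; [exact: cvg_cst|exact: cvg_harmonic].
rewrite addr0 in h2.
apply: ler_cvg_to (cvg_rnorm _ h1) h2 _.
by apply: nearW => n; exact: (hu n).2.
Qed.

Theorem projection_theorem V x : closed_subspace V ->
  exists p, V p /\ forall z, V z -> ip z (x - p) = 0.
Proof.
move=> VV; have [p Vp hp] := nearest_point x VV; exists p; split=> // z Vz.
have {}hp y : V y -> rnorm (x - p) <= rnorm (x - p - y).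
  by move=> Vy; rewrite -addrA -opprD; apply: hp; exact: csD.
move: (x - p : H) hp => w hp; set b : C := ip z w.
(* Minimality of w against the competitor w - t b z. *)
have key (t : R) : 0 <= (t ^+ 2 * rnorm z ^+ 2 - 2 * t) * rnorm b ^+ 2.
  have := hp _ (csZ (cofR t * b) VV Vz).
  rewrite -(@ler_pXn2r _ 2) ?nnegrE ?rnormv_ge0//.
  rewrite (rnormB_sqr w ((cofR t * b) *: z)).
  rewrite (rnormvZ (cofR t * b) z).
  rewrite rnormM rnorm_cofR.
  rewrite ipZr.
  rewrite -ip_conj -/b -(mulrA (cofR t)) Re_cofRM (mulrC b) sqr_rnorm_conj.
  rewrite [complex.Re _]/= !exprMn real_normK ?num_real//.
  lra.
apply: rnorm_eq0; apply/eqP; rewrite -sqrf_eq0 eq_le sqr_ge0 andbT.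
have z0 := sqr_ge0 (rnorm z).
(* A small t > 0 makes the coefficient negative and forces b = 0; this t is small enough and also
   covers z = 0. *)
have := key (rnorm z ^+ 2 + 1)^-1; set s := rnorm z ^+ 2 in z0 *.
have -> : (s + 1)^-1 ^+ 2 * s - 2 * (s + 1)^-1 = - (s + 2) * (s + 1)^-1 ^+ 2.
  by field; lra.
have s1 : 0 < (s + 1)^-1 ^+ 2 by rewrite exprn_gt0// invr_gt0; lra.
by rewrite mulNr mulNr oppr_ge0 pmulr_rle0// mulr_gt0//; lra.
Qed.

(** Same body as [orth_proj], so that the two agree by conversion on [l2]. *)
Definition hproj V x : H :=
  xget (0 : H) [set p | V p /\ forall z, V z -> ip z (x - p) = 0].

Lemma hprojP V x : closed_subspace V ->
  V (hproj V x) /\ forall z, V z -> ip z (x - hproj V x) = 0.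
Proof.
move=> VV; have [p hp] := projection_theorem x VV.
have := @xgetPex _ (0 : H)
  [set p | V p /\ forall z, V z -> ip z (x - p) = 0].
by apply; exists p.
Qed.

Lemma hproj_eq V x p : closed_subspace V -> V p ->
  (forall z, V z -> ip z (x - p) = 0) -> hproj V x = p.
Proof.
move=> VV Vp hp; have [Vq hq] := hprojP x VV.
set q := hproj V x in Vq hq *.
apply/eqP; rewrite -subr_eq0 -rnormv_eq0 -sqrf_eq0; apply/eqP.
have -> : rnorm (q - p) ^+ 2 = Re (ip (q - p) (x - p - (x - q))).
  by rewrite opprB [x - p + _]addrC addrA subrK Re_ipxx.
by rewrite ipBr hp ?hq ?subrr//; exact: csB.
Qed.

Lemma hproj_id V x : closed_subspace V -> V x -> hproj V x = x.
Proof.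
by move=> VV Vx; apply: hproj_eq => // z _; rewrite subrr ip0r.
Qed.

Lemma hproj_linear V : closed_subspace V -> forall (a : C) x y,
  hproj V (a *: x + y) = a *: hproj V x + hproj V y.
Proof.
move=> VV a x y; have [Vp hp] := hprojP x VV; have [Vq hq] := hprojP y VV.
apply: hproj_eq => //; first exact: csDZ.
move=> z Vz; rewrite opprD addrACA -scalerBr ipDZr hp ?hq//.
by rewrite mulr0 addr0.
Qed.

Lemma hproj_symmetric V : closed_subspace V -> hsymmetric (hproj V).
Proof.
move=> VV x y; have [Vp hp] := hprojP x VV; have [Vq hq] := hprojP y VV.
have /eqP := hq _ Vp; rewrite ipBr subr_eq0 => /eqP ->.
have /(congr1 Num.conj) := hp _ Vq; rewrite rmorph0 /= ip_conj ipBl => /eqP.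
by rewrite subr_eq0 => /eqP ->.
Qed.

End Projection.

(** * Exponentials of bounded operators *)

Section CauchyProduct.
Variables (K : numFieldType) (V : lmodType K).

Definition expc (z : K) (k : nat) : K := z ^+ k / k`!%:R.

Lemma expcD (z w : K) k :
  expc (z + w) k = \sum_(0 <= j < k.+1) expc z j * expc w (k - j).
Proof.
rewrite /expc addrC exprDn mulr_suml big_mkord; apply: eq_bigr => -[j jk] _ /=.
rewrite ltnS in jk.
have f0 n : n`!%:R != 0 :> K by rewrite pnatr_eq0 -lt0n fact_gt0.
have c0 : 'C(k, j)%:R != 0 :> K by rewrite pnatr_eq0 -lt0n bin_gt0.
rewrite -(bin_fact jk) !natrM -[_ *+ _]mulr_natr.
by field; rewrite !f0 c0.
Qed.

(** The square j, l < n is cut along j + l = n. On the triangle below, collecting the terms with j +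
    l = k gives the coefficient of z + w by the binomial formula; the rest is the remainder that
    [hexpD] shows to vanish. *)
Lemma cauchy_product (f : nat -> V) (z w : K) n :
  \sum_(0 <= j < n) \sum_(0 <= l < n) (expc z j * expc w l) *: f (j + l)%N =
  \sum_(0 <= k < n) expc (z + w) k *: f k +
  \sum_(0 <= j < n) \sum_(0 <= l < n | (n <= j + l)%N)
    (expc z j * expc w l) *: f (j + l)%N.
Proof.
have -> : \sum_(0 <= k < n) expc (z + w) k *: f k =
    \sum_(0 <= k < n) \sum_(0 <= j < n | (j < k.+1)%N)
      (expc z j * expc w (k - j)) *: f k.
  apply: eq_big_nat => k /andP[_ kn]; rewrite expcD scaler_suml.
  by rewrite (big_nat_widen _ _ n).
have -> : \sum_(0 <= k < n) \sum_(0 <= j < n | (j < k.+1)%N)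
      (expc z j * expc w (k - j)) *: f k =
    \sum_(0 <= j < n) \sum_(0 <= k < n | (j < k.+1)%N)
      (expc z j * expc w (k - j)) *: f k.
  under eq_bigr do rewrite big_mkcond; rewrite exchange_big /=.
  by apply: eq_bigr => j _; rewrite -big_mkcond.
rewrite -big_split /=; apply: eq_big_nat => j /andP[_ jn].
rewrite (bigID (fun l => (j + l < n)%N)) /=; congr (_ + _); last first.
  by apply: eq_bigl => l; rewrite -leqNgt.
rewrite (eq_bigl (fun l => (l < n - j)%N)); last by move=> l; rewrite ltn_subRL.
transitivity (\sum_(0 <= i < n - j) (expc z j * expc w i) *: f (j + i)%N).
  by rewrite [RHS](big_nat_widen _ _ n) ?leq_subr//.
transitivity (\sum_(j <= k < n) (expc z j * expc w (k - j)) *: f k).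
  rewrite [RHS](big_addn 0); apply: eq_bigr => l _.
  by rewrite addnK addnC.
by rewrite [LHS](big_nat_widenl j 0).
Qed.

End CauchyProduct.

Section Exponential.
Variables (R : realType) (H : hilbert R).
Local Notation C := (Cplx R).
Local Notation Re := (@complex.Re R).
Implicit Types (x y : H) (z w : C).

Lemma series_dominated (u : nat -> H) (b : nat -> R) :
  (forall k, rnorm (u k) <= b k) -> cvgn (series b) ->
  exists l : H, series u @ \oo --> l.
Proof.
move=> ub cb; apply: hilbert_complete => e e0.
have /cvg_ex[/= s /cvgrPdist_le sb] := cb.
have /sb[n0 _ hn] : 0 < e / 2 by rewrite divr_gt0.
exists n0.
suff h m n : (n0 <= m)%N -> (m <= n)%N -> rnorm (series u m - series u n) <= e.
  move=> m n nm nn; case: (leqP m n) => [|/ltnW] mn; first exact: h.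
  by rewrite rnormvB h.
move=> nm mn; have nn := leq_trans nm mn.
rewrite rnormvB sub_series_geq//; apply: le_trans (rnormv_sum _ _ _) _.
apply: le_trans (_ : series b n - series b m <= _).
  by rewrite sub_series_geq//; apply: ler_sum => k _; exact: ub.
have := hn _ nm; have := hn _ nn => /=.
by rewrite !ler_distl; lra.
Qed.

Variables (S : {linear H -> H}) (m : R).
Hypotheses (m0 : 0 <= m) (Sm : op_bound S m).

Lemma iter_linear k (a : C) x y :
  iter k S (a *: x + y) = a *: iter k S x + iter k S y.
Proof. by elim: k => //= k ->; rewrite linearP. Qed.

(** Same body as [exp_itop], for conversion on [l2]. *)
Definition hexp (T : H -> H) (t : R) (x : H) : H :=
  limn (series (fun k => (('i * cofR t) ^+ k / k`!%:R) *: iter k T x)).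

Definition pexp (n : nat) (z : C) (x : H) : H :=
  \sum_(0 <= k < n) expc z k *: iter k S x.

Lemma pexp_linear n z (a : C) x y :
  pexp n z (a *: x + y) = a *: pexp n z x + pexp n z y.
Proof.
rewrite /pexp scaler_sumr -big_split; apply: eq_bigr => k _ /=.
by rewrite iter_linear scalerDr !scalerA mulrC.
Qed.

Lemma rnorm_expc (z : C) k : rnorm (expc z k) = expc (rnorm z) k.
Proof.
apply: (@cofR_inj R); rewrite -normrE /expc normrM normrX normrV; last first.
  by rewrite unitfE pnatr_eq0 -lt0n fact_gt0.
by rewrite normr_nat normrE /cofR rmorphM rmorphXn fmorphV rmorph_nat.
Qed.

Lemma rnorm_imag (t : R) : rnorm ('i * cofR t : C) = `|t|.
Proof.
rewrite rnormM rnorm_cofR; suff -> : rnorm ('i : C) = 1 by rewrite mul1r.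
by apply: (@cofR_inj R); rewrite -normrE normCi /cofR rmorph1.
Qed.

Lemma expc_ge0 (a : R) k : 0 <= a -> 0 <= expc a k.
Proof. by move=> a0; rewrite /expc divr_ge0// exprn_ge0. Qed.

Lemma rnorm_exp_term (z : C) k x :
  rnorm (expc z k *: iter k S x) <= expc (rnorm z * m) k * rnorm x.
Proof.
rewrite rnormvZ rnorm_expc.
have -> : expc (rnorm z * m) k * rnorm x = expc (rnorm z) k * (m ^+ k * rnorm x).
  by rewrite /expc exprMn; ring.
rewrite ler_wpM2l//.
  by rewrite expc_ge0 ?rnormv_ge0.
exact: op_bound_iter.
Qed.

Lemma cvg_expR (a : R) : series (expc a) @ \oo --> expR a.
Proof. exact: is_cvg_series_exp_coeff. Qed.

Lemma sum_expc_le (a : R) n : 0 <= a -> series (expc a) n <= expR a.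
Proof.
move=> a0; apply: nondecreasing_cvgn_le; last exact: (cvgP _ (@cvg_expR a)).
by apply: nondecreasing_series => k _ _; exact: expc_ge0.
Qed.

Lemma pexp_le n (z : C) x : rnorm (pexp n z x) <= expR (rnorm z * m) * rnorm x.
Proof.
apply: le_trans (rnormv_sum _ _ _) _.
apply: (@le_trans _ _ (series (expc (rnorm z * m)) n * rnorm x)).
  by rewrite mulr_suml; apply: ler_sum => k _; exact: rnorm_exp_term.
by rewrite ler_wpM2r ?rnormv_ge0// sum_expc_le// mulr_ge0 ?rnormv_ge0.
Qed.

Lemma cvg_hexp t x : (fun n => pexp n ('i * cofR t) x) @ \oo --> hexp S t x.
Proof.
have [] := @series_dominated
  (fun k => expc ('i * cofR t) k *: iter k S x)
  (fun k => expc (rnorm ('i * cofR t : C) * m) k * rnorm x).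
- by move=> k; exact: rnorm_exp_term.
- have -> : (fun k => expc (rnorm ('i * cofR t : C) * m) k * rnorm x) =
      rnorm x *: expc (rnorm ('i * cofR t : C) * m).
    by apply/funext => k; rewrite /= mulrC.
  by apply: is_cvg_seriesZ; exact: (cvgP _ (@cvg_expR _)).
- by move=> l hl; rewrite /hexp (cvg_lim _ hl)//; exact: norm_hausdorff.
Qed.

Lemma hexp_linear t (a : C) x y :
  hexp S t (a *: x + y) = a *: hexp S t x + hexp S t y.
Proof.
apply: (cvg_uniq (@cvg_hexp t (a *: x + y))).
under eq_fun do rewrite pexp_linear.
by apply: cvgD; [apply: cvgZr|]; exact: cvg_hexp.
Qed.

Lemma hexp_sub_id t x : rnorm (hexp S t x - x) <= (expR (`|t| * m) - 1) * rnorm x.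
Proof.
have hx : (fun n => pexp n ('i * cofR t) x - x) @ \oo --> hexp S t x - x.
  by apply: cvgB; [exact: cvg_hexp|exact: cvg_cst].
(* From n = 1 on the partial sum contains the term k = 0, which cancels x. *)
apply: (cvg_rnorm_le hx); exists 1%N => -[//|n] _.
rewrite /pexp big_nat_recl//= /expc expr0 fact0 invr1 mulr1 scale1r addrC addKr.
apply: le_trans (rnormv_sum _ _ _) _.
apply: (@le_trans _ _ ((series (expc (`|t| * m)) n.+1 - 1) * rnorm x)).
  rewrite /series /= big_nat_recl//= {1}/expc expr0 fact0 invr1 mulr1 addrC addKr.
  rewrite mulr_suml; apply: ler_sum => k _.
  by rewrite -(rnorm_imag t); exact: rnorm_exp_term.
by rewrite ler_wpM2r ?rnormv_ge0// lerD2r sum_expc_le// mulr_ge0.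
Qed.

Lemma hexp_commute (B : {linear H -> H}) (b : R) t x : op_bound B b ->
  (forall y, B (S y) = S (B y)) -> B (hexp S t x) = hexp S t (B x).
Proof.
move=> Bb BS; apply: cvg_uniq (@cvg_hexp t (B x)).
have iB k y : iter k S (B y) = B (iter k S y) by elim: k => //= k ->.
have -> : (fun n => pexp n ('i * cofR t) (B x)) =
    (fun n => B (pexp n ('i * cofR t) x)).
  apply/funext => n; rewrite /pexp linear_sum; apply: eq_bigr => k _.
  by rewrite linearZ /= iB.
exact: cvg_bounded Bb (@cvg_hexp t x).
Qed.

(** The product of the partial sums tends to the composition. Its remainder in [cauchy_product] is
    dominated by the scalar one for a = |s| m and b = |t| m, which vanishes because exp(a) exp(b) =
    exp(a + b). *)
Lemma hexpD s t x : hexp S (s + t) x = hexp S s (hexp S t x).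
Proof.
pose z : C := 'i * cofR s; pose w : C := 'i * cofR t.
have zw : 'i * cofR (s + t) = z + w by rewrite cofRD mulrDr.
have h1 : (fun n => pexp n z (pexp n w x)) @ \oo --> hexp S s (hexp S t x).
  have -> : (fun n => pexp n z (pexp n w x)) = (fun n =>
      pexp n z (pexp n w x - hexp S t x) + pexp n z (hexp S t x)).
    apply/funext => n.
    rewrite -[pexp n z (_ - _)]scale1r -pexp_linear scale1r subrK.
    by [].
  rewrite -[X in _ --> X]add0r; apply: cvgD; last exact: cvg_hexp.
  apply/cvg_rnormP.
  have h0 : (fun n => expR (rnorm z * m) * rnorm (pexp n w x - hexp S t x)) @ \oo
      --> (0 : R).
    rewrite -(mulr0 (expR (rnorm z * m))); apply: cvgMr.
    exact: (proj1 (cvg_rnormP _ _ _) (@cvg_hexp t x)).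
  apply: (squeeze_cvgr _ (cvg_cst 0) h0); apply: nearW => n.
  by rewrite rnormv_ge0 subr0 pexp_le.
apply: cvg_uniq h1.
have -> : (fun n => pexp n z (pexp n w x)) = (fun n => pexp n (z + w) x +
    \sum_(0 <= j < n) \sum_(0 <= l < n | (n <= j + l)%N)
    (expc z j * expc w l) *: iter (j + l)%N S x).
  apply/funext => n; rewrite -(cauchy_product (fun k => iter k S x)).
  apply: eq_bigr => j _; rewrite /pexp.
  rewrite -[iter j S]/(linear_of (iter_linear j) : H -> H) linear_sum scaler_sumr.
  apply: eq_bigr => l _; rewrite linearZ /= scalerA.
  by rewrite -iterD.
rewrite -[X in _ --> X]addr0; apply: cvgD; first by rewrite -zw; exact: cvg_hexp.
pose a : R := rnorm z * m; pose b : R := rnorm w * m.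
have h0 : (fun n => (series (expc a) n * series (expc b) n - series (expc (a + b)) n)
    * rnorm x) @ \oo --> (0 : R).
  rewrite -(mul0r (rnorm x)); apply: cvgMl.
  rewrite -(subrr (expR (a + b))) {1}expRD.
  by apply: cvgB; [apply: cvgM|]; exact: cvg_expR.
apply/cvg_rnormP; apply: (squeeze_cvgr _ (cvg_cst 0) h0); apply: nearW => n.
rewrite rnormv_ge0 subr0 /=.
(* The same identity for the constant sequence 1 evaluates the dominating scalar remainder. *)
have := @cauchy_product R R^o (fun=> 1) a b n.
have -> : \sum_(0 <= j < n) \sum_(0 <= l < n) (expc a j * expc b l) *: (1 : R^o) =
    series (expc a) n * series (expc b) n.
  rewrite /series /= mulr_suml; apply: eq_bigr => j _; rewrite mulr_sumr.
  by apply: eq_bigr => l _; rewrite /= [LHS]mulr1.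
have -> : \sum_(0 <= k < n) expc (a + b) k *: (1 : R^o) = series (expc (a + b)) n.
  by apply: eq_bigr => k _; rewrite [LHS]mulr1.
move=> ->; rewrite [X in X - _]addrC addrK mulr_suml.
apply: le_trans (rnormv_sum _ _ _) _; apply: ler_sum => j _.
rewrite mulr_suml; apply: le_trans (rnormv_sum _ _ _) _; apply: ler_sum => l _.
rewrite rnormvZ rnormM !rnorm_expc.
have -> : (expc a j * expc b l) *: (1 : R^o) =
    expc (rnorm z) j * expc (rnorm w) l * m ^+ (j + l).
  by rewrite [LHS]mulr1 /a /b /expc !exprMn exprD; ring.
rewrite -[leRHS]mulrA ler_wpM2l//.
  by apply: mulr_ge0; apply: expc_ge0; exact: rnormv_ge0.
exact: op_bound_iter.
Qed.

Lemma hexp0 x : hexp S 0 x = x.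
Proof.
have := hexp_sub_id 0 x; rewrite normr0 mul0r expR0 subrr mul0r => h.
apply/eqP; rewrite -subr_eq0 -rnormv_eq0; apply/eqP/le_anti.
by rewrite h rnormv_ge0.
Qed.

Lemma hexpK t x : hexp S (- t) (hexp S t x) = x.
Proof. by rewrite -hexpD addNr hexp0. Qed.

Lemma hexpNK t x : hexp S t (hexp S (- t) x) = x.
Proof. by rewrite -hexpD subrr hexp0. Qed.

Lemma hexp_iter n t x : hexp S (n%:R * t) x = iter n (hexp S t) x.
Proof.
elim: n x => [|n IH] x; first by rewrite mul0r hexp0.
by rewrite -natr1 mulrDl mul1r addrC hexpD IH.
Qed.

Hypothesis sS : hsymmetric S.

(** Powers of S are symmetric and conjugation turns (i t)^k into (- i t)^k. *)
Lemma ip_hexp t x y : ip x (hexp S t y) = ip (hexp S (- t) x) y.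
Proof.
have h1 : (fun n => ip x (pexp n ('i * cofR t) y)) @ \oo --> ip x (hexp S t y).
  exact: (cvg_ip _ (@cvg_hexp t y)).
have h2 : (fun n => (ip y (pexp n ('i * cofR (- t)) x))^*) @ \oo -->
    ip (hexp S (- t) x) y.
  by rewrite -ip_conj; apply: cvg_conj; exact: (cvg_ip _ (@cvg_hexp (- t) x)).
apply: (cvg_unique (@norm_hausdorff _ _) h1); rewrite /set1/=.
have sk k (u w : H) : ip u (iter k S w) = ip (iter k S u) w.
  by elim: k u => //= k IH u; rewrite sS IH -iterSr.
rewrite (_ : (fun n => ip x _) =
  (fun n => (ip y (pexp n ('i * cofR (- t)) x))^*))//.
apply/funext => n; rewrite /pexp !ip_sumr rmorph_sum; apply: eq_bigr => k _.
rewrite !ipZr /= rmorphM /= ip_conj -sk; congr (_ * _).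
rewrite /expc rmorphM rmorphXn fmorphV rmorph_nat rmorphM /= conjCi conj_cofR.
by rewrite cofRN mulrN mulNr opprK.
Qed.

Lemma rnorm_hexp t x : rnorm (hexp S t x) = rnorm x.
Proof.
apply: (@pexpIrn _ 2); rewrite ?nnegrE ?rnormv_ge0//.
by rewrite -!Re_ipxx ip_hexp hexpK.
Qed.

End Exponential.

(** * The spectral theorem for bounded symmetric operators *)

Section AbsoluteValue.
Variables (R : realType) (H : hilbert R).
Local Notation C := (Cplx R).
Local Notation Re := (@complex.Re R).
Implicit Types (x y : H).

Lemma hlinZ (f : {linear H -> H}) (a : C) x : f (a *: x) = a *: f x.
Proof. exact: linearZZ. Qed.

Lemma linearD2 (f g : {linear H -> H}) (a : C) x y :
  f (a *: x + y) + g (a *: x + y) = a *: (f x + g x) + (f y + g y).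
Proof. by rewrite !linearP scalerDr addrACA. Qed.

Lemma hsymmetric_Re (S : H -> H) x : hsymmetric S -> ip x (S x) = cofR (Re (ip x (S x))).
Proof.
move=> sS; have := ip_conj x (S x); rewrite -sS.
move: (ip x (S x)) => [a b] [] h; rewrite /cofR /=; congr Complex.
by have : - b = b by []; lra.
Qed.

Section Iteration.
Variable Y : {linear H -> H}.
Hypotheses (sY : hsymmetric Y) (Y1 : op_bound Y 1).

(* Newton-like iteration X' = (Y + X^2) / 2 for 1 - sqrt (1 - Y); the scalar
   sequence xi is its value at Y = 1 and dominates it. *)
Fixpoint sqrt_iter (n : nat) : H -> H :=
  if n is k.+1 then
    fun x => cofR 2^-1 *: (Y x + sqrt_iter k (sqrt_iter k x))
  else fun=> 0.

Fixpoint sqrt_scalar (n : nat) : R :=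
  if n is k.+1 then (1 + sqrt_scalar k ^+ 2) / 2 else 0.

Lemma sqrt_scalar_itv n : 0 <= sqrt_scalar n <= 1.
Proof. elim: n => [|n /andP[h0 h1]] /=; first by rewrite lexx ler01. nra. Qed.

Lemma sqrt_scalar_nd n : sqrt_scalar n <= sqrt_scalar n.+1.
Proof.
by have /andP[h0 h1] := sqrt_scalar_itv n; rewrite /=; have := sqr_ge0 (sqrt_scalar n - 1); nra.
Qed.

Lemma sqrt_iter_linear n (a : C) x y :
  sqrt_iter n (a *: x + y) = a *: sqrt_iter n x + sqrt_iter n y.
Proof.
elim: n x y => [|n IH] x y /=; first by rewrite scaler0 addr0.
rewrite !IH linearP scalerA [a * _]mulrC -scalerA -scalerDr; congr (_ *: _).
by rewrite scalerDr addrACA.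
Qed.

Lemma sqrt_iterB n x y : sqrt_iter n (x - y) = sqrt_iter n x - sqrt_iter n y.
Proof. by rewrite addrC -scaleN1r sqrt_iter_linear scaleN1r addrC. Qed.

Lemma sqrt_iter_le n : op_bound (sqrt_iter n) (sqrt_scalar n).
Proof.
elim: n => [|n IH] x /=; first by rewrite rnormv0 mul0r.
have /andP[h0 h1] := sqrt_scalar_itv n.
rewrite rnormvZ rnorm_cofR ger0_norm ?invr_ge0// mulrC mulrAC.
rewrite ler_pM2r ?invr_gt0//; apply: le_trans (rnormvD _ _) _.
rewrite mulrDl; apply: lerD; first exact: Y1.
by apply: le_trans (IH _) _; rewrite expr2 -mulrA ler_wpM2l.
Qed.

(** Writing X' for the iterate after X, the next difference is half of X' (X' - X) + (X' - X) X.
    Norms therefore obey the recursion that the scalar sequence satisfies with equality. *)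
Lemma sqrt_iter_step n :
  op_bound (fun x => sqrt_iter n.+1 x - sqrt_iter n x)
    (sqrt_scalar n.+1 - sqrt_scalar n).
Proof.
elim: n => [|n IH] x.
  rewrite /= !addr0 !subr0 expr0n addr0 rnormvZ rnorm_cofR ger0_norm ?invr_ge0//.
  by rewrite div1r ler_wpM2l ?invr_ge0//; have := Y1 x; rewrite mul1r.
have -> : sqrt_iter n.+2 x - sqrt_iter n.+1 x = cofR 2^-1 *:
    (sqrt_iter n.+1 (sqrt_iter n.+1 x - sqrt_iter n x) +
     (sqrt_iter n.+1 (sqrt_iter n x) - sqrt_iter n (sqrt_iter n x))).
  rewrite sqrt_iterB addrA subrK.
  rewrite -[LHS]/(cofR 2^-1 *: (Y x + sqrt_iter n.+1 (sqrt_iter n.+1 x)) -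
     cofR 2^-1 *: (Y x + sqrt_iter n (sqrt_iter n x))).
  by rewrite -scalerBr opprD addrACA subrr add0r.
rewrite rnormvZ rnorm_cofR ger0_norm ?invr_ge0//.
have h1 := sqrt_iter_le n.+1 (sqrt_iter n.+1 x - sqrt_iter n x).
have h2 := IH (sqrt_iter n x); have h3 := sqrt_iter_le n x; have h4 := IH x.
have /andP[s0 s1] := sqrt_scalar_itv n; have /andP[t0 t1] := sqrt_scalar_itv n.+1.
have st := sqrt_scalar_nd n.
rewrite -[sqrt_scalar n.+2]/((1 + sqrt_scalar n.+1 ^+ 2) / 2).
have -> : (1 + sqrt_scalar n.+1 ^+ 2) / 2 - sqrt_scalar n.+1 =
    2^-1 * ((sqrt_scalar n.+1 + sqrt_scalar n) *
      (sqrt_scalar n.+1 - sqrt_scalar n)).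
  by rewrite -[X in _ - X = _]/((1 + sqrt_scalar n ^+ 2) / 2); field.
rewrite -[leRHS]mulrA ler_pM2l ?invr_gt0//; apply: le_trans (rnormvD _ _) _.
apply: le_trans (lerD h1 h2) _.
have ts : 0 <= sqrt_scalar n.+1 - sqrt_scalar n by rewrite subr_ge0.
have := ler_wpM2l t0 h4; have := ler_wpM2l ts h3.
move: (rnorm _) (rnorm _) (rnorm _) => r p2 p1; lra.
Qed.

Lemma sqrt_scalar_cvg : cvgn sqrt_scalar.
Proof.
apply: nondecreasing_is_cvgn; first by apply/nondecreasing_seqP; exact: sqrt_scalar_nd.
by exists 1 => _ [n _ <-]; have /andP[] := sqrt_scalar_itv n.
Qed.

Lemma sqrt_iter_dist m n x : (m <= n)%N ->
  rnorm (sqrt_iter n x - sqrt_iter m x) <= (sqrt_scalar n - sqrt_scalar m) * rnorm x.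
Proof.
move=> /subnK <-; elim: (n - m)%N => [|k IH].
  by rewrite !subrr rnormv0 mul0r.
apply: le_trans (rnormv_dist _ (sqrt_iter (k + m) x) _) _.
apply: le_trans (lerD (sqrt_iter_step _ _) IH) _.
by rewrite -mulrDl subrKA.
Qed.

Lemma sqrt_iter_cvg x : exists l : H, (fun n => sqrt_iter n x) @ \oo --> l.
Proof.
apply: hilbert_complete => e e0.
have /cvg_ex[/= s /cvgrPdist_le sb] := sqrt_scalar_cvg.
have x1 : 0 < rnorm x + 1 by rewrite ltr_wpDl ?rnormv_ge0.
have /sb[n0 _ hn] : 0 < e / (rnorm x + 1) / 2 by rewrite !divr_gt0.
exists n0.
suff h m n : (n0 <= m)%N -> (m <= n)%N -> rnorm (sqrt_iter n x - sqrt_iter m x) <= e.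
  move=> m n nm nn; case: (leqP n m) => [|/ltnW] mn; first exact: h.
  by rewrite rnormvB h.
move=> nm mn; have nn := leq_trans nm mn.
apply: le_trans (sqrt_iter_dist x mn) _.
have : sqrt_scalar n - sqrt_scalar m <= e / (rnorm x + 1).
  by have := hn _ nm; have := hn _ nn => /=; rewrite !ler_distl; lra.
rewrite ler_pdivlMr// => h; apply: le_trans h.
rewrite ler_wpM2l ?lerDl// subr_ge0.
by have /nondecreasing_seqP := sqrt_scalar_nd; exact.
Qed.

(** The limit X is a fixed point, 2 X = Y + X^2, that is (1 - X)^2 = 1 - Y. Everything commuting
    with Y commutes with each iterate and so with X. *)
Lemma sqrt_limit : exists X : {linear H -> H},
  [/\ op_bound X 1, hsymmetric X,
      forall x, X x + X x = Y x + X (X x)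
    & forall (B : {linear H -> H}) b, op_bound B b ->
        (forall x, B (Y x) = Y (B x)) -> forall x, B (X x) = X (B x)].
Proof.
have [f hf] := choice sqrt_iter_cvg.
have lf (a : C) x y : f (a *: x + y) = a *: f x + f y.
  apply: cvg_uniq (hf (a *: x + y)) _.
  under eq_fun do rewrite sqrt_iter_linear.
  by apply: cvgD; [apply: cvgZr|]; exact: hf.
have f1 : op_bound f 1.
  move=> x; apply: (cvg_rnorm_le (hf x)); exists 0%N => n _.
  apply: le_trans (sqrt_iter_le _ _) _; rewrite ler_wpM2r ?rnormv_ge0//.
  by have /andP[] := sqrt_scalar_itv n.
exists (linear_of lf); split=> //.
- move=> x y /=.
  have h1 : (fun n => ip x (sqrt_iter n y)) @ \oo --> ip x (f y).
    exact: (cvg_ip _ (hf y)).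
  have h2 : (fun n => (ip y (sqrt_iter n x))^*) @ \oo --> ip (f x) y.
    by rewrite -ip_conj; apply: cvg_conj; exact: (cvg_ip _ (hf x)).
  apply: (cvg_unique (@norm_hausdorff _ _) h1); rewrite /set1/=.
  rewrite (_ : (fun n => ip x _) = (fun n => (ip y (sqrt_iter n x))^*))//.
  apply/funext => n; rewrite ip_conj.
  elim: n x y {h1 h2} => [|n IH] x y /=; first by rewrite ip0r ip0l.
  by rewrite ipZr ipZl ipDr ipDl conj_cofR sY !IH.
- move=> x /=; apply: cvg_uniq (cvgD (hf x) (hf x)) _.
  have h1 : (fun n => sqrt_iter n (sqrt_iter n x)) @ \oo --> f (f x).
    (* Operator and argument both vary with n; the uniform bound [sqrt_iter_le] disposes of the
       first summand. *)
    have -> : (fun n => sqrt_iter n (sqrt_iter n x)) =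
        (fun n => sqrt_iter n (sqrt_iter n x - f x) + sqrt_iter n (f x)).
      by apply/funext => n; rewrite sqrt_iterB subrK.
    rewrite -[X in _ --> X]add0r; apply: cvgD; last exact: hf.
    apply/cvg_rnormP.
    have h0 : (fun n => rnorm (sqrt_iter n x - f x)) @ \oo --> (0 : R).
      exact: (proj1 (cvg_rnormP _ _ _) (hf x)).
    apply: (squeeze_cvgr _ (cvg_cst 0) h0); apply: nearW => n.
    rewrite rnormv_ge0 subr0; apply: le_trans (sqrt_iter_le _ _) _.
    have /andP[s0 s1] := sqrt_scalar_itv n.
    by rewrite ler_piMl ?rnormv_ge0.
  have h2 : (fun n => sqrt_iter n.+1 x + sqrt_iter n.+1 x) @ \oo -->
      Y x + f (f x).
    rewrite (_ : (fun n => _) = (fun n => Y x + sqrt_iter n (sqrt_iter n x))).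
      by apply: cvgD; [exact: cvg_cst|exact: h1].
    apply/funext => n /=; rewrite -scalerDl -cofRD.
    by rewrite (_ : 2^-1 + 2^-1 = 1) ?scale1r//; field.
  by rewrite -cvg_shiftS.
- move=> B b Bb BY x /=; apply: cvg_uniq (hf (B x)).
  rewrite (_ : (fun n => _) = (fun n => B (sqrt_iter n x))).
    exact: cvg_bounded Bb (hf x).
  apply/funext => n; elim: n x => [|n IH] x /=; first by rewrite linear0.
  by rewrite (hlinZ B) (linearD B) BY !IH.
Qed.

End Iteration.

(** P = b (1 - X) is b times the square root of B^2 / b^2, where X comes from [sqrt_limit] for Y = 1
    - B^2 / b^2. The bound on B puts the form of Y between 0 and 1, hence makes Y a contraction. *)
Lemma absolute_value (B : {linear H -> H}) (b : R) : 0 < b -> op_bound B b ->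
  hsymmetric B -> exists P : {linear H -> H},
  [/\ hsymmetric P, forall x, 0 <= Re (ip x (P x)),
      forall x, P (P x) = B (B x)
    & forall (D : {linear H -> H}) d, op_bound D d ->
        (forall x, D (B x) = B (D x)) -> forall x, D (P x) = P (D x)].
Proof.
move=> b0 Bb sB.
pose Yf x := x - cofR (b ^- 2) *: B (B x).
have lY (a : C) x y : Yf (a *: x + y) = a *: Yf x + Yf y.
  rewrite /Yf !(linearP B) scalerDr scalerA [_ * a]mulrC -scalerA scalerBr.
  by rewrite opprD addrACA.
pose Y := linear_of lY.
have sY : hsymmetric Y.
  by move=> x y; rewrite /= /Yf ipBr ipBl ipZr ipZl conj_cofR !sB.
have BB x : Re (ip x (B (B x))) = rnorm (B x) ^+ 2 by rewrite sB Re_ipxx.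
have Y1 : op_bound Y 1.
  move=> x; apply: (@form_bound_rnorm _ _ Y setT 1) => // {}x _.
  rewrite /= /Yf ipBr ReB ipZr Re_cofRM Re_ipxx BB mul1r.
  have hB : b ^- 2 * rnorm (B x) ^+ 2 <= rnorm x ^+ 2.
    rewrite mulrC ler_pdivrMr ?exprn_gt0// mulrC -exprMn.
    by apply: ler_sqr_nneg; rewrite ?rnormv_ge0//; exact: Bb.
  have : 0 <= b ^- 2 * rnorm (B x) ^+ 2.
    by rewrite mulr_ge0 ?sqr_ge0// invr_ge0 sqr_ge0.
  by move: hB; lra.
have [X [X1 sX XX XC]] := sqrt_limit sY Y1.
pose Pf x := cofR b *: (x - X x).
have lP (a : C) x y : Pf (a *: x + y) = a *: Pf x + Pf y.
  rewrite /Pf (linearP X) opprD addrACA scalerDr; congr (_ + _).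
  by rewrite -scalerBr !scalerA mulrC.
exists (linear_of lP); split=> [x y|x|x|D d Dd DB x] /=.
- by rewrite /Pf ipZr ipZl ipBr ipBl conj_cofR sX.
- rewrite /Pf ipZr Re_cofRM ipBr ReB Re_ipxx mulr_ge0 ?(ltW b0)// subr_ge0.
  apply: le_trans (Re_ip_le _ _) _; rewrite expr2 ler_wpM2l ?rnormv_ge0//.
  by have := X1 x; rewrite mul1r.
(* (1 - X)^2 = 1 - 2 X + X^2 = 1 - Y by the fixed point equation. *)
- have -> : Pf (Pf x) = cofR (b ^+ 2) *: (x - Y x).
    rewrite /Pf (hlinZ X) -scalerBr scalerA cofRM; congr (_ *: _).
    rewrite (linearB X) -[X in _ = x - X](addrK (X (X x))) -XX.
    by rewrite -[X x + X x - _]addrA [in RHS]opprD [in RHS]addrA.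
  rewrite /Yf subKr scalerA -cofRM mulfV ?expf_neq0 ?gt_eqF//.
  by rewrite scale1r.
- rewrite /Pf (hlinZ D) (linearB D) (XC D d)// => y.
  by rewrite /= /Yf (linearB D) (hlinZ D) !DB.
Qed.

End AbsoluteValue.

(** * Spectral subspaces of a positive operator through orbit growth *)

Section SpectralFamily.
Variables (R : realType) (H : hilbert R).
Local Notation C := (Cplx R).
Local Notation Re := (@complex.Re R).
Implicit Types (x y : H).
Variables (A : {linear H -> H}) (a : R).
Hypotheses (a0 : 0 <= a) (Aa : op_bound A a) (sA : hsymmetric A)
  (A0 : forall x, 0 <= Re (ip x (A x))).

(* The range of the spectral projection of A on ]-oo, l], described by the
   growth of the orbit *)
Definition growth_space (l : R) : set H :=
  [set x | forall n, rnorm (iter n A x) <= l ^+ n * rnorm x].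

(** Symmetry moves one factor A across the product. Successive quotients of the norms along an orbit
    thus never decrease. *)
Lemma orbit_log_convex x n :
  rnorm (iter n.+1 A x) ^+ 2 <= rnorm (iter n A x) * rnorm (iter n.+2 A x).
Proof.
by rewrite -Re_ipxx {1}iterS -sA -iterS; exact: Re_ip_le.
Qed.

(** If q = |A x| / |x| exceeded l, log-convexity would keep every later quotient at least q, and q^n
    |x| would outgrow c l^n. *)
Lemma growth_step (l c : R) x :
  (forall n, rnorm (iter n A x) <= c * l ^+ n) -> rnorm (A x) <= l * rnorm x.
Proof.
move=> h; rewrite leNgt; apply/negP => lt.
have h0 := h 0%N; rewrite expr0 mulr1 /= in h0.
have c0 : 0 <= c by apply: le_trans h0; exact: rnormv_ge0.
have h1 := h 1%N; rewrite expr1 /= in h1.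
have := rnormv_ge0 (A x) => Ax0.
have [x0|x0] := eqVneq x 0.
  by move: lt; rewrite x0 linear0 rnormv0 mulr0 ltxx.
have px : 0 < rnorm x by rewrite lt_neqAle eq_sym rnormv_eq0 x0 rnormv_ge0.
have l0 : 0 <= l.
  by rewrite leNgt; apply/negP => l0; nra.
pose q := rnorm (A x) / rnorm x.
have lq : l < q by rewrite /q ltr_pdivlMr.
have q0 : 0 < q by apply: le_lt_trans lq.
have ratio n : 0 < rnorm (iter n A x) /\
    q * rnorm (iter n A x) <= rnorm (iter n.+1 A x).
  elim: n => [|n [p pq]]; first by rewrite /= /q divfK ?gt_eqF.
  have p1 : 0 < rnorm (iter n.+1 A x) by apply: lt_le_trans pq; exact: mulr_gt0.
  split=> //; have h2 := orbit_log_convex x n; rewrite -(ler_pM2l p); apply: le_trans h2.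
  by rewrite mulrA expr2 [_ * q]mulrC ler_pM2r.
have pw n : q ^+ n * rnorm x <= rnorm (iter n A x).
  elim: n => [|n IH]; first by rewrite expr0 mul1r.
  by apply: le_trans (ratio n).2; rewrite exprS -mulrA ler_pM2l.
have cv : (fun n => c * (l / q) ^+ n) @ \oo --> c * 0.
  apply: cvgMr; apply: cvg_expr.
  by rewrite ger0_norm ?(divr_ge0 l0 (ltW q0))// ltr_pdivrMr// mul1r.
rewrite mulr0 in cv.
have : rnorm x <= 0.
  apply: (cvgr_to_ge cv); apply: nearW => n.
  rewrite expr_div_n mulrA ler_pdivlMr ?exprn_gt0// mulrC.
  exact: le_trans (pw n) (h n).
by rewrite leNgt px.
Qed.

(** [growth_step] applied to each iterate removes the constant. The right-hand form is the one that
    visibly passes to sums and to A x. *)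
Lemma growth_spaceP (l : R) x : growth_space l x <->
  exists c, forall n, rnorm (iter n A x) <= c * l ^+ n.
Proof.
split=> [h|[c h]]; first by exists (rnorm x) => n; rewrite mulrC.
have st k : rnorm (iter k.+1 A x) <= l * rnorm (iter k A x).
  apply: (@growth_step l (c * l ^+ k)) => n.
  by rewrite -iterD -mulrA -exprD addnC; exact: h.
have [l0|l0] := leP 0 l.
  elim=> [|n IH]; first by rewrite expr0 mul1r.
  by apply: le_trans (st n) _; rewrite exprS -mulrA ler_wpM2l.
have x0 : x = 0.
  apply/eqP; rewrite -rnormv_eq0; apply/eqP/le_anti; rewrite rnormv_ge0 andbT.
  have := st 0%N; have := rnormv_ge0 (A x); have := rnormv_ge0 x => /=; nra.
by move=> n; rewrite x0 -[iter n A]/(linear_of (iter_linear A n) : H -> H)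
  linear0 rnormv0 mulr0.
Qed.

Lemma growth_space_lt0 (l : R) x : l < 0 -> growth_space l x -> x = 0.
Proof.
move=> l0 /(_ 1%N); rewrite expr1 /= => h.
apply/eqP; rewrite -rnormv_eq0; apply/eqP/le_anti; rewrite rnormv_ge0 andbT.
have := rnormv_ge0 (A x); have := rnormv_ge0 x; nra.
Qed.

Lemma growth_space0 (l : R) : growth_space l 0.
Proof.
by move=> n; rewrite -[iter n A]/(linear_of (iter_linear A n) : H -> H)
  linear0 rnormv0 mulr0.
Qed.

Lemma growth_space_closed (l : R) : closed_subspace (growth_space l).
Proof.
split; first exact: growth_space0.
- move=> b x y Mx My; have [l0|l0] := leP 0 l; last first.
    rewrite (growth_space_lt0 l0 Mx) (growth_space_lt0 l0 My) scaler0 addr0.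
    exact: growth_space0.
  apply/growth_spaceP; exists (rnorm b * rnorm x + rnorm y) => n.
  rewrite iter_linear; apply: le_trans (rnormvD _ _) _; rewrite rnormvZ mulrDl.
  apply: lerD; last by rewrite mulrC.
  by rewrite -mulrA ler_wpM2l ?rnormv_ge0// mulrC.
- move=> u x Mu ux n.
  have h1 : (fun k => rnorm (iter n A (u k))) @ \oo --> rnorm (iter n A x).
    apply: cvg_rnorm; rewrite -[iter n A]/(linear_of (iter_linear A n) : H -> H).
    apply: (@cvg_bounded _ _ (linear_of (iter_linear A n)) (a ^+ n)) ux.
    exact: op_bound_iter.
  have h2 : (fun k => l ^+ n * rnorm (u k)) @ \oo --> l ^+ n * rnorm x.
    by apply: cvgMr; exact: cvg_rnorm.
  by apply: (ler_cvg_to h1 h2); apply: nearW => k; exact: Mu.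
Qed.

Lemma growth_space_A (l : R) x : growth_space l x -> growth_space l (A x).
Proof.
move=> Mx; apply/growth_spaceP; exists (l * rnorm x) => n.
by rewrite -iterSr mulrAC -exprS; exact: Mx.
Qed.

Lemma growth_space_le (l k : R) x : l <= k -> growth_space l x -> growth_space k x.
Proof.
move=> lk; have [l0 Mx n|l0] := leP 0 l.
  apply: le_trans (Mx n) _; rewrite ler_wpM2r ?rnormv_ge0//.
  by rewrite lerXn2r ?nnegrE// (le_trans l0).
by move=> /(growth_space_lt0 l0) ->; exact: growth_space0.
Qed.

Lemma growth_spaceT (l : R) x : a <= l -> growth_space l x.
Proof. by move=> al; apply: growth_space_le al _ => n; exact: op_bound_iter. Qed.

(** Source of the right continuity of the spectral family. *)
Lemma growth_space_rc (l : R) x :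
  (forall k, growth_space (l + k.+1%:R^-1) x) -> growth_space l x.
Proof.
move=> h n.
have h2 : (fun k => (l + k.+1%:R^-1) ^+ n * rnorm x) @ \oo -->
    (l + 0) ^+ n * rnorm x.
  apply: cvgMl; apply: (@cvg_comp _ _ _ _ (fun t : R => t ^+ n)).
    by apply: cvgD; [exact: cvg_cst|exact: cvg_harmonic].
  exact: exprn_continuous.
rewrite addr0 in h2.
by apply: (cvgr_to_ge h2); apply: nearW => k; exact: h.
Qed.

Lemma growth_space_upper (l : R) x :
  growth_space l x -> Re (ip x (A x)) <= l * rnorm x ^+ 2.
Proof.
move=> /(_ 1%N); rewrite expr1 /= => h; apply: le_trans (Re_ip_le _ _) _.
by rewrite expr2 [leRHS]mulrA [leRHS]mulrC ler_wpM2l ?rnormv_ge0.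
Qed.

(* The range of |l - A| + (l - A) lies in [growth_space l]. *)
Lemma growth_space_lower (l : R) x :
  (forall z, growth_space l z -> ip z x = 0) -> l * rnorm x ^+ 2 <= Re (ip x (A x)).
Proof.
move=> xM; have [l0|l0] := leP 0 l; last first.
  by apply: le_trans (A0 x); rewrite nmulr_rle0// sqr_ge0.
pose Bf y := cofR l *: y - A y.
have lB (c : C) y z : Bf (c *: y + z) = c *: Bf y + Bf z.
  rewrite /Bf (linearP A) scalerDr scalerA [_ * c]mulrC -scalerA scalerBr.
  by rewrite opprD addrACA.
pose B := linear_of lB.
have sB : hsymmetric B.
  by move=> y z; rewrite /= /Bf ipBr ipBl ipZr ipZl conj_cofR sA.
have b0 : 0 < l + a + 1 by rewrite ltr_wpDl// addr_ge0.
have Bb : op_bound B (l + a + 1).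
  move=> y; apply: le_trans (rnormvD _ _) _; rewrite rnormvN rnormvZ rnorm_cofR.
  by rewrite ger0_norm// !mulrDl -addrA lerD2l; have := Aa y; have := rnormv_ge0 y; lra.
have [P [sP P0 PP PC]] := absolute_value b0 Bb sB.
have BP y : B (P y) = P (B y) by exact: (PC B _ Bb).
have AB y : A (B y) = B (A y) by rewrite /= /Bf (linearB A) (hlinZ A).
have AP y : A (P y) = P (A y) by exact: (PC A _ Aa).
pose V := [set P y + B y | y in setT].
have VV (c : C) y z : V y -> V z -> V (c *: y + z).
  move=> [y' _ <-] [z' _ <-]; exists (c *: y' + z') => //.
  exact: linearD2.
have VA y : V y -> V (A y).
  by move=> [y' _ <-]; exists (A y') => //; rewrite (linearD A) AP AB.
(* B (P + B) = P B + P^2 = P (P + B), so l - A equals its absolute value on V. There the form of A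
   lies between 0 and l, which bounds A by l. *)
have VB y : V y -> B y = P y.
  by move=> [y' _ <-]; rewrite (linearD B) (linearD P) BP PP addrC.
have bnd y : V y -> rnorm (A y) <= l * rnorm y.
  apply: (form_bound_rnorm sA VV VA l0) => {}y Vy; rewrite A0/=.
  have : Re (ip y (B y)) = l * rnorm y ^+ 2 - Re (ip y (A y)).
    by rewrite /= /Bf ipBr ReB ipZr Re_cofRM Re_ipxx.
  by rewrite VB//; have := P0 y; lra.
have VM y : V y -> growth_space l y.
  move=> Vy n; have VAn k : V (iter k A y) by elim: k => //= k; exact: VA.
  elim: n => [|n IH]; first by rewrite expr0 mul1r.
  by apply: le_trans (bnd _ (VAn n)) _; rewrite exprS -mulrA ler_wpM2l.
(* P + B is symmetric and x is orthogonal to its range. Hence the form of l - A at x is minus that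
   of P. *)
have Cx : P x + B x = 0.
  apply: ip_eq0P => y; rewrite ipDr sP sB -ipDl; apply: xM; apply: VM.
  by exists y.
have : Re (ip x (P x)) + (l * rnorm x ^+ 2 - Re (ip x (A x))) = 0.
  rewrite -Re_ipxx -Re_cofRM -ipZr -ReB -ipBr -ReD -ipDr.
  by rewrite -[_ - A x]/(B x) Cx ip0r.
by have := P0 x; lra.
Qed.

End SpectralFamily.

(** * Order and monotone limits of orthogonal projections *)

Section Projections.
Variables (R : realType) (H : hilbert R).
Local Notation C := (Cplx R).
Local Notation Re := (@complex.Re R).
Implicit Types (x y : H) (P Q : {linear H -> H}).

Lemma linearB2 P Q (a : C) x y :
  P (a *: x + y) - Q (a *: x + y) = a *: (P x - Q x) + (P y - Q y).
Proof. by rewrite (linearP P) (linearP Q) opprD addrACA -scalerBr. Qed.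

Definition orth_projector P := hsymmetric P /\ forall x, P (P x) = P x.

Lemma projector_rnorm P x : orth_projector P -> rnorm (P x) ^+ 2 = Re (ip x (P x)).
Proof. by move=> [sP PP]; rewrite -Re_ipxx -sP PP. Qed.

Lemma projector_le1 P : orth_projector P -> op_bound P 1.
Proof.
move=> pP x; rewrite mul1r; have [->|Px0] := eqVneq (rnorm (P x)) 0.
  exact: rnormv_ge0.
have Pp : 0 < rnorm (P x) by rewrite lt_neqAle eq_sym Px0 rnormv_ge0.
rewrite -(ler_pM2r Pp) -expr2 (projector_rnorm x pP); exact: Re_ip_le.
Qed.

(** Q kills x - Q x, hence P does too; the second identity is the adjoint of the first. *)
Lemma projector_subP P Q : orth_projector P -> orth_projector Q ->
  (forall x, rnorm (P x) <= rnorm (Q x)) ->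
  forall x, P (Q x) = P x /\ Q (P x) = P x.
Proof.
move=> [sP PP] [sQ QQ] PQ.
have h x : P (Q x) = P x.
  apply/esym/eqP; rewrite -subr_eq0 -linearB -rnormv_eq0; apply/eqP/le_anti.
  rewrite rnormv_ge0 andbT; apply: le_trans (PQ _) _.
  by rewrite linearB QQ subrr rnormv0.
move=> x; split=> //; apply/eqP; rewrite -subr_eq0; apply/eqP.
by apply: ip_eq0P => y; rewrite ipBr sQ sP h -sP subrr.
Qed.

Lemma projectorB P Q : orth_projector P -> orth_projector Q ->
  (forall x, P (Q x) = P x) -> forall D : {linear H -> H},
  (forall x, D x = Q x - P x) -> orth_projector D /\
  forall x, rnorm (D x) ^+ 2 = rnorm (Q x) ^+ 2 - rnorm (P x) ^+ 2.
Proof.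
move=> pP pQ PQ D DE; have [sP PP] := pP; have [sQ QQ] := pQ.
have QP x : Q (P x) = P x.
  apply/eqP; rewrite -subr_eq0; apply/eqP.
  by apply: ip_eq0P => y; rewrite ipBr sQ sP PQ -sP subrr.
have pD : orth_projector D.
  split=> [x y|x]; first by rewrite !DE ipBr ipBl sP sQ.
  by rewrite !DE linearB (linearB P) QQ QP PQ PP subrr subr0.
split=> // x; rewrite !projector_rnorm// DE ipBr ReB.
by [].
Qed.

(** The difference has a vanishing, hence nonnegative, form, so [form_cauchy_schwarz] annihilates
    all its matrix elements. *)
Lemma hsymmetric_form_eq P Q : hsymmetric P -> hsymmetric Q ->
  (forall x, Re (ip x (P x)) = Re (ip x (Q x))) -> forall x, P x = Q x.
Proof.
move=> sP sQ PQ x.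
have lD (a : C) y z : (P (a *: y + z) - Q (a *: y + z)) =
    a *: (P y - Q y) + (P z - Q z).
  exact: linearB2.
pose D := @linear_of R H (fun y => P y - Q y) lD.
have sD : hsymmetric D by move=> y z; rewrite /= ipBr ipBl sP sQ.
have D0 y : Re (ip y (D y)) = 0 by rewrite /= ipBr ReB PQ subrr.
suff : D x = 0 by move/eqP; rewrite /= subr_eq0 => /eqP.
apply: ip_eq0P => y; apply: rnorm_eq0; apply/eqP; rewrite -sqrf_eq0 eq_le sqr_ge0.
rewrite andbT.
have := @form_cauchy_schwarz _ _ D setT sD (fun _ _ _ _ _ => I).
move=> /(_ _ y x I I); rewrite !D0 mul0r; apply.
by move=> z _; rewrite D0.
Qed.

(** The squared distance of P m x and P n x is the difference of their squared norms, and these form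
    a bounded monotone sequence. *)
Lemma projector_monotone_cvg (P : nat -> {linear H -> H}) :
  (forall n, orth_projector (P n)) ->
  (forall n x, rnorm (P n x) <= rnorm (P n.+1 x)) ->
  exists Q : {linear H -> H}, orth_projector Q /\
    forall x, (fun n => P n x) @ \oo --> Q x.
Proof.
move=> pP Pnd.
have mono m n x : (m <= n)%N -> rnorm (P m x) <= rnorm (P n x).
  move=> /subnK <-; elim: (n - m)%N => // k IH.
  exact: le_trans IH (Pnd _ _).
have dist m n x : (m <= n)%N ->
    rnorm (P n x - P m x) ^+ 2 = rnorm (P n x) ^+ 2 - rnorm (P m x) ^+ 2.
  move=> mn; have h y := projector_subP (pP m) (pP n) (fun z => mono m n z mn) y.
  have lD (a : C) y z : (P n (a *: y + z) - P m (a *: y + z)) =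
      a *: (P n y - P m y) + (P n z - P m z).
    exact: linearB2.
  have [_ /(_ x)] := @projectorB (P m) (P n) (pP m) (pP n) (fun y => (h y).1)
    (linear_of lD) (fun y => erefl).
  by [].
have /choice[f hf] x : exists l : H, (fun n => P n x) @ \oo --> l.
  apply: hilbert_complete => e e0.
  have cv : cvgn (fun n => rnorm (P n x) ^+ 2).
    apply: nondecreasing_is_cvgn.
      apply/nondecreasing_seqP => n; apply: ler_sqr_nneg; rewrite ?rnormv_ge0//.
    exists (rnorm x ^+ 2) => _ [n _ <-]; apply: ler_sqr_nneg; rewrite ?rnormv_ge0//.
    by have := projector_le1 (pP n) x; rewrite mul1r.
  have /cvg_ex[/= s /cvgrPdist_le sb] := cv.
  have /sb[n0 _ hn] : 0 < e ^+ 2 / 2 by rewrite divr_gt0 ?exprn_gt0.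
  exists n0.
  suff h m n : (n0 <= m)%N -> (m <= n)%N -> rnorm (P n x - P m x) <= e.
    move=> m n nm nn; case: (leqP n m) => [|/ltnW] mn; first exact: h.
    by rewrite rnormvB h.
  move=> nm mn; rewrite -(@ler_pXn2r _ 2) ?nnegrE ?rnormv_ge0 ?(ltW e0)// dist//.
  have := hn _ nm; have := hn _ (leq_trans nm mn) => /=.
  by rewrite !ler_distl; lra.
have lf (a : C) x y : f (a *: x + y) = a *: f x + f y.
  apply: cvg_uniq (hf (a *: x + y)) _.
  under eq_fun do rewrite linearP.
  by apply: cvgD; [apply: cvgZr|]; exact: hf.
exists (linear_of lf); split=> //.
have sf x y : ip x (f y) = ip (f x) y.
  have h1 : (fun n => ip x (P n y)) @ \oo --> ip x (f y).
    exact: (cvg_ip _ (hf y)).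
  have h2 : (fun n => (ip y (P n x))^*) @ \oo --> ip (f x) y.
    by rewrite -ip_conj; apply: cvg_conj; exact: (cvg_ip _ (hf x)).
  apply: (cvg_unique (@norm_hausdorff _ _) h1); rewrite /set1/=.
  rewrite (_ : (fun n => ip x _) = (fun n => (ip y (P n x))^*))//.
  by apply/funext => n; rewrite ip_conj (pP n).1.
split=> // x /=; apply: cvg_uniq (hf x).
have -> : (fun n => P n x) = (fun n => P n (P n x - f x) + P n (f x)).
  by apply/funext => n; rewrite linearB (pP n).2 subrK.
rewrite -[X in _ --> X]add0r; apply: cvgD; last exact: hf.
apply/cvg_rnormP.
have h0 : (fun n => rnorm (P n x - f x)) @ \oo --> (0 : R).
  exact: (proj1 (cvg_rnormP _ _ _) (hf x)).
apply: (squeeze_cvgr _ (cvg_cst 0) h0); apply: nearW => n.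
by rewrite rnormv_ge0 subr0; have := projector_le1 (pP n) (P n x - f x); rewrite mul1r.
Qed.

End Projections.

Section Resolution.
Variables (R : realType) (H : hilbert R).
Local Notation C := (Cplx R).
Local Notation Re := (@complex.Re R).
Implicit Types (x y : H).
Variables (S : {linear H -> H}) (m : R).
Hypotheses (m0 : 0 <= m) (Sm : op_bound S m) (sS : hsymmetric S).

Lemma shift_linear (a : C) x y : (S (a *: x + y) + cofR m *: (a *: x + y)) =
  a *: (S x + cofR m *: x) + (S y + cofR m *: y).
Proof.
rewrite linearP !scalerDr !scalerA [cofR m * a]mulrC.
by rewrite addrACA.
Qed.

(** Orbit growth detects spectral subspaces only for positive operators. S + m is positive, and the
    parameter l becomes l + m in [M]. *)
Let A : {linear H -> H} := linear_of shift_linear.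

Let sA : hsymmetric A.
Proof. by move=> x y; rewrite /= ipDr ipDl ipZr ipZl conj_cofR sS. Qed.

Let AE x : Re (ip x (A x)) = Re (ip x (S x)) + m * rnorm x ^+ 2.
Proof. by rewrite /= ipDr ReD ipZr Re_cofRM Re_ipxx. Qed.

Let A0 x : 0 <= Re (ip x (A x)).
Proof.
rewrite AE; have := rnormv_ge0 x; have := Sm x.
have := Re_ip_le (- x) (S x); rewrite rnormvN ipNl ReN; nra.
Qed.

Let Am : op_bound A (m + m).
Proof.
move=> x; apply: le_trans (rnormvD _ _) _; rewrite rnormvZ rnorm_cofR ger0_norm//.
by rewrite mulrDl lerD2r; exact: Sm.
Qed.

Let mm0 : 0 <= m + m. Proof. exact: addr_ge0. Qed.

Let M l := growth_space A (l + m).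
Let Mcl l : closed_subspace (M l). Proof. exact: growth_space_closed mm0 Am sA _. Qed.

Definition spectral_family (l : R) : {linear H -> H} :=
  linear_of (hproj_linear (Mcl l)).
Local Notation G := spectral_family.

Lemma spectral_family_projector l : orth_projector (G l).
Proof.
split; first exact: hproj_symmetric.
by move=> x; apply: hproj_id => //; exact: (hprojP x (Mcl l)).1.
Qed.

Lemma spectral_family_min l k x : l <= k -> G l (G k x) = G l x /\ G k (G l x) = G l x.
Proof.
move=> lk.
have h y : G k (G l y) = G l y.
  apply: hproj_id => //; apply: (@growth_space_le _ _ _ (l + m)); first by rewrite lerD2r.
  exact: (hprojP y (Mcl l)).1.
split=> //; apply/eqP; rewrite -subr_eq0; apply/eqP; apply: ip_eq0P => y.
have [sl _] := spectral_family_projector l; have [sk _] := spectral_family_projector k.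
by rewrite ipBr sl sk h -sl subrr.
Qed.

Lemma spectral_family_lt l x : l < - m -> G l x = 0.
Proof.
move=> lm; apply: (@growth_space_lt0 _ _ A (l + m)); first by lra.
exact: (hprojP x (Mcl l)).1.
Qed.

Lemma spectral_family_ge l x : m <= l -> G l x = x.
Proof.
move=> ml; apply: hproj_id => //; apply: (growth_spaceT mm0 Am).
by rewrite lerD2r.
Qed.

Lemma spectral_family_commute l x : S (G l x) = G l (S x).
Proof.
have GA y : M l y -> M l (S y).
  move=> My; have -> : S y = A y - cofR m *: y by rewrite /= addrK.
  apply: (csB (Mcl l)); last exact: (csZ _ (Mcl l)).
  exact: growth_space_A.
have [Mx ox] := hprojP x (Mcl l).
apply/esym/hproj_eq => //; first exact: GA.
by move=> z Mz; rewrite -linearB sS; apply: ox; exact: GA.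
Qed.

(** y lies in the growth space of b and is orthogonal to that of a; [growth_space_upper] and
    [growth_space_lower] give the two inequalities. *)
Lemma spectral_family_bounds a b x y : a <= b -> y = G b x - G a x ->
  a * rnorm y ^+ 2 <= Re (ip y (S y)) <= b * rnorm y ^+ 2.
Proof.
move=> ab yGG.
have := AE y; set u := Re (ip y (A y)); set w := Re (ip y (S y)) => uw.
have Mb z : M b (G b z) by exact: (hprojP z (Mcl b)).1.
have yE : y = G b (x - G a x).
  by rewrite yGG (linearB (G b)) (spectral_family_min x ab).2.
have h1 : u <= (b + m) * rnorm y ^+ 2.
  by apply: (@growth_space_upper _ _ A); rewrite yE; exact: Mb.
have h2 : (a + m) * rnorm y ^+ 2 <= u.
  apply: (growth_space_lower mm0 Am sA A0) => z Mz.
  have yE' : y = G b x - G a (G b x) by rewrite yGG (spectral_family_min x ab).1.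
  by rewrite yE'; exact: (hprojP (G b x) (Mcl a)).2.
by apply/andP; split; lra.
Qed.

Definition spectral_cumul x (l : R) : R := rnorm (G l x) ^+ 2.

Lemma spectral_cumulB a b x : a <= b ->
  rnorm (G b x - G a x) ^+ 2 = spectral_cumul x b - spectral_cumul x a.
Proof.
move=> ab.
have lD (c : C) y z : (G b (c *: y + z) - G a (c *: y + z)) =
    c *: (G b y - G a y) + (G b z - G a z).
  exact: linearB2.
have [_ /(_ x)] := @projectorB _ _ (G a) (G b) (spectral_family_projector a)
  (spectral_family_projector b) (fun y => (spectral_family_min y ab).1)
  (linear_of lD) (fun y => erefl).
by [].
Qed.

Lemma spectral_cumul_nd x : {homo spectral_cumul x : a b / a <= b}.
Proof.
by move=> a b ab; rewrite -subr_ge0 -(spectral_cumulB x ab) sqr_ge0.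
Qed.

(** Monotone norms make the sequence Cauchy. Its limit lies in all growth spaces beyond l, hence in
    that of l, and its difference from x stays orthogonal to the latter: it is the projection of
    x. *)
Lemma spectral_family_rc l x :
  (fun k => G (l + k.+1%:R^-1) x) @ \oo --> G l x.
Proof.
pose u k := G (l + k.+1%:R^-1) x.
have inv j k : (j <= k)%N -> k.+1%:R^-1 <= j.+1%:R^-1 :> R.
  by move=> jk; rewrite lef_pV2 ?posrE ?ltr0n// ler_nat ltnS.
have [y uy] : exists y : H, u @ \oo --> y.
  apply: hilbert_complete => e e0.
  have cv : cvgn (fun k => spectral_cumul x (l + k.+1%:R^-1)).
    apply: nonincreasing_is_cvgn.
      apply/nonincreasing_seqP => n; apply: spectral_cumul_nd; rewrite lerD2l.
      exact: inv.
    by exists 0 => _ [n _ <-]; exact: sqr_ge0.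
  have /cvg_ex[/= s /cvgrPdist_le sb] := cv.
  have /sb[n0 _ hn] : 0 < e ^+ 2 / 2 by rewrite divr_gt0 ?exprn_gt0.
  exists n0.
  suff h j k : (n0 <= j)%N -> (j <= k)%N -> rnorm (u j - u k) <= e.
    move=> j k nj nk; case: (leqP j k) => [|/ltnW] jk; first exact: h.
    by rewrite rnormvB h.
  move=> nj jk; rewrite -(@ler_pXn2r _ 2) ?nnegrE ?rnormv_ge0 ?(ltW e0)//.
  rewrite spectral_cumulB ?lerD2l ?inv//.
  have := hn _ nj; have := hn _ (leq_trans nj jk) => /=.
  by rewrite !ler_distl; lra.
suff <- : y = G l x by [].
apply/esym/hproj_eq => //.
  apply: growth_space_rc => k.
  have cl := Mcl (l + k.+1%:R^-1).
  have -> : l + m + k.+1%:R^-1 = l + k.+1%:R^-1 + m by rewrite addrAC.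
  apply: (cs_cvg cl (u := fun n => u (n + k)%N)); last by rewrite cvg_shiftn.
  move=> n; apply: (@growth_space_le _ _ _ (l + (n + k).+1%:R^-1 + m)).
    by rewrite lerD2r lerD2l inv// leq_addl.
  exact: (hprojP x (Mcl _)).1.
move=> z Mz.
have h : (fun k => ip z (x - u k)) @ \oo --> ip z (x - y).
  by apply: cvg_ip; apply: cvgB => //; exact: cvg_cst.
apply: rnorm_eq0; apply/le_anti; rewrite rnormv_ge0 andbT.
apply: (cvg_rnorm_le h); exists 0%N => k _.
rewrite (hprojP x (Mcl _)).2 ?rnormv0//.
by apply: growth_space_le Mz; rewrite lerD2r lerDl.
Qed.

Lemma spectral_cumul_rc x : right_continuous (spectral_cumul x).
Proof.
move=> l; apply/cvgrPdist_le => e e0.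
have h : (fun k => spectral_cumul x (l + k.+1%:R^-1)) @ \oo --> spectral_cumul x l.
  rewrite /spectral_cumul; under eq_fun do rewrite expr2; rewrite expr2.
  by apply: cvgM; apply: cvg_rnorm; exact: spectral_family_rc.
move/cvgrPdist_le : h => /(_ _ e0)[k _ /(_ k (leqnn k))] /= hk.
near=> t.
have lt : l < t by near: t; exact: nbhs_right_gt.
have tk : t < l + k.+1%:R^-1.
  by near: t; apply: nbhs_right_lt; rewrite ltrDl invr_gt0.
have h1 := spectral_cumul_nd x (ltW lt); have h2 := spectral_cumul_nd x (ltW tk).
move: hk; rewrite distrC ger0_norm; last by rewrite subr_ge0 (le_trans h1).
by rewrite distrC ger0_norm ?subr_ge0//; lra.
Unshelve. all: by end_near. Qed.

End Resolution.

(** * From the spectral family to a projection-valued measure *)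

Section SpectralMeasure.
Variables (R : realType) (H : hilbert R).
Local Notation C := (Cplx R).
Local Notation Re := (@complex.Re R).
Local Notation borel := (measurableTypeR R).
Implicit Types (x y : H).
Variables (S : {linear H -> H}) (m : R).
Hypotheses (m0 : 0 <= m) (Sm : op_bound S m) (sS : hsymmetric S).
Local Notation G := (spectral_family m0 Sm sS).
Local Notation F := (spectral_cumul m0 Sm sS).

Definition spectral_cumulative x : cumulative R R :=
  HB.pack (F x) (@isCumulative.Build R _ R (F x)
    (@spectral_cumul_nd R H S m m0 Sm sS x) (@spectral_cumul_rc R H S m m0 Sm sS x)).

Definition spectral_mu x : {measure set borel -> \bar R} :=
  lebesgue_stieltjes_measure (spectral_cumulative x).
Local Notation mu := spectral_mu.

Lemma spectral_mu_itv x a b : a <= b ->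
  mu x (`]a, b]%classic : set R) = (F x b - F x a)%:E.
Proof.
move=> ab; rewrite /spectral_mu /= /lebesgue_stieltjes_measure /measure_extension.
rewrite measurable_mu_extE; last exact: is_ocitv.
exact: (wlength_itv_bnd (spectral_cumulative x) false false ab).
Qed.

Lemma measurable_borel_itv a b : measurable (`]a, b]%classic : set borel).
Proof. by apply: sub_sigma_algebra; exact: is_ocitv. Qed.

Lemma spectral_mu_itvT x (a b : R) : a < - m -> m <= b ->
  mu x (`]a, b]%classic : set R) = (rnorm x ^+ 2)%:E.
Proof.
move=> am mb; rewrite spectral_mu_itv; last first.
  by apply: le_trans (ltW am) (le_trans _ mb); rewrite -subr_ge0 opprK addr_ge0.
rewrite /spectral_cumul (spectral_family_ge m0 Sm sS x mb).
by rewrite (spectral_family_lt m0 Sm sS x am) rnormv0 expr0n subr0.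
Qed.

Lemma spectral_muT x : mu x setT = (rnorm x ^+ 2)%:E.
Proof.
have U : \bigcup_n (`](- n%:R)%R, n%:R]%classic : set R) = setT.
  rewrite -subTset => /= t _ /=; exists (Num.bound `|t|) => //=.
  have := archi_boundP (normr_ge0 t); rewrite in_itv/= ltr_norml.
  by move=> /andP[-> /ltW ->].
have cv := @nondecreasing_cvg_mu _ _ _ (mu x)
  (fun n => `](- n%:R)%R, n%:R]%classic : set R).
rewrite U in cv; apply: (cvg_unique (@ereal_hausdorff R) (cv _ _ _)).
- by move=> n; exact: measurable_borel_itv.
- exact: measurableT.
- move=> i j ij; apply/subsetPset => t /=; rewrite !in_itv/= => /andP[h1 h2].
  have ijR : i%:R <= j%:R :> R by rewrite ler_nat.
  by apply/andP; split; lra.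
apply: cvg_near_cst; exists (Num.bound m).+1 => // n /= mn.
apply: spectral_mu_itvT.
  rewrite ltrN2; apply: le_lt_trans (ler_norm _) _.
  apply: lt_le_trans (_ : (Num.bound m)%:R <= _).
    by rewrite ger0_norm//; exact: archi_boundP.
  by rewrite ler_nat ltnW.
apply: (@le_trans _ _ (Num.bound m)%:R); last by rewrite ler_nat ltnW.
by apply: ltW; exact: archi_boundP.
Qed.

Lemma spectral_mu_le x B : measurable B -> (mu x B <= (rnorm x ^+ 2)%:E)%E.
Proof.
by move=> mB; rewrite -spectral_muT; apply: le_measure; rewrite ?inE.
Qed.

Lemma spectral_mu_fin x B : measurable B -> mu x B \is a fin_num.
Proof.
move=> mB; rewrite ge0_fin_numE//; apply: le_lt_trans (spectral_mu_le x mB) _.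
exact: ltry.
Qed.

Lemma spectral_muD x (A B : set borel) : measurable A -> measurable B ->
  B `<=` A -> mu x (A `\` B) = (mu x A - mu x B)%E.
Proof.
move=> mA mB BA; rewrite -{2}(setIidr BA).
by apply: measureD => //; rewrite -ge0_fin_numE ?spectral_mu_fin.
Qed.

(** Tying P to the measures of all x at once determines it, by [hsymmetric_form_eq]. *)
Definition has_projector (B : set borel) (P : {linear H -> H}) :=
  orth_projector P /\ forall x, mu x B = (rnorm (P x) ^+ 2)%:E.

Definition projected : set (set borel) :=
  [set B | measurable B /\ exists P, has_projector B P].

Lemma has_projector_sub A B P Q : measurable A -> measurable B -> B `<=` A ->
  has_projector A P -> has_projector B Q -> forall x, rnorm (Q x) <= rnorm (P x).
Proof.
move=> mA mB BA [_ PA] [_ QB] x; rewrite -(@ler_pXn2r _ 2) ?nnegrE ?rnormv_ge0//.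
by rewrite -lee_fin -PA -QB; apply: le_measure; rewrite ?inE.
Qed.

(** Dynkin class argument: proper differences of sets correspond to differences of nested
    projections, increasing unions to strong limits of increasing projections. *)
Lemma projected_lambda : lambda_system setT projected.
Proof.
split=> //.
- split; first exact: measurableT.
  exists idfun; split=> // x; exact: spectral_muT.
- move=> A B BA [mA [P hP]] [mB [Q hQ]]; split; first exact: measurableD.
  have QP := has_projector_sub mA mB BA hP hQ.
  have QPE x := (projector_subP hQ.1 hP.1 QP x).1.
  have [pD DE] := projectorB hQ.1 hP.1 QPE (D := linear_of (linearB2 P Q))
    (fun x => erefl).
  exists (linear_of (linearB2 P Q)); split=> // x.
  by rewrite spectral_muD// hP.2 hQ.2 DE.
- move=> B ndB hB; split; first by apply: bigcup_measurable => n _; exact: (hB n).1.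
  have /choice[P hP] n : exists P, has_projector (B n) P := (hB n).2.
  have mB n := (hB n).1.
  have sub n : B n `<=` B n.+1 by apply/subsetPset; exact: ndB.
  have [Q [pQ PQ]] := projector_monotone_cvg (fun n => (hP n).1)
    (fun n => has_projector_sub (mB n.+1) (mB n) (sub n) (hP n.+1) (hP n)).
  exists Q; split=> // x.
  apply: (cvg_unique (@ereal_hausdorff R) (nondecreasing_cvg_mu _ _ ndB)) => //.
    by apply: bigcup_measurable => n _.
  rewrite /set1 /=.
  rewrite (_ : mu x \o B = fun n => (rnorm (P n x) ^+ 2)%:E); last first.
    by apply/funext => n /=; rewrite (hP n).2.
  apply: cvg_EFin; first exact: nearW.
  under eq_fun do rewrite /= expr2; rewrite expr2.
  by apply: cvgM; apply: cvg_rnorm; exact: PQ.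
Qed.

Lemma spectral_family_itv_projector a b : a <= b ->
  has_projector `]a, b]%classic (linear_of (linearB2 (G b) (G a))).
Proof.
move=> ab.
have [pD DE] := projectorB (spectral_family_projector m0 Sm sS a)
  (spectral_family_projector m0 Sm sS b)
  (fun x => (spectral_family_min m0 Sm sS x ab).1)
  (D := linear_of (linearB2 (G b) (G a))) (fun x => erefl).
by split=> // x; rewrite spectral_mu_itv// DE.
Qed.

Lemma has_projector0 : has_projector set0 \0.
Proof.
split=> [|x]; last by rewrite measure0 /= rnormv0 expr0n.
by split=> [x y|x] //=; rewrite ip0l ip0r.
Qed.

Lemma projected_borel (B : set borel) : measurable B -> projected B.
Proof.
apply: (@lambda_system_subset _ (@ocitv R) (@ocitvI R) setT projected) => //.
  exact: projected_lambda.
move=> _ [[a b] _ <-] /=; split; first exact: measurable_borel_itv.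
have [ab|ba] := leP a b.
  by exists (linear_of (linearB2 (G b) (G a))); exact: spectral_family_itv_projector.
exists \0; rewrite set_itv_ge; first exact: has_projector0.
by rewrite bnd_simp -leNgt ltW.
Qed.

(** The default 0 can occur only for sets that are not Borel, by [projected_borel]. *)
Definition spectral_E (B : set R) : {linear H -> H} :=
  if pselect (exists P, has_projector B P) is left h then projT1 (cid h)
  else \0.
Local Notation E := spectral_E.

Lemma spectral_EP (B : set borel) : measurable B -> has_projector B (E B).
Proof.
move=> mB; rewrite /E; case: pselect => [h|]; first by case: (cid h).
by move=> h; exfalso; apply: h; exact: (projected_borel mB).2.
Qed.

Lemma spectral_E_projector (B : set borel) : measurable B -> orth_projector (E B).
Proof. by move=> /spectral_EP[]. Qed.

Lemma spectral_mu_E x (B : set borel) : measurable B ->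
  mu x B = (Re (ip x (E B x)))%:E.
Proof. by move=> mB; rewrite (spectral_EP mB).2 projector_rnorm//; exact: spectral_E_projector. Qed.

Lemma spectral_E_unique (B : set borel) (P : {linear H -> H}) : measurable B ->
  has_projector B P -> forall x, E B x = P x.
Proof.
move=> mB hP; have pE := spectral_E_projector mB.
apply: hsymmetric_form_eq; [exact: pE.1|exact: hP.1.1|move=> x].
apply: EFin_inj; rewrite -spectral_mu_E// hP.2 projector_rnorm//.
exact: hP.1.
Qed.

Lemma spectral_ET x : E setT x = x.
Proof.
rewrite (@spectral_E_unique setT idfun)//.
by split=> // y; exact: spectral_muT.
Qed.

Lemma spectral_E_itv a b x : a <= b -> E `]a, b]%classic x = G b x - G a x.
Proof.
by move=> ab; rewrite (spectral_E_unique _ (spectral_family_itv_projector ab)).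
Qed.

Lemma spectral_E0 x : E set0 x = 0.
Proof. by rewrite (spectral_E_unique _ has_projector0). Qed.

Lemma spectral_ED (A B : set borel) x : measurable A -> measurable B ->
  B `<=` A -> E (A `\` B) x = E A x - E B x.
Proof.
move=> mA mB BA.
have hA := spectral_EP mA; have hB := spectral_EP mB.
have QP := has_projector_sub mA mB BA hA hB.
have QPE y := (projector_subP hB.1 hA.1 QP y).1.
have [pD DE] := projectorB hB.1 hA.1 QPE (D := linear_of (linearB2 (E A) (E B)))
    (fun x => erefl).
rewrite (@spectral_E_unique _ (linear_of (linearB2 (E A) (E B))))//.
  exact: measurableD.
by split=> // y; rewrite spectral_muD// hA.2 hB.2 DE.
Qed.

Lemma spectral_E_cvg (B : nat -> set borel) x : (forall n, measurable (B n)) ->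
  {homo B : n k / (n <= k)%N >-> (n <= k)%O} ->
  (fun n => E (B n) x) @ \oo --> E (\bigcup_n B n) x.
Proof.
move=> mB ndB.
have sub n : B n `<=` B n.+1 by apply/subsetPset; exact: ndB.
have mU : measurable (\bigcup_n B n : set borel) by exact: bigcup_measurable.
have hP n := spectral_EP (mB n).
have [Q [pQ PQ]] := projector_monotone_cvg (fun n => (hP n).1)
    (fun n => has_projector_sub (mB n.+1) (mB n) (sub n) (hP n.+1) (hP n)).
rewrite (spectral_E_unique mU (P := Q))//; split=> // y.
apply: (cvg_unique (@ereal_hausdorff R) (nondecreasing_cvg_mu mB mU ndB)) => //.
rewrite /set1 /=.
rewrite (_ : mu y \o B = fun n => (rnorm (E (B n) y) ^+ 2)%:E); last first.
  by apply/funext => n /=; rewrite (hP n).2.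
apply: cvg_EFin; first exact: nearW.
under eq_fun do rewrite /= expr2; rewrite expr2.
by apply: cvgM; apply: cvg_rnorm; exact: PQ.
Qed.

(** A product of two [G] is the one with the smaller parameter, so only the relative position of the
    endpoints matters. *)
Lemma spectral_E_itvI a b c d x :
  E `]a, b]%classic (E `]c, d]%classic x) = E (`]a, b] `&` `]c, d]) x.
Proof.
have [ab|ba] := leP a b; last first.
  rewrite [`]a, b]%classic]set_itv_ge ?bnd_simp -?leNgt ?(ltW ba)//.
  by rewrite set0I !spectral_E0.
have [cd|dc] := leP c d; last first.
  rewrite [`]c, d]%classic]set_itv_ge ?bnd_simp -?leNgt ?(ltW dc)//.
  by rewrite setI0 !spectral_E0 linear0.
have gm k l y : k <= l -> G k (G l y) = G k y.
  by move=> kl; rewrite (spectral_family_min m0 Sm sS y kl).1.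
have gM k l y : k <= l -> G l (G k y) = G k y.
  by move=> kl; rewrite (spectral_family_min m0 Sm sS y kl).2.
rewrite !spectral_E_itv// !(linearB (G _)).
have [bc|cb] := leP b c.
  rewrite (gm b d) ?(le_trans bc)// (gm b c)// (gm a d) ?(le_trans ab) ?(le_trans bc)//.
  rewrite (gm a c) ?(le_trans ab)// !subrr.
  rewrite (_ : _ `&` _ = set0) ?spectral_E0// -subset0 => t [] /=.
  by rewrite !in_itv/=; lra.
have [da|ad] := leP d a.
  rewrite (gM d b) ?(le_trans da)// (gM c b) ?(le_trans cd) ?(le_trans da)//.
  rewrite (gM d a)// (gM c a) ?(le_trans cd)// subrr.
  rewrite (_ : _ `&` _ = set0) ?spectral_E0// -subset0 => t [] /=.
  by rewrite !in_itv/=; lra.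
rewrite (gM c b) ?(ltW cb)// (gm a d) ?(ltW ad)//.
have -> : `]a, b] `&` `]c, d] = `](Num.max a c), (Num.min b d)]%classic.
  apply/seteqP; split=> t /=; rewrite !in_itv/= gt_max le_min.
    by move=> [/andP[-> ->] /andP[-> ->]].
  by move=> /andP[/andP[-> ->] /andP[-> ->]].
rewrite spectral_E_itv; last by rewrite ge_max !le_min ab cd (ltW cb) (ltW ad).
have -> : G b (G d x) = G (Num.min b d) x.
  by case: leP => h; [exact: gm|apply: gM; exact: ltW].
have [ac|ca] := leP a c.
  by rewrite (gm a c)// subrr subr0.
by rewrite (gM c a) ?(ltW ca)// opprB addrA subrK.
Qed.

(** With one factor fixed, multiplicativity is stable under the operations of a Dynkin class in the
    other, hence extends from a pi-system to its sigma-algebra. *)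
Lemma spectral_E_setI_lambda (X : set borel) (g : set (set borel)) :
  measurable X -> setI_closed g ->
  (forall D, g D -> measurable D) ->
  (forall D, g D -> forall x, E X (E D x) = E (X `&` D) x) ->
  forall D, <<s g >> D -> measurable D /\ forall x, E X (E D x) = E (X `&` D) x.
Proof.
move=> mX gI mg hg.
apply: (@lambda_system_subset _ g gI setT
  [set D : set borel | measurable D /\ forall x, E X (E D x) = E (X `&` D) x]) => //.
split=> //.
- by split; [exact: measurableT|move=> x; rewrite setIT spectral_ET].
- move=> A B BA [mA hA] [mB hB]; split; first exact: measurableD.
  move=> x; rewrite spectral_ED// linearB hA hB -spectral_ED.
  + by rewrite setIDA; congr (E _ x); apply/seteqP; split=> t /=; tauto.
  + exact: measurableI.
  + exact: measurableI.
  + exact: setIS.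
- move=> B ndB hB; have mB n := (hB n).1.
  split; first by apply: bigcup_measurable => n _.
  move=> x; rewrite setI_bigcupr.
  have ndX : {homo (fun n => X `&` B n) : i j / (i <= j)%N >-> (i <= j)%O}.
    by move=> i j ij; apply/subsetPset; apply: setIS; apply/subsetPset; exact: ndB.
  have h1 := @spectral_E_cvg _ x (fun n => measurableI _ _ mX (mB n)) ndX.
  apply: cvg_uniq h1.
  under eq_fun do rewrite -(hB _).2.
  apply: cvg_bounded (@spectral_E_cvg B x mB ndB).
  exact: projector_le1 (spectral_E_projector mX).
- by move=> D gD; split; [exact: mg|exact: hg].
Qed.

Lemma spectral_EI (B D : set borel) x : measurable B -> measurable D ->
  E (B `&` D) x = E B (E D x).
Proof.
move=> mB mD.
have mo (Y : set borel) : @ocitv R Y -> measurable Y.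
  by move=> [[c d] _ <-]; exact: measurable_borel_itv.
have step1 a b (Y : set borel) y : measurable Y ->
    E `]a, b]%classic (E Y y) = E (`]a, b] `&` Y) y.
  move=> mY.
  have h (Z : set borel) : @ocitv R Z -> forall z,
      E `]a, b]%classic (E Z z) = E (`]a, b] `&` Z) z.
    by move=> [[c d] _ <-] z; exact: spectral_E_itvI.
  by rewrite (spectral_E_setI_lambda (measurable_borel_itv a b) (@ocitvI R) mo h mY).2.
(* Taking adjoints exchanges the factors of [step1]; a second extension then frees the interval. *)
have h (Z : set borel) : @ocitv R Z -> forall z, E B (E Z z) = E (B `&` Z) z.
  move=> oZ z; have mZ := mo _ oZ; case: oZ mZ => [[c d] _ <-] /= mcd.
  have mI : measurable (`]c, d] `&` B : set borel) by exact: measurableI.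
  apply/eqP; rewrite -subr_eq0; apply/eqP; apply: ip_eq0P => y; rewrite ipBr.
  rewrite (spectral_E_projector mB).1 (spectral_E_projector mcd).1 step1//.
  by rewrite (setIC B) -(spectral_E_projector mI).1 subrr.
by rewrite (spectral_E_setI_lambda mB (@ocitvI R) mo h mD).2.
Qed.

End SpectralMeasure.

(** A subdivision into n + 1 equal pieces leaves a total error (b - a)(F b - F a) / (n + 1). This
    takes the place of Riemann-Stieltjes sums in [spectral_integral]. *)
Lemma increments_eq (R : realType) (P Q F : R -> R) (a b : R) : a <= b ->
  (forall s t, a <= s -> s <= t -> t <= b ->
    `|(P t - P s) - (Q t - Q s)| <= (t - s) * (F t - F s)) ->
  P b - P a = Q b - Q a.
Proof.
move=> ab h.
have key n : `|(P b - P a) - (Q b - Q a)| <= ((b - a) * (F b - F a)) * n.+1%:R^-1.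
  pose d := (b - a) / n.+1%:R; pose t k := a + k%:R * d.
  have n0 : (n.+1%:R : R) != 0 by rewrite pnatr_eq0.
  have d0 : 0 <= d by rewrite divr_ge0 ?subr_ge0.
  have ta : t 0%N = a by rewrite /t mul0r addr0.
  have tb : t n.+1 = b by rewrite /t mulrC divfK// addrC subrK.
  have part k : (k <= n.+1)%N ->
      `|(P (t k) - P a) - (Q (t k) - Q a)| <= d * (F (t k) - F a).
    elim: k => [|k IH] kn; first by rewrite ta !subrr normr0 mulr0.
    have tk : t k.+1 - t k = d by rewrite /t -natr1; ring.
    have hk : a <= t k by rewrite /t lerDl mulr_ge0.
    have hk1 : t k <= t k.+1 by rewrite -subr_ge0 tk.
    have hkb : t k.+1 <= b.
      by rewrite -tb /t lerD2l ler_wpM2r// ler_nat.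
    have := h _ _ hk hk1 hkb; have := IH (ltnW kn); rewrite tk.
    rewrite !ler_norml => /andP[h1 h2] /andP[h3 h4].
    by apply/andP; split; lra.
  by have := part n.+1 (leqnn _); rewrite tb /d mulrAC.
suff : `|(P b - P a) - (Q b - Q a)| <= 0.
  by rewrite normr_le0 subr_eq0 => /eqP.
apply/ler_addgt0Pl => e e0; rewrite addr0.
have [n0 /(_ n0 (leqnn _))] := inv_succ_small ((b - a) * (F b - F a)) e0.
exact: le_trans (key n0).
Qed.

(** Counterpart of [spectral_measure_of] on an abstract Hilbert space. *)
Record resolution (R : realType) (H : hilbert R) (S : H -> H)
    (E : set R -> {linear H -> H}) : Prop := Resolution {
  res_sym : forall B : set (measurableTypeR R), measurable B -> hsymmetric (E B);
  res_T : forall x, E setT x = x;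
  res_I : forall B D : set (measurableTypeR R), measurable B -> measurable D ->
    forall x, E (B `&` D) x = E B (E D x);
  res_int : forall x, exists mu : {measure set (measurableTypeR R) -> \bar R},
    [/\ forall B, measurable B -> mu B = (complex.Re (ip x (E B x)))%:E,
        mu.-integrable setT (EFin : R -> \bar R)
      & ip x (S x) = cofR (\int[mu]_t t)%R] }.

Section SpectralTheorem.
Variables (R : realType) (H : hilbert R).
Local Notation C := (Cplx R).
Local Notation Re := (@complex.Re R).
Local Notation borel := (measurableTypeR R).
Implicit Types (x y : H).
Variables (S : {linear H -> H}) (m : R).
Hypotheses (m0 : 0 <= m) (Sm : op_bound S m) (sS : hsymmetric S).
Local Notation G := (spectral_family m0 Sm sS).
Local Notation F := (spectral_cumul m0 Sm sS).
Local Notation mu := (spectral_mu m0 Sm sS).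
(** Larger than m because []-L, L]] is open on the left and [spectral_family_lt] asks for -L <
    -m. *)
Let L : R := m + 1.

Let LT x : mu x (`](- L), L]%classic : set borel) = (rnorm x ^+ 2)%:E.
Proof. by apply: spectral_mu_itvT; rewrite /L; [rewrite ltrN2 ltrDl|rewrite lerDl]. Qed.

Let integrable_itv x a b : (mu x).-integrable (`]a, b]%classic : set borel) (EFin : R -> \bar R).
Proof.
apply: (@measurable_bounded_integrable _ borel R (mu x) (fun t => t)).
- exact: measurable_borel_itv.
- by rewrite -ge0_fin_numE// spectral_mu_fin//; exact: measurable_borel_itv.
- exact: measurable_id.
- exists (`|a| + `|b|); split; first exact: num_real.
  move=> M hM t /=; rewrite in_itv/= => /andP[h1 h2].
  apply: le_trans (ltW hM); rewrite ler_norml.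
  have := ler_norm b; have := ler_norm (- a); rewrite normrN.
  have := normr_ge0 a; have := normr_ge0 b.
  by move=> ? ? ? ?; apply/andP; split; lra.
Qed.

Let null x : mu x (~` `](- L), L]%classic : set borel) = 0%E.
Proof.
by rewrite -setTD spectral_muD// spectral_muT LT subee.
Qed.

Lemma spectral_mu_integrable x : (mu x).-integrable setT (EFin : R -> \bar R).
Proof.
have mI := measurable_borel_itv (- L) L.
apply/(negligible_integrable (measurableC mI) measurableT _ (null x)).
  exact: EFin_measurable.
by rewrite setTD setCK; exact: integrable_itv.
Qed.

Lemma spectral_mu_int x :
  (\int[mu x]_t t)%R = (\int[mu x]_(t in `](- L), L]) t)%R.
Proof.
have mI := measurable_borel_itv (- L) L.
rewrite /Rintegral (negligible_integral (measurableC mI) measurableT _ (null x)).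
  by rewrite setTD setCK.
exact: spectral_mu_integrable.
Qed.

Lemma spectral_mu_int_bounds x a b : a <= b ->
  a * (F x b - F x a) <= (\int[mu x]_(t in `]a, b]) t)%R <= b * (F x b - F x a).
Proof.
move=> ab; have mI := measurable_borel_itv a b.
have ec (c : R) : (\int[mu x]_(t in `]a, b]) c)%R = c * (F x b - F x a).
  by rewrite Rintegral_cst// spectral_mu_itv.
have ic (c : R) : (mu x).-integrable (`]a, b]%classic : set borel) (EFin \o cst c).
  apply: (@measurable_bounded_integrable _ borel R (mu x) (fun=> c)) => //.
    by rewrite -ge0_fin_numE// spectral_mu_fin.
  exists `|c|; split; first exact: num_real.
  by move=> M hM t _; exact: ltW.
have ii := integrable_itv x a b.
apply/andP; split; rewrite -ec.
- apply: (le_Rintegral mI (ic a) ii) => t /=; rewrite in_itv/= => /andP[at_ _].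
  exact: ltW.
- by apply: (le_Rintegral mI ii (ic b)) => t /=; rewrite in_itv/= => /andP[].
Qed.

(** As functions of the upper end b, the integral over ]-L, b] and the form of S at G b x both have
    increments on ]s, t] between s and t times that of F x; [increments_eq] identifies them. *)
Lemma spectral_integral x : ip x (S x) = cofR (\int[mu x]_t t)%R.
Proof.
rewrite hsymmetric_Re// spectral_mu_int; congr cofR.
pose P b := (\int[mu x]_(t in `](- L), b]) t)%R.
pose Q b := Re (ip (G b x) (S (G b x))).
have LL : - L <= L by rewrite /L; move: m0; lra.
have GL : G (- L) x = 0 by apply: spectral_family_lt; rewrite /L; move: m0; lra.
have := @increments_eq _ P Q (F x) (- L) L LL.
have -> : P (- L) = 0.
  by rewrite /P set_itv_ge ?Rintegral_set0// bnd_simp -leNgt.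
have -> : Q (- L) = 0 by rewrite /Q GL ip0l.
rewrite !subr0 /Q spectral_family_ge; last by rewrite /L; move: m0; lra.
move=> h; apply/esym/h => s t Ls st tL {h}.
have -> : P t - P s = (\int[mu x]_(u in `]s, t]) u)%R.
  rewrite /P (_ : `](- L), t]%classic = `](- L), s] `|` `]s, t]); last first.
    by apply: itv_bndbnd_setU; rewrite bnd_simp.
  rewrite Rintegral_setU; first by rewrite addrC addKr.
  - exact: measurable_borel_itv.
  - exact: measurable_borel_itv.
  - by rewrite -itv_bndbnd_setU ?bnd_simp//; exact: integrable_itv.
  - apply/disj_setPS => u [] /=; rewrite !in_itv/= => /andP[_ us] /andP[su _].
    by have := lt_le_trans su us; rewrite ltxx.
have /andP[h1 h2] := spectral_mu_int_bounds x st.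
have /andP[h3 h4] := spectral_family_bounds st (erefl (G t x - G s x)).
rewrite spectral_cumulB// in h3 h4.
(* S commutes with [G s], so the cross terms between G s x and G t x - G s x vanish. *)
have -> : Re (ip (G t x) (S (G t x))) - Re (ip (G s x) (S (G s x))) =
    Re (ip (G t x - G s x) (S (G t x - G s x))).
  have [sG GG] := spectral_family_projector m0 Sm sS s.
  have Gy : G s (G t x - G s x) = 0.
    by rewrite (linearB (G s)) GG (spectral_family_min m0 Sm sS x st).1 subrr.
  have -> : G t x = G s x + (G t x - G s x) by rewrite addrC subrK.
  move: (G t x - G s x) Gy => y Gy; rewrite [G s x + y - _]addrC addKr.
  have c1 : ip (G s x) (S y) = 0.
    by rewrite -GG -sG -spectral_family_commute Gy linear0 ip0r.
  have c2 : ip y (S (G s x)) = 0 by rewrite sS -ip_conj c1 rmorph0.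
  by rewrite (linearD S) ipDr !ipDl c1 c2 addr0 add0r ReD addrC addKr.
rewrite ler_norml; apply/andP; split; lra.
Qed.

Theorem spectral_theorem : exists E, resolution S E.
Proof.
exists (spectral_E m0 Sm sS); split.
- by move=> B mB; exact: (spectral_E_projector m0 Sm sS mB).1.
- exact: spectral_ET.
- by move=> B D mB mD x; exact: spectral_EI.
- move=> x; exists (mu x); split; first by move=> B; exact: spectral_mu_E.
    exact: spectral_mu_integrable.
  exact: spectral_integral.
Qed.

End SpectralTheorem.

(** * Absolutely continuous vectors and Bessel vectors *)

Section ResolutionTheory.
Variables (R : realType) (H : hilbert R).
Local Notation C := (Cplx R).
Local Notation Re := (@complex.Re R).
Local Notation Im := (@complex.Im R).
Local Notation borel := (measurableTypeR R).
Implicit Types (x y : H).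
Variables (S : {linear H -> H}) (m : R) (E : set R -> {linear H -> H}).
Hypotheses (m0 : 0 <= m) (Sm : op_bound S m) (sS : hsymmetric S).
Hypothesis rE : resolution S E.

Lemma res_projector (B : set borel) : measurable B -> orth_projector (E B).
Proof.
move=> mB; split; first exact: res_sym rE B mB.
by move=> x; rewrite -(res_I rE mB mB) setIid.
Qed.

Lemma res_mu x : exists mu : {measure set borel -> \bar R},
  [/\ forall B : set borel, measurable B -> mu B = (rnorm (E B x) ^+ 2)%:E,
      mu.-integrable setT (EFin : R -> \bar R)
    & Re (ip x (S x)) = (\int[mu]_t t)%R].
Proof.
have [mu [h1 h2 h3]] := res_int rE x; exists mu; split=> //.
  by move=> B mB; rewrite h1// projector_rnorm//; exact: res_projector.
by rewrite h3.
Qed.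

Lemma res_0 x : E set0 x = 0.
Proof.
have [mu [h _ _]] := res_mu x; have := h set0 measurable0.
rewrite measure0 => -[h0]; move/esym/eqP : h0.
by rewrite sqrf_eq0 rnormv_eq0 => /eqP.
Qed.

Lemma res_disj (B D : set borel) x : measurable B -> measurable D ->
  B `&` D = set0 -> E B (E D x) = 0.
Proof. by move=> mB mD BD; rewrite -(res_I rE mB mD) BD res_0. Qed.

Lemma res_U (B D : set borel) x : measurable B -> measurable D ->
  B `&` D = set0 -> E (B `|` D) x = E B x + E D x.
Proof.
move=> mB mD BD; have mU : measurable (B `|` D : set borel) by exact: measurableU.
pose P := linear_of (linearD2 (E B) (E D)).
apply: (@hsymmetric_form_eq _ _ (E (B `|` D)) P).
- exact: res_sym rE _ mU.
- by move=> y z; rewrite /= ipDr ipDl (res_sym rE mB) (res_sym rE mD).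
- move=> y; have [mu [h _ _]] := res_mu y.
  rewrite /= ipDr ReD -!projector_rnorm//; try exact: res_projector.
  by apply: EFin_inj; rewrite EFinD -!h// measureU.
Qed.

Lemma res_C (B : set borel) x : measurable B -> x = E B x + E (~` B) x.
Proof.
move=> mB; rewrite -res_U//; last 2 first.
- exact: measurableC.
- exact: setICr.
by rewrite setUv (res_T rE).
Qed.

Lemma res_pythagoras (B D : set borel) x y : measurable B -> measurable D ->
  B `&` D = set0 -> E B x = x -> E D y = y -> ip x y = 0.
Proof.
move=> mB mD BD <- <-.
by rewrite -(res_sym rE mB) res_disj// ip0r.
Qed.

(** Every E D preserves the orthogonal ranges of E B and of E on the complement, so the spectral
    measure of x + y is the sum of the two. *)
Lemma res_mu_sum (B : set borel) x y : measurable B ->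
  E B x = x -> E (~` B) y = y ->
  Re (ip (x + y) (S (x + y))) = Re (ip x (S x)) + Re (ip y (S y)).
Proof.
move=> mB Bx By; have mC : measurable (~` B : set borel) by exact: measurableC.
have [mu [h1 h2 ->]] := res_mu (x + y).
have [mx [hx1 hx2 ->]] := res_mu x; have [my [hy1 hy2 ->]] := res_mu y.
have muE D : measurable D -> D `<=` setT -> mu D = measure_add mx my D.
  move=> mD _; rewrite measure_addE h1// hx1// hy1// linearD /= rnormD_orth//.
  have -> : E D x = E B (E D x).
    by rewrite -(res_I rE mB mD) setIC (res_I rE mD mB) Bx.
  have -> : E D y = E (~` B) (E D y).
    by rewrite -(res_I rE mC mD) setIC (res_I rE mD mC) By.
  by rewrite -(res_sym rE mB) res_disj// ?ip0r// setICr.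
rewrite /Rintegral (eq_measure_integral (measure_add mx my)); last first.
  by move=> D mD DT; exact: muE.
rewrite integral_measure_add//.
by rewrite fineD// integrable_fin_num.
Qed.

(** Additivity of the form kills the real part of the cross term; replacing y by i y kills the
    imaginary part. Since only the quadratic form of S is given by E, this is the way to
    [res_commute]. *)
Lemma res_orth_S (B : set borel) x y : measurable B ->
  E B x = x -> E (~` B) y = y -> ip x (S y) = 0.
Proof.
move=> mB Bx By.
have cross (z : H) : E (~` B) z = z -> Re (ip x (S z)) = 0.
  move=> Bz; have := res_mu_sum mB Bx Bz.
  rewrite (linearD S) ipDr !ipDl !ReD (sS z x) (Re_ipC (S z)); lra.
have h1 := cross y By.
have /cross : E (~` B) ('i *: y) = 'i *: y by rewrite (hlinZ (E _)) By.
rewrite (hlinZ S) ipZr; move: h1; case: (ip x (S y)) => a b /= ->.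
rewrite mul0r mul1r add0r => /eqP; rewrite oppr_eq0 => /eqP ->.
by [].
Qed.

Lemma res_commute (B : set borel) x : measurable B -> S (E B x) = E B (S x).
Proof.
move=> mB; have mC : measurable (~` B : set borel) by exact: measurableC.
have [sB BB] := res_projector mB; have [sC CC] := res_projector mC.
apply/eqP; rewrite -subr_eq0; apply/eqP; apply: ip_eq0P => y.
have e1 : ip y (S (E B x)) = ip (E B y) (S (E B x)).
  rewrite {1}(res_C y mB) ipDl [X in _ + X](_ : _ = 0) ?addr0//.
  by rewrite sS -ip_conj (@res_orth_S B)// rmorph0.
have e2 : ip (E B y) (S x) = ip (E B y) (S (E B x)).
  by rewrite {1}(res_C x mB) (linearD S) ipDr (@res_orth_S B _ (E (~` B) x))// addr0.
by rewrite ipBr sB e1 e2 subrr.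
Qed.

Lemma res_itv_bound (J : set borel) x : measurable J -> E J x = x ->
  exists mu : {measure set borel -> \bar R},
  [/\ mu J = (rnorm x ^+ 2)%:E, mu.-integrable J (EFin : R -> \bar R)
    & Re (ip x (S x)) = (\int[mu]_(t in J) t)%R].
Proof.
move=> mJ Jx; have mC : measurable (~` J : set borel) by exact: measurableC.
have [mu [h1 h2 h3]] := res_mu x; exists mu.
have n0 : mu (~` J) = 0%E.
  by rewrite h1// -Jx res_disj// ?rnormv0 ?expr0n// setICl.
split; first by rewrite h1// Jx.
  by apply: integrableS h2.
rewrite h3 /Rintegral (negligible_integral mC measurableT h2 n0).
by rewrite setTD setCK.
Qed.

Lemma res_lower (J : set borel) (a : R) x : measurable J ->
  (forall t : R, J t -> a <= t) -> E J x = x ->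
  a * rnorm x ^+ 2 <= Re (ip x (S x)).
Proof.
move=> mJ aJ Jx; have [mu [h1 h2 ->]] := res_itv_bound mJ Jx.
have -> : a * rnorm x ^+ 2 = (\int[mu]_(t in J) a)%R.
  by rewrite Rintegral_cst// h1.
apply: le_Rintegral => //; apply: (@measurable_bounded_integrable _ borel R mu (fun=> a)) => //.
  by rewrite h1 ltry.
exists `|a|; split; first exact: num_real.
by move=> M hM t _; exact: ltW.
Qed.

Lemma res_upper (J : set borel) (a : R) x : measurable J ->
  (forall t : R, J t -> t <= a) -> E J x = x ->
  Re (ip x (S x)) <= a * rnorm x ^+ 2.
Proof.
move=> mJ aJ Jx; have [mu [h1 h2 ->]] := res_itv_bound mJ Jx.
have -> : a * rnorm x ^+ 2 = (\int[mu]_(t in J) a)%R.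
  by rewrite Rintegral_cst// h1.
apply: le_Rintegral => //; apply: (@measurable_bounded_integrable _ borel R mu (fun=> a)) => //.
  by rewrite h1 ltry.
exists `|a|; split; first exact: num_real.
by move=> M hM t _; exact: ltW.
Qed.

Let Re_ipS_le x : `|Re (ip x (S x))| <= m * rnorm x ^+ 2.
Proof.
apply: le_trans (normr_Re _) _; apply: le_trans (ip_cauchy_schwarz _ _) _.
by rewrite expr2 mulrA [leRHS]mulrC ler_wpM2l ?rnormv_ge0.
Qed.

(** On the range of E beyond L or below -L the form of S is at least L |y|^2 in absolute value,
    while the bound on S allows only m |y|^2. *)
Lemma res_support (L : R) x : m < L -> E `](- L), L]%classic x = x.
Proof.
move=> mL.
have mI : measurable (`](- L), L]%classic : set borel) by exact: measurable_borel_itv.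
have z (J : set borel) (e : R) : measurable J -> 0 < e ->
    (forall y, E J y = y -> (m + e) * rnorm y ^+ 2 <= `|Re (ip y (S y))|) ->
    E J x = 0.
  move=> mJ e0 h; have /h := (res_projector mJ).2 x; have := Re_ipS_le (E J x).
  move=> h1 h2; have := le_trans h2 h1; rewrite mulrDl gerDl pmulr_rle0// => h3.
  by apply/eqP; rewrite -rnormv_eq0 -sqrf_eq0 eq_le h3 sqr_ge0.
rewrite {2}(res_C x mI).
have -> : ~` `](- L), L]%classic = `]L, +oo[%classic `|` `]-oo, (- L)]%classic :> set R.
  apply/seteqP; split=> t /=; rewrite !in_itv/= ?andbT.
    by move=> /negP; rewrite negb_and -!leNgt -ltNge => /orP[]; [right|left].
  by move=> [h|h]; apply/negP; rewrite negb_and -!leNgt -ltNge h ?orbT.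
have m1 : measurable (`]L, +oo[%classic : set borel) by exact: measurable_itv.
have m2 : measurable (`]-oo, (- L)]%classic : set borel) by exact: measurable_itv.
rewrite res_U//; last first.
  rewrite -subset0 => t [] /=; rewrite !in_itv/= andbT => h1 h2.
  by move: m0 mL h1 h2; lra.
have e0 : 0 < L - m by rewrite subr_gt0.
rewrite (z _ _ m1 e0) ?(z _ _ m2 e0) ?addr0//.
  move=> y hy; rewrite addrC subrK.
  have h : Re (ip y (S y)) <= - L * rnorm y ^+ 2.
    by apply: (res_upper m2 _ hy) => t /=; rewrite in_itv.
  by rewrite -normrN; apply: le_trans (ler_norm _); rewrite lerNr -mulNr.
move=> y hy; rewrite addrC subrK.
apply: le_trans (ler_norm _); apply: (res_lower m1 _ hy) => t /=.
by rewrite in_itv/= andbT => /ltW.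
Qed.

(** The range of E J is invariant under S, and the form of S - a lies between 0 and b - a there, so
    [form_bound_rnorm] applies. *)
Lemma res_approx_eigen (a b : R) x : a <= b ->
  E `]a, b]%classic x = x -> rnorm (S x - cofR a *: x) <= (b - a) * rnorm x.
Proof.
move=> ab; set J := `]a, b]%classic => Jx.
have mJ : measurable (J : set borel) by exact: measurable_borel_itv.
have lA (c : C) y z : S (c *: y + z) - cofR a *: (c *: y + z) =
    c *: (S y - cofR a *: y) + (S z - cofR a *: z).
  rewrite (linearP S) scalerDr scalerA [_ * c]mulrC -scalerA scalerBr.
  by rewrite opprD addrACA.
apply: (@form_bound_rnorm _ _ (linear_of lA) [set y | E J y = y]) => //.
- by move=> y z; rewrite /= ipBr ipBl ipZr ipZl conj_cofR sS.
- by move=> c y z /= hy hz; rewrite (linearP (E J)) hy hz.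
- by move=> y /= hy; rewrite (linearB (E J)) (hlinZ (E J)) hy -res_commute// hy.
- by rewrite subr_ge0.
- move=> y /= hy; rewrite ipBr ReB ipZr Re_cofRM Re_ipxx.
  have h1 : a * rnorm y ^+ 2 <= Re (ip y (S y)).
    by apply: (res_lower mJ _ hy) => t; rewrite /J /= in_itv/= => /andP[/ltW].
  have h2 : Re (ip y (S y)) <= b * rnorm y ^+ 2.
    by apply: (res_upper mJ _ hy) => t; rewrite /J /= in_itv/= => /andP[].
  by move: h1 h2; set u := rnorm y ^+ 2; set w := Re _ => h1 h2; apply/andP; split; lra.
Qed.

End ResolutionTheory.

(** * Euler's formula and the discrete Parseval identity *)

Section Euler.
Variable R : realType.
Local Notation C := (Cplx R).

Definition eis (t : R) : C := Complex (cos t) (sin t).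

Lemma eisD s t : eis (s + t) = eis s * eis t.
Proof. by rewrite /eis cosD sinD; congr Complex; rewrite addrC. Qed.

Lemma eis0 : eis 0 = 1.
Proof. by rewrite /eis cos0 sin0. Qed.

Lemma eisX t n : eis (n%:R * t) = eis t ^+ n.
Proof.
elim: n => [|n IH]; first by rewrite mul0r eis0.
by rewrite -natr1 mulrDl mul1r eisD IH exprSr.
Qed.

Lemma rnorm_eis t : rnorm (eis t) = 1.
Proof. by rewrite rnormcE /= cos2Dsin2 sqrtr1. Qed.

Lemma eis_conjK t : (eis t)^* * eis t = 1.
Proof. by rewrite sqr_rnorm_conj rnorm_eis expr1n. Qed.

Lemma imaginary_pow k : ('i : C) ^+ k =
  Complex ((~~ odd k)%:R * (-1) ^+ k./2) ((odd k)%:R * (-1) ^+ k.-1./2).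
Proof.
have iE : ('i : C) = Complex 0 1 by [].
elim: k => [|k IH]; first by rewrite expr0 /= mul1r mul0r.
rewrite exprS IH iE; apply/eqP; rewrite eq_complex /= !mul0r !mul1r sub0r add0r.
rewrite eqxx andbT negbK; case: k {IH} => [|k] /=; first by rewrite !mul0r oppr0.
by case: (odd k) => /=; rewrite ?mul0r ?oppr0// !mul1r exprS mulN1r.
Qed.

Lemma expc_euler (t : R) k :
  expc ('i * cofR t : C) k = Complex (cos_coeff t k) (sin_coeff t k).
Proof.
rewrite /expc exprMn imaginary_pow.
have -> : (k`!%:R : C)^-1 = cofR (k`!%:R^-1) by rewrite /cofR fmorphV rmorph_nat.
rewrite /cofR -rmorphXn /=; apply/eqP; rewrite eq_complex /=.
by rewrite /cos_coeff /sin_coeff /= !mulr0 !subr0 !add0r !eqxx.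
Qed.

Lemma cvg_euler (t : R) : series (expc ('i * cofR t : C)) @ \oo --> eis t.
Proof.
have hc : series (cos_coeff t) @ \oo --> cos t.
  by rewrite unlock; exact: is_cvg_series_cos_coeff.
have hs : series (sin_coeff t) @ \oo --> sin t.
  by rewrite unlock; exact: is_cvg_series_sin_coeff.
apply/cvg_rnormP.
have h0 : (fun n => `|series (cos_coeff t) n - cos t| +
    `|series (sin_coeff t) n - sin t|) @ \oo --> (0 : R).
  rewrite -[0]addr0; apply: cvgD.
    exact: (proj1 (cvgr_dist0P _ _ _) hc).
  exact: (proj1 (cvgr_dist0P _ _ _) hs).
apply: (squeeze_cvgr _ (cvg_cst 0) h0); apply: nearW => n.
rewrite rnormv_ge0/=; apply: le_trans (rnorm_ReIm _) _.
rewrite ReB ImB /series /= Re_sum (raddf_sum (@complex.Im R)) /=.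
by under eq_bigr do rewrite expc_euler /=; under [X in _ + `|X - _|]eq_bigr do rewrite expc_euler /=.
Qed.

Lemma cos_lt1 (t : R) : 0 < t < pi *+ 2 -> cos t < 1.
Proof.
move=> /andP[t0 t2]; have -> : t = (t / 2) *+ 2 by rewrite -mulr_natr divfK.
have s0 : 0 < sin (t / 2).
  by apply: sin_gt0_pi; rewrite divr_gt0//= ltr_pdivrMr// mulr_natr.
rewrite cos_mulr2n; have := cos2Dsin2 (t / 2).
have : 0 < sin (t / 2) ^+ 2 by rewrite exprn_gt0.
rewrite -mulr_natr; lra.
Qed.

Section Parseval.
Variables (M : nat) (t0 : R).
Let z (l : nat) := eis (t0 + l%:R * (pi *+ 2 / M.+1%:R)).
Let om := eis (pi *+ 2 / M.+1%:R).

(** Up to the phase of t0 the nodes are the (M + 1)-th roots of unity. The geometric sum has ratio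
    [om ^+ j], which differs from 1 because its real part is below 1. *)
Lemma root_unity_sum j : (0 < j < M.+1)%N -> \sum_(l < M.+1) z l ^+ j = 0.
Proof.
move=> /andP[j0 jM].
have zE l : z l ^+ j = eis t0 ^+ j * (om ^+ j) ^+ l.
  by rewrite /z eisD eisX exprMn -!exprM mulnC.
under eq_bigr do rewrite zE.
rewrite -mulr_sumr.
have q1 : (om ^+ j) ^+ M.+1 = 1.
  rewrite -exprM mulnC exprM -eisX mulrC divfK ?pnatr_eq0//.
  by rewrite /eis cos2pi sin2pi expr1n.
have qn : om ^+ j - 1 != 0.
  rewrite subr_eq0; apply/eqP => /(congr1 (@complex.Re R)).
  rewrite -eisX /= => h.
  move: h; apply/eqP; rewrite lt_eqF//; apply: cos_lt1; have p0 : 0 < (pi : R) *+ 2 by rewrite pmulrn_lgt0// pi_gt0.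
  rewrite mulr_gt0 ?ltr0n ?divr_gt0 ?ltr0n//=.
  by rewrite mulrCA gtr_pMr// ltr_pdivrMr ?ltr0n// mul1r ltr_nat.
have := subrX1 (om ^+ j) M.+1; rewrite q1 subrr => /esym/eqP.
by rewrite mulf_eq0 (negbTE qn) => /= /eqP ->; rewrite mulr0.
Qed.

Lemma root_unity_orth n k : (n < M.+1)%N -> (k < M.+1)%N ->
  \sum_(l < M.+1) z l ^+ n * (z l ^+ k)^* = (n == k)%:R * M.+1%:R.
Proof.
move=> nM kM.
have zz l : (z l)^* * z l = 1 by exact: eis_conjK.
have main i j : (i < M.+1)%N -> (j < i)%N ->
    \sum_(l < M.+1) z l ^+ i * (z l ^+ j)^* = 0.
  move=> iM ji; rewrite -[RHS](@root_unity_sum (i - j)); last first.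
    by rewrite subn_gt0 ji (leq_ltn_trans (leq_subr _ _)).
  apply: eq_bigr => l _; rewrite -{1}(subnK (ltnW ji)) exprD rmorphXn /= -mulrA.
  by rewrite -exprMn mulrC [z l * _]mulrC zz expr1n mul1r.
case: (ltngtP n k) => [nk|kn|<-].
- have /(congr1 Num.conj) := main k n kM nk; rewrite rmorph0 rmorph_sum mul0r => h0.
  rewrite -[RHS]h0; apply: eq_bigr => l _.
  by rewrite rmorphM /= conjCK mulrC.
- by rewrite mul0r main.
- rewrite mul1r (eq_bigr (fun=> 1)); first by rewrite sumr_const card_ord.
  by move=> l _; rewrite rmorphXn /= -exprMn mulrC zz expr1n.
Qed.

(** Summing over the nodes first leaves the diagonal; d <= M + 1 keeps the exponents distinct modulo
    M + 1. *)
Lemma discrete_parseval d (a : nat -> C) : (d <= M.+1)%N ->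
  \sum_(l < M.+1) rnorm (\sum_(0 <= n < d) a n * z l ^+ n) ^+ 2 =
  M.+1%:R * \sum_(0 <= n < d) rnorm (a n) ^+ 2.
Proof.
move=> dM; apply: (@cofR_inj R); rewrite cofRM /cofR !rmorph_sum rmorph_nat /=.
transitivity (\sum_(l < M.+1) \sum_(0 <= n < d) \sum_(0 <= k < d)
    a n * (a k)^* * (z l ^+ n * (z l ^+ k)^*)).
  apply: eq_bigr => l _; rewrite -/(cofR _) -sqr_rnorm_conj mulrC mulr_suml.
  apply: eq_bigr => n _; rewrite rmorph_sum mulr_sumr; apply: eq_bigr => k _.
  by rewrite rmorphM /=; ring.
rewrite exchange_big mulr_sumr /=; apply: eq_big_nat => n /andP[_ nd].
rewrite exchange_big /= (bigD1_seq n) ?mem_index_iota ?iota_uniq//=.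
rewrite -mulr_sumr root_unity_orth ?(leq_trans nd)// eqxx mul1r.
rewrite big_seq_cond big1 ?addr0 => [|k].
  by rewrite mulrC [a n * _]mulrC sqr_rnorm_conj.
rewrite mem_index_iota => /andP[/andP[_ kd] kn].
rewrite -mulr_sumr root_unity_orth ?(leq_trans nd) ?(leq_trans kd)//.
by rewrite eq_sym (negbTE kn) mul0r mulr0.
Qed.

End Parseval.

Lemma discrete_parseval_nat M (t0 : R) d (a : nat -> C) : (0 < M)%N -> (d <= M)%N ->
  \sum_(0 <= l < M)
    rnorm (\sum_(0 <= n < d) a n * eis (t0 + l%:R * (pi *+ 2 / M%:R)) ^+ n) ^+ 2 =
  M%:R * \sum_(0 <= n < d) rnorm (a n) ^+ 2.
Proof. by case: M => // M _ dM; rewrite big_mkord; exact: discrete_parseval. Qed.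

End Euler.

Section ApproximateEigenvectors.
Variables (R : realType) (H : hilbert R).
Local Notation C := (Cplx R).
Implicit Types (x y : H).
Variables (S : {linear H -> H}) (M : R).
Hypotheses (M1 : 1 <= M) (SM : op_bound S M) (sS : hsymmetric S).
Let M0 : 0 <= M := le_trans ler01 M1.

Lemma iter_approx_eigen (a e : R) x k : `|a| <= M -> 0 <= e ->
  rnorm (S x - cofR a *: x) <= e ->
  rnorm (iter k S x - cofR (a ^+ k) *: x) <= k%:R * M ^+ k * e.
Proof.
move=> aM e0 ha; elim: k => [|k IH].
  by rewrite expr0 /cofR rmorph1 scale1r subrr rnormv0 !mul0r.
have -> : iter k.+1 S x - cofR (a ^+ k.+1) *: x =
    S (iter k S x - cofR (a ^+ k) *: x) + cofR (a ^+ k) *: (S x - cofR a *: x).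
  rewrite (linearB S) (hlinZ S) scalerBr scalerA -cofRM -exprSr addrA subrK.
  by [].
apply: le_trans (rnormvD _ _) _; rewrite rnormvZ rnorm_cofR normrX.
have h1 : rnorm (S (iter k S x - cofR (a ^+ k) *: x)) <= M * (k%:R * M ^+ k * e).
  by apply: le_trans (SM _) _; rewrite ler_wpM2l.
have h2 : `|a| ^+ k * rnorm (S x - cofR a *: x) <= M ^+ k.+1 * e.
  have a0 : 0 <= `|a| ^+ k by exact: exprn_ge0.
  apply: (ler_pM a0 (rnormv_ge0 _) _ ha).
  apply: le_trans (_ : M ^+ k <= _); last by rewrite exprS ler_peMl ?exprn_ge0.
  by rewrite lerXn2r ?nnegrE.
apply: le_trans (lerD h1 h2) _; rewrite -natr1 exprS le_eqVlt; apply/orP; left.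
by apply/eqP; ring.
Qed.

(** The k-th term of the difference carries k M^k e; the estimate k <= 2^k turns the sum into an
    exponential series, whence the factor 2 M. *)
Lemma hexp_approx_eigen (t a e : R) x : `|a| <= M -> 0 <= e ->
  rnorm (S x - cofR a *: x) <= e ->
  rnorm (hexp S t x - eis (t * a) *: x) <= expR (`|t| * (2 * M)) * e.
Proof.
move=> aM e0 ha.
have h : (fun n => pexp S n ('i * cofR t) x -
      series (expc ('i * cofR (t * a) : C)) n *: x) @ \oo -->
    hexp S t x - eis (t * a) *: x.
  apply: cvgB; first exact: (cvg_hexp M0 SM).
  by apply: cvgZl; exact: cvg_euler.
apply: (cvg_rnorm_le h); exists 0%N => n _.
rewrite /pexp /series /= scaler_suml -sumrB.
apply: le_trans (rnormv_sum _ _ _) _.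
apply: (@le_trans _ _ (series (expc (`|t| * (2 * M))) n * e)); last first.
  by rewrite ler_wpM2r// sum_expc_le// mulr_ge0// mulr_ge0.
rewrite /series /= mulr_suml; apply: ler_sum => k _.
have -> : expc ('i * cofR (t * a) : C) k = expc ('i * cofR t) k * cofR (a ^+ k).
  by rewrite /expc cofRM mulrA exprMn mulrAC /cofR rmorphXn.
rewrite -scalerA -scalerBr rnormvZ rnorm_expc rnorm_imag.
have -> : expc (`|t| * (2 * M)) k = expc `|t| k * (2 * M) ^+ k.
  by rewrite /expc exprMn mulrAC.
rewrite -[leRHS]mulrA ler_wpM2l ?expc_ge0//.
apply: le_trans (iter_approx_eigen k aM e0 ha) _; rewrite ler_wpM2r// exprMn.
rewrite ler_wpM2r ?exprn_ge0// -natrX ler_nat.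
by apply: ltnW; exact: ltn_expl.
Qed.

(** The exponential is isometric, so the errors of the n steps merely add up. *)
Lemma hexp_iter_approx_eigen (t a e : R) x n : `|a| <= M -> 0 <= e ->
  rnorm (S x - cofR a *: x) <= e ->
  rnorm (iter n (hexp S t) x - eis (t * a) ^+ n *: x) <=
    n%:R * (expR (`|t| * (2 * M)) * e).
Proof.
move=> aM e0 ha; have h1 := hexp_approx_eigen t aM e0 ha.
elim: n => [|n IH]; first by rewrite expr0 scale1r subrr rnormv0 mul0r.
have -> : iter n.+1 (hexp S t) x - eis (t * a) ^+ n.+1 *: x =
    hexp S t (iter n (hexp S t) x - eis (t * a) ^+ n *: x) +
    eis (t * a) ^+ n *: (hexp S t x - eis (t * a) *: x).
  pose U := linear_of (hexp_linear M0 SM t).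
  rewrite -[hexp S t (_ - _)]/(U _) (linearB U) (hlinZ U) scalerBr scalerA.
  by rewrite -exprSr addrA subrK.
apply: le_trans (rnormvD _ _) _; rewrite (rnorm_hexp M0 SM sS) rnormvZ.
have -> : rnorm (eis (t * a) ^+ n) = 1 by rewrite -eisX rnorm_eis.
by rewrite mul1r -natr1 mulrDl mul1r lerD.
Qed.

End ApproximateEigenvectors.

Section BesselVectors.
Variables (R : realType) (H : hilbert R).
Local Notation C := (Cplx R).
Local Notation Re := (@complex.Re R).
Local Notation borel := (measurableTypeR R).
Local Notation leb := (@lebesgue_measure R).
Implicit Types (x y : H).

(* The orbit of x under U satisfies an upper Riesz bound; dually,
   sum_n |<g, U^n x>|^2 <= c |g|^2. *)
Definition bessel_vector (U : H -> H) x := exists c : R,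
  forall d (a : nat -> C), rnorm (\sum_(0 <= n < d) a n *: iter n U x) ^+ 2 <=
    c * \sum_(0 <= n < d) rnorm (a n) ^+ 2.

Lemma orth_sum_sqr (n : nat) (u : nat -> H) :
  (forall i j, (i < n)%N -> (j < n)%N -> i != j -> ip (u i) (u j) = 0) ->
  rnorm (\sum_(0 <= i < n) u i) ^+ 2 = \sum_(0 <= i < n) rnorm (u i) ^+ 2.
Proof.
elim: n => [|n IH] h; first by rewrite !big_nil rnormv0 expr0n.
rewrite !big_nat_recr//= rnormD_orth ?IH// => [i j hi hj|].
  by apply: h; exact: ltnW.
rewrite ip_suml big_nat_cond big1// => i /andP[/andP[_ hi] _].
by apply: h => //; [exact: ltnW|rewrite ltn_eqF].
Qed.

Variables (S : {linear H -> H}) (m : R) (E : set R -> {linear H -> H}).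
Hypotheses (m0 : 0 <= m) (Sm : op_bound S m) (sS : hsymmetric S).
Hypothesis rE : resolution S E.
Let mE (a b : R) : measurable (`]a, b]%classic : set borel) := measurable_borel_itv a b.

Lemma res_grid (t : nat -> R) n x : (forall k, t k <= t k.+1) ->
  E `](t 0%N), (t n)]%classic x =
  \sum_(0 <= l < n) E `](t l), (t l.+1)]%classic x.
Proof.
move=> tt; have t0 k : t 0%N <= t k.
  by elim: k => // k IH; exact: le_trans IH (tt k).
elim: n => [|n IH].
  by rewrite big_nil set_itv_ge ?(res_0 rE)// bnd_simp ltxx.
rewrite big_nat_recr//= -IH -(res_U rE)//; last first.
  rewrite -subset0 => u [] /=; rewrite !in_itv/= => /andP[_ un] /andP[nu _].
  by have := lt_le_trans nu un; rewrite ltxx.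
by rewrite -itv_bndbnd_setU ?bnd_simp.
Qed.

(* Cut ]-pi/tau, pi/tau] into M equal cells.  On the range of a cell,
   exp(i tau S) is almost multiplication by a number, and up to a common phase
   these numbers are the M-th roots of unity, whence Parseval's identity; let
   M tend to infinity. *)
Lemma bounded_density_bessel (tau k : R) x : 0 < tau -> m < pi / tau -> 0 <= k ->
  (forall s t : R, s <= t -> rnorm (E `]s, t]%classic x) ^+ 2 <= k * (t - s)) ->
  bessel_vector (hexp S tau) x.
Proof.
(* Parseval contributes the factor M, and each of the M cells of length 2 L / M carries at most k
   times its length of |x|^2. *)
move=> tau0 mL k0 dens; pose L := pi / tau; exists (2 * L * k) => d a.
have L0 : 0 < L by rewrite divr_gt0// pi_gt0.
pose Mb := L + 1.
have Mb1 : 1 <= Mb by rewrite lerDr ltW.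
have SMb : op_bound S Mb.
  by apply: op_boundW Sm; apply: le_trans (ltW mL) _; rewrite lerDl.
pose U := hexp S tau; pose Cb := expR (`|tau| * (2 * Mb)).
pose v := \sum_(0 <= n < d) a n *: iter n U x.
pose A := \sum_(0 <= n < d) rnorm (a n) ^+ 2.
have A0 : 0 <= A by apply: sumr_ge0 => n _; exact: sqr_ge0.
pose q : R := Num.sqrt (2 * L * k).
have q2 : q ^+ 2 = 2 * L * k.
  by rewrite sqr_sqrtr// mulr_ge0// mulr_ge0// ltW.
pose B := \sum_(0 <= n < d) rnorm (a n) * (n%:R * Cb * (2 * L) * q).
have key p : (d <= p.+1)%N -> rnorm v <= q * Num.sqrt A + B * p.+1%:R^-1.
  move=> dp.
  (* M is a square so that the bound on a cell component, the root of k del, becomes q / (p + 1).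
     The M errors, each of order del q / (p + 1) with M del = 2 L, then sum to a multiple of 1 / (p
     + 1). *)
  have [M [M0 MR dM]] : exists M : nat,
      [/\ (0 < M)%N, (M%:R : R) = p.+1%:R ^+ 2 & (d <= M)%N].
    exists (p.+1 ^ 2)%N; split; [by rewrite expn_gt0|by rewrite natrX|].
    by apply: leq_trans dp _; rewrite -{1}[p.+1]expn1 leq_pexp2l.
  pose del := 2 * L / M%:R.
  have del0 : 0 < del by apply: divr_gt0; [exact: mulr_gt0|rewrite ltr0n].
  pose t l := - L + l%:R * del.
  have tS l : t l.+1 - t l = del by rewrite /t -natr1; ring.
  have tt l : t l <= t l.+1 by rewrite -subr_ge0 tS ltW.
  have tM : t M = L.
    by rewrite /t /del mulrC divfK ?pnatr_eq0 -?lt0n//; ring.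
  have tb l : (l < M)%N -> `|t l| <= Mb.
    move=> lM; have h1 : t l <= L.
      by rewrite -tM /t lerD2l ler_pM2r// ler_nat ltnW.
    have h2 : - L <= t l by rewrite lerDl mulr_ge0// ltW.
    by rewrite ler_norml /Mb; apply/andP; split; lra.
  pose eta l := E `](t l), (t l.+1)]%classic x.
  have etaE l : E `](t l), (t l.+1)]%classic (eta l) = eta l.
    exact: (res_projector rE (mE _ _)).2.
  have xE : x = \sum_(0 <= l < M) eta l.
    rewrite -(res_grid _ _ tt) tM {1}/t mul0r addr0.
    by rewrite (res_support m0 Sm rE x mL).
  have eta_le l : rnorm (eta l) ^+ 2 <= k * del by rewrite -(tS l); exact: dens.
  have eta_le' l : rnorm (eta l) <= q / p.+1%:R.
    rewrite -(@ler_pXn2r _ 2) ?nnegrE ?rnormv_ge0 ?divr_ge0 ?sqrtr_ge0//.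
    apply: le_trans (eta_le l) _; rewrite expr_div_n q2 /del MR.
    by rewrite le_eqVlt; apply/orP; left; apply/eqP; ring.
  pose z l := eis (tau * t l) : C.
  pose c l := \sum_(0 <= n < d) a n * z l ^+ n.
  pose w := \sum_(0 <= l < M) c l *: eta l.
  have wle : rnorm w <= q * Num.sqrt A.
    rewrite -(@ler_pXn2r _ 2) ?nnegrE ?rnormv_ge0 ?mulr_ge0 ?sqrtr_ge0//.
    rewrite exprMn q2 sqr_sqrtr// /w orth_sum_sqr; last first.
      move=> i j _ _ ij; rewrite ipZl ipZr -(etaE i) -(etaE j).
      rewrite -(res_sym rE (mE _ _)) (res_disj rE) ?ip0r ?mulr0//.
      have tmono i' j' : (i' <= j')%N -> t i' <= t j'.
        by move=> h; rewrite /t lerD2l ler_pM2r// ler_nat.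
      rewrite -subset0 => u [] /=; rewrite !in_itv/= => /andP[iu ui] /andP[ju uj].
      move: ij; rewrite neq_ltn => /orP[] h.
        by have := lt_le_trans ju (le_trans ui (tmono _ _ h)); rewrite ltxx.
      by have := lt_le_trans iu (le_trans uj (tmono _ _ h)); rewrite ltxx.
    apply: le_trans (_ : (k * del) * \sum_(0 <= l < M) rnorm (c l) ^+ 2 <= _).
      rewrite mulr_sumr; apply: ler_sum => l _; rewrite rnormvZ exprMn mulrC.
      by rewrite ler_wpM2r ?sqr_ge0.
    have -> : \sum_(0 <= l < M) rnorm (c l) ^+ 2 = M%:R * A.
      rewrite -(discrete_parseval_nat (- pi) a M0 dM); apply: eq_bigr => l _.
      have zE : tau * t l = - pi + l%:R * (pi *+ 2 / M%:R).
        have t0' : tau != 0 by rewrite gt_eqF.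
        have M0' : (M%:R : R) != 0 by rewrite pnatr_eq0 -lt0n.
        by rewrite /t /del /L -mulr_natr; field; rewrite t0' M0'.
      by rewrite /c /z zE.
    have M0' : (M%:R : R) != 0 by rewrite pnatr_eq0 -lt0n.
    by rewrite le_eqVlt; apply/orP; left; apply/eqP; rewrite /del; field.
  have vw : rnorm (v - w) <= B * p.+1%:R^-1.
    have -> : v - w = \sum_(0 <= n < d) \sum_(0 <= l < M)
        a n *: (iter n U (eta l) - z l ^+ n *: eta l).
      rewrite /v /w; under [X in _ - X]eq_bigr do rewrite /c scaler_suml.
      rewrite exchange_big -sumrB; apply: eq_bigr => n _.
      rewrite -scaler_sumr sumrB scalerBr; congr (_ - _); last first.
        by rewrite scaler_sumr; apply: eq_bigr => l _; rewrite scalerA.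
      congr (_ *: _); rewrite {1}xE.
      pose Un := linear_of (iter_linear (linear_of (hexp_linear m0 Sm tau)) n).
      by rewrite -[iter n U]/(Un : H -> H) linear_sum.
    apply: le_trans (rnormv_sum _ _ _) _; rewrite /B mulr_suml.
    apply: ler_sum => n _; apply: le_trans (rnormv_sum _ _ _) _.
    have bd l : (l < M)%N ->
        rnorm (a n *: (iter n U (eta l) - z l ^+ n *: eta l)) <=
        rnorm (a n) * (n%:R * (Cb * (del * (q / p.+1%:R)))).
      move=> lM; rewrite rnormvZ ler_wpM2l ?rnormv_ge0//.
      apply: (hexp_iter_approx_eigen Mb1 SMb sS tau n (tb l lM)).
        by rewrite mulr_ge0 ?(ltW del0)// divr_ge0 ?sqrtr_ge0.
      have := res_approx_eigen sS rE (tt l) (etaE l).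
      rewrite tS => h; apply: le_trans h _.
      by rewrite ler_wpM2l ?(ltW del0).
    rewrite big_nat_cond; apply: le_trans (_ : \sum_(0 <= l < M)
      rnorm (a n) * (n%:R * (Cb * (del * (q / p.+1%:R)))) <= _).
      rewrite [leRHS]big_nat_cond; apply: ler_sum => l /andP[/andP[_ lM] _].
      exact: bd.
    rewrite sumr_const_nat subn0 -mulr_natr /del.
    have M0' : (M%:R : R) != 0 by rewrite pnatr_eq0 -lt0n.
    have p0' : (p.+1%:R : R) != 0 by rewrite pnatr_eq0.
    rewrite le_eqVlt; apply/orP; left; apply/eqP; field.
    by rewrite M0' andbT addrC natr1.
  have -> : v = w + (v - w) by rewrite addrC subrK.
  by apply: le_trans (rnormvD _ _) _; exact: lerD.
have vle : rnorm v <= q * Num.sqrt A.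
  apply/ler_addgt0Pl => e e0; rewrite addrC.
  have [n0 hn] := inv_succ_small B e0.
  apply: le_trans (key (maxn n0 d) _) _; first by rewrite ltnW// ltnS leq_maxr.
  by rewrite lerD2l; apply: hn; exact: leq_maxl.
rewrite -/v -/A -q2 -(sqr_sqrtr A0) -exprMn.
by apply: ler_sqr_nneg => //; exact: rnormv_ge0.
Qed.

End BesselVectors.

(** * Bessel vectors and absolute continuity *)

Section AbsoluteContinuity.
Variables (R : realType) (H : hilbert R).
Local Notation C := (Cplx R).
Local Notation Re := (@complex.Re R).
Local Notation borel := (measurableTypeR R).
Local Notation leb := (@lebesgue_measure R).
Implicit Types (x y : H).

Variables (S : {linear H -> H}) (m : R).
Hypotheses (m0 : 0 <= m) (Sm : op_bound S m) (sS : hsymmetric S).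

Section FixedResolution.
Variable (E : set R -> {linear H -> H}).
Hypothesis rE : resolution S E.
Let mE (a b : R) : measurable (`]a, b]%classic : set borel) := measurable_borel_itv a b.

Lemma res_bound (B : set borel) : measurable B -> op_bound (E B) 1.
Proof. by move=> mB; exact: (projector_le1 (res_projector rE mB)). Qed.

Lemma res_iter_hexp (B : set borel) tau n x : measurable B ->
  E B (iter n (hexp S tau) x) = iter n (hexp S tau) (E B x).
Proof.
move=> mB; elim: n => //= n IH.
rewrite (hexp_commute m0 Sm tau _ (res_bound mB)) ?IH// => y.
by rewrite (res_commute sS rE).
Qed.

(* On the range of E ]s, t], U^n is close to z^n for n up to about 1/(t - s);
   test the Bessel bound on the coefficients conj(z)^n. *)
Lemma bessel_bounded_density tau x : bessel_vector (hexp S tau) x ->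
  exists2 K : R, 0 <= K &
    forall s t : R, s <= t -> rnorm (E `]s, t]%classic x) ^+ 2 <= K * (t - s).
Proof.
move=> [c hc]; set U := hexp S tau in hc *.
have r1 : rnorm (1 : C) = 1 by rewrite -(rnorm_eis (0 : R)) eis0.
have xc : rnorm x ^+ 2 <= c.
  have := hc 1%N (fun=> 1); rewrite !big_nat1 /= scale1r.
  by rewrite r1 expr1n mulr1.
have c0 : 0 <= c by apply: le_trans xc; exact: sqr_ge0.
pose M := m + 2; have M1 : 1 <= M by rewrite /M; move: m0; lra.
have SM : op_bound S M by apply: op_boundW Sm; rewrite /M lerDl.
pose Cb := expR (`|tau| * (2 * M)).
have Cb1 : 1 <= Cb by rewrite -expR0 ler_expR mulr_ge0// mulr_ge0// (le_trans ler01 M1).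
have Cb0 : 0 < Cb by exact: expR_gt0.
(* With eta the component of x on ]s, t]: if 4 Cb (t - s) >= 1, then |eta|^2 <= c suffices.
   Otherwise d |eta|^2 <= 4 c and 4 Cb (t - s) d >= 1 combine to this constant. *)
exists (16 * c * Cb); first by rewrite mulr_ge0 ?(ltW Cb0)// mulr_ge0.
move=> s t st; pose J := `]s, t]%classic; pose eta := E J x.
have mJ : measurable (J : set borel) := mE s t.
have etaJ : E J eta = eta by exact: (res_projector rE mJ).2.
have etax : rnorm eta <= rnorm x by have := res_bound mJ x; rewrite mul1r.
pose de := t - s; have de0 : 0 <= de by rewrite subr_ge0.
have [|small] := leP 1 (4 * (Cb * de)).
  move=> big; apply: le_trans (_ : c <= _).
    by apply: le_trans xc; rewrite ler_sqr_nneg ?rnormv_ge0.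
  by rewrite -/de; nra.
have [e0|en0] := eqVneq eta 0.
  rewrite -/J -/eta e0 rnormv0 expr0n mulr_ge0//.
  by rewrite mulr_ge0 ?(ltW Cb0)// mulr_ge0.
have eta0 : 0 < rnorm eta by rewrite lt_neqAle rnormv_ge0 andbT eq_sym rnormv_eq0.
have [de00|dep] := eqVneq de 0.
  move: en0; rewrite /eta /J set_itv_ge ?(res_0 rE) ?eqxx//.
  by rewrite bnd_simp -leNgt -subr_le0 -/de de00.
have {dep}dep : 0 < de by rewrite lt_neqAle eq_sym dep.
have de1 : de <= 1 by nra.
have ae : rnorm (S eta - cofR s *: eta) <= de * rnorm eta.
  exact: (res_approx_eigen sS rE st etaJ).
(* A nonzero vector with |S eta - s eta| <= de |eta| forces |s| <= m + de. *)
have sM : `|s| <= M.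
  have h1 : rnorm (cofR s *: eta) <= rnorm (S eta - cofR s *: eta) + rnorm (S eta).
    rewrite -{1}(subrK (S eta) (cofR s *: eta)).
    by apply: le_trans (rnormvD _ _) _; rewrite rnormvB.
  have h2 := Sm eta; rewrite rnormvZ rnorm_cofR in h1.
  suff : `|s| <= m + de by move=> h; rewrite /M; lra.
  by rewrite -(ler_pM2r eta0) mulrDl; lra.
pose z : C := eis (tau * s).
have zz n : (z^*) ^+ n * z ^+ n = 1 by rewrite -exprMn eis_conjK expr1n.
have rz n : rnorm ((z^*) ^+ n) = 1.
  have rz1 : rnorm (z^* : C) = 1 by rewrite rnorm_conj rnorm_eis.
  elim: n => [|n IH]; last by rewrite exprS rnormM IH rz1 mulr1.
  by rewrite expr0.
(* The largest d with d Cb (t - s) <= 1/2, so that U^n eta stays within |eta| / 2 of z^n eta for n <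
   d. *)
pose d := Num.truncn ((2 * (Cb * de))^-1).
pose ep := Cb * de; have ep0 : 0 < ep by rewrite mulr_gt0.
have /andP[d1 d2] : d%:R <= (2 * ep)^-1 < d.+1%:R.
  by apply: Num.Theory.truncn_itv; rewrite invr_ge0 mulr_ge0// ltW.
have d1' : d%:R * ep <= 2^-1.
  by move: d1; rewrite invfM -ler_pdivlMr ?invr_gt0// invrK.
have d2' : 1 < 2 * ep * (d%:R + 1).
  by move: d2; rewrite -[d.+1%:R]natr1 -[_^-1]mul1r ltr_pdivrMr ?mulr_gt0// mulrC.
have dd : 1 <= d%:R :> R.
  rewrite (ler_nat R 1) lt0n; apply/eqP => d00.
  by move: d2' small; rewrite d00 -/ep; lra.
(* Aligned phases put y within d |eta| / 2 of d eta, whereas the Bessel bound, projected by E J,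
   gives |y|^2 <= c d. *)
pose y := \sum_(0 <= n < d) ((z^*) ^+ n) *: iter n U eta.
have yle : rnorm y ^+ 2 <= c * d%:R.
  have -> : y = E J (\sum_(0 <= n < d) ((z^*) ^+ n) *: iter n U x).
    rewrite (linear_sum (E J)); apply: eq_bigr => n _.
    by rewrite (hlinZ (E J)) res_iter_hexp.
  apply: le_trans (_ : rnorm (\sum_(0 <= n < d) ((z^*) ^+ n) *: iter n U x) ^+ 2 <= _).
    rewrite ler_sqr_nneg ?rnormv_ge0//.
    by have := res_bound mJ; move/(_ (\sum_(0 <= n < d) ((z^*) ^+ n) *: iter n U x)); rewrite mul1r.
  apply: le_trans (hc _ _) _; under eq_bigr do rewrite rz expr1n.
  by rewrite sumr_const_nat subn0.
have ylow : rnorm (y - cofR d%:R *: eta) <= d%:R * (d%:R * ep * rnorm eta).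
  have -> : y - cofR d%:R *: eta =
      \sum_(0 <= n < d) (z^*) ^+ n *: (iter n U eta - z ^+ n *: eta).
    under [RHS]eq_bigr do rewrite scalerBr scalerA zz scale1r.
    by rewrite sumrB sumr_const_nat subn0 /cofR rmorph_nat scaler_nat.
  apply: le_trans (rnormv_sum _ _ _) _.
  apply: le_trans (_ : \sum_(0 <= n < d) (d%:R * ep * rnorm eta) <= _); last first.
    by rewrite sumr_const_nat subn0 -[leLHS]mulr_natl.
  rewrite big_nat_cond [leRHS]big_nat_cond; apply: ler_sum => n /andP[/andP[_ nd] _].
  rewrite rnormvZ rz mul1r.
  apply: le_trans (hexp_iter_approx_eigen M1 SM sS tau n sM _ ae) _.
    by rewrite mulr_ge0// rnormv_ge0.
  have nd' : n%:R <= d%:R :> R by rewrite ler_nat ltnW.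
  rewrite -/Cb /ep -!mulrA ler_pM2r//.
  by rewrite !mulr_gt0.
have ybig : 2^-1 * d%:R * rnorm eta <= rnorm y.
  have h : d%:R * rnorm eta <= rnorm y + rnorm (y - cofR d%:R *: eta).
    have -> : d%:R * rnorm eta = rnorm (cofR d%:R *: eta).
      by rewrite rnormvZ rnorm_cofR ger0_norm.
    rewrite -{1}(subKr y (cofR d%:R *: eta)) -(rnormvN (y - _)).
    exact: rnormvD.
  have : d%:R * (d%:R * ep * rnorm eta) <= d%:R * (2^-1 * rnorm eta).
    by rewrite ler_wpM2l// ler_pM2r.
  by lra.
have sq : (2^-1 * d%:R * rnorm eta) ^+ 2 <= c * d%:R.
  apply: le_trans yle; rewrite ler_sqr_nneg//.
  by rewrite mulr_ge0 ?rnormv_ge0// mulr_ge0.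
have fin : d%:R * rnorm eta ^+ 2 <= 4 * c.
  have dp : 0 < d%:R :> R by lra.
  rewrite -(ler_pM2r dp).
  by move: sq; rewrite !exprMn; set e2 := rnorm eta ^+ 2; move: (d%:R : R) => D; lra.
rewrite -/de -/J -/eta.
have -> : 16 * c * Cb * de = 4 * c * (4 * ep) by rewrite /ep; ring.
have e2 : 0 <= rnorm eta ^+ 2 by exact: sqr_ge0.
move: fin d2' dd e2; set X := rnorm eta ^+ 2; move: (d%:R : R) => D fin d2' dd e2.
have h1 : 1 <= 4 * ep * D by nra.
have h2 : X <= 4 * ep * D * X by rewrite ler_peMl.
apply: le_trans h2 _; rewrite -mulrA [leRHS]mulrC ler_pM2l//.
by rewrite mulr_gt0.
Qed.

(** A null set has covers by half-open intervals of arbitrarily small total length, and the spectral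
    measure of each interval is at most K times its length. *)
Lemma bounded_density_null (K : R) x : 0 <= K ->
  (forall s t : R, s <= t -> rnorm (E `]s, t]%classic x) ^+ 2 <= K * (t - s)) ->
  forall A : set borel, measurable A -> leb A = 0%E -> E A x = 0.
Proof.
move=> K0 hK A mA lA; have [mu [muE _ _]] := res_mu rE x.
suff : mu A = 0%E.
  by rewrite muE// => -[] /eqP; rewrite sqrf_eq0 rnormv_eq0 => /eqP.
apply/eqP; rewrite eq_le measure_ge0 andbT.
apply/lee_addgt0Pr => e e0; rewrite add0e.
have K1 : 0 < K + 1 by rewrite ltr_wpDl.
have e1 : 0 < e / (K + 1) by rewrite divr_gt0.
have : (leb A < (e / (K + 1))%:E)%E by rewrite lA lte_fin.
rewrite /lebesgue_measure /lebesgue_stieltjes_measure /measure_extension /mu_ext.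
move=> /ereal_inf_lt[_ [F cF <-]] hF.
have mF k : measurable (F k : set borel).
  have := cover_measurable cF k => -[[a b] _ <-]; exact: mE.
have /le_trans : (mu A <= \sum_(k <oo) mu (F k))%E.
  apply: measure_sigma_subadditive => //; exact: (cover_subset cF).
apply; apply: le_trans (_ : (K%:E * (e / (K + 1))%:E <= _)%E); last first.
  by rewrite -EFinM lee_fin mulrA ler_pdivrMr// [e * _]mulrC ler_pM2r// lerDl.
apply: le_trans (lee_wpmul2l _ (ltW hF)); last by rewrite lee_fin.
rewrite -nneseriesZl//; apply: lee_nneseries => // k _.
have := cover_measurable cF k => -[[a b] _ <-] /=.
have [ab|ba] := leP a b; last first.
  by rewrite set_itv_ge ?bnd_simp -?leNgt ?(ltW ba)// measure0 wlength0 mule0.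
by rewrite wlength_itv_bnd//= -EFinM muE ?lee_fin; [exact: hK|exact: mE].
Qed.

(* Cut x off to the sets where its Radon-Nikodym density is at most n. *)
Lemma ac_bessel_approx tau x : 0 < tau -> m < pi / tau ->
  (forall A : set borel, measurable A -> leb A = 0%E -> E A x = 0) ->
  exists2 u : nat -> H, (forall n, bessel_vector (hexp S tau) (u n)) &
    u @ \oo --> x.
Proof.
move=> tau0 mtau xac; have [mu [muE _ _]] := res_mu rE x.
have mufin : (mu setT < +oo)%E by rewrite muE ?ltry.
(* Restricting to the whole line only equips mu with the structure of a finite measure. *)
pose nu : {finite_measure set borel -> \bar R} := mfrestr measurableT mufin.
have nuE A : nu A = mu A by rewrite /nu /= /mfrestr /mrestr setIT.
have nuleb : nu `<< leb.
  apply/null_content_dominatesP => A mA lA.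
  by rewrite nuE muE// (xac A mA lA) rnormv0 expr0n.
have [f [f0 ffin fint fE]] := radon_nikodym_sigma_finite nuleb.
pose B n : set borel := [set t | (f t <= n%:R%:E)%E].
have mB n : measurable (B n).
  rewrite /B -[X in measurable X]setTI.
  by apply: emeasurable_fun_infty_c => //; exact: (measurable_int _ fint).
exists (fun n => E (B n) x) => [n|].
  apply: (@bounded_density_bessel _ _ S m E m0 Sm sS rE tau n%:R) => // s t st.
  have mI : measurable (`]s, t] `&` B n : set borel).
    by apply: measurableI => //; exact: mE.
  rewrite -(res_I rE (mE s t) (mB n)) -lee_fin -muE//.
  have -> : mu (`]s, t] `&` B n) = (\int[leb]_(u in `]s, t] `&` B n) f u)%E.
    by rewrite -nuE; exact: fE.
  apply: le_trans (_ : (\int[leb]_(u in `]s, t] `&` B n) n%:R%:E <= _)%E).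
    apply: ge0_le_integral => //.
    - by apply: measurable_funTS; exact: (measurable_int _ fint).
    - by move=> u [].
  rewrite integral_cst// EFinM; apply: lee_wpmul2l => //.
  apply: le_trans (_ : (leb `]s, t]%classic <= _)%E).
    by apply: le_measure => //; rewrite ?inE//; exact: mE.
  rewrite lebesgue_measure_itv /= lte_fin; case: ifPn => // _.
  by rewrite lee_fin subr_ge0.
have cB : (mu \o B) n @[n --> \oo] --> mu (\bigcup_n B n).
  apply: nondecreasing_cvg_mu => //; first exact: bigcup_measurable.
  move=> i j ij; apply/subsetPset => t /= /le_trans; apply.
  by rewrite lee_fin ler_nat.
have BT : \bigcup_n B n = setT.
  apply/seteqP; split=> // t _; exists (Num.bound `|fine (f t)|) => //=.
  rewrite /B /= -[f t]fineK// lee_fin; apply: le_trans (ler_norm _) (ltW _).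
  exact: archi_boundP.
rewrite BT in cB.
have hc : (fun n => rnorm (E (B n) x) ^+ 2) @ \oo --> rnorm x ^+ 2.
  move: cB; rewrite muE// (res_T rE) => /fine_cvg; apply: cvg_trans.
  by apply: near_eq_cvg; near=> n; rewrite /= muE.
apply/cvg_rnormP/cvgrPdist_lt => e e0.
have e20 : 0 < e ^+ 2 by rewrite exprn_gt0.
move/cvgrPdist_lt : hc => /(_ _ e20); apply: filterS => n.
have -> : rnorm x ^+ 2 - rnorm (E (B n) x) ^+ 2 = rnorm (E (B n) x - x) ^+ 2.
  have mC : measurable (~` B n : set borel) by exact: measurableC.
  have [_ BB] := res_projector rE (mB n); have [_ CC] := res_projector rE mC.
  have orth : ip (E (B n) x) (E (~` B n) x) = 0.
    by apply: (res_pythagoras rE (mB n) mC) => //; exact: setICr.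
  have xE := res_C rE x (mB n).
  have -> : E (B n) x - x = - E (~` B n) x by rewrite [X in _ - X]xE opprD addNKr.
  by rewrite rnormvN [X in rnorm X ^+ 2 - _]xE (rnormD_orth orth) addrAC subrr add0r.
rewrite sub0r normrN ger0_norm ?sqr_ge0// ger0_norm ?rnormv_ge0// => h.
by rewrite -(@ltr_pXn2r _ 2) ?nnegrE ?rnormv_ge0 ?(ltW e0).
Unshelve. all: by end_near. Qed.

End FixedResolution.

Definition hac (T : H -> H) : set H := [set x | exists2 E, resolution T E &
  forall A : set borel, measurable A -> leb A = 0%E -> E A x = 0].

(** Independence of the resolution, without its uniqueness: x is a limit of Bessel vectors built
    from the witness E', and a Bessel vector has bounded density with respect to any resolution, so
    E annihilates it on null sets. *)
Lemma hac_resP E x : resolution S E ->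
  (hac S x <-> forall A : set borel, measurable A -> leb A = 0%E -> E A x = 0).
Proof.
move=> rE; split=> [[E' rE' xac] A mA lA|h]; last by exists E.
(* With this tau, pi / tau = m + 1 exceeds m. *)
have tau0 : 0 < pi / (m + 1) by rewrite divr_gt0 ?pi_gt0// ltr_wpDl.
have mtau : m < pi / (pi / (m + 1)).
  by rewrite invf_div mulrC divfK ?gt_eqF ?pi_gt0// ltrDl.
have [u hu ux] := ac_bessel_approx rE' tau0 mtau xac.
have un n : E A (u n) = 0.
  have [K K0 hK] := bessel_bounded_density rE (hu n).
  exact: (bounded_density_null rE K0 hK).
have hl : (fun n => E A (u n)) @ \oo --> E A x.
  by apply: (cvg_bounded _ (res_bound rE mA)).
apply: cvg_uniq hl _; under eq_fun do rewrite un; exact: cvg_cst.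
Qed.

Lemma hac_closed : closed_subspace (hac S).
Proof.
have [E rE] := spectral_theorem m0 Sm sS; split.
- by apply/(hac_resP _ rE) => A mA lA; rewrite linear0.
- move=> a x y /(hac_resP _ rE) hx /(hac_resP _ rE) hy.
  by apply/(hac_resP _ rE) => A mA lA; rewrite linearP hx// hy// scaler0 addr0.
- move=> u x hu ux; apply/(hac_resP _ rE) => A mA lA.
  have hl : (fun n => E A (u n)) @ \oo --> E A x.
    by apply: (cvg_bounded _ (res_bound rE mA)).
  apply: cvg_uniq hl _.
  have un n : E A (u n) = 0 by move/(hac_resP _ rE) : (hu n) => ->.
  under eq_fun do rewrite un; exact: cvg_cst.
Qed.

Lemma bessel_hac tau x : bessel_vector (hexp S tau) x -> hac S x.
Proof.
have [E rE] := spectral_theorem m0 Sm sS => hx.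
have [K K0 hK] := bessel_bounded_density rE hx.
by exists E => //; exact: (bounded_density_null rE K0 hK).
Qed.

Lemma hac_bessel_approx tau x : 0 < tau -> m < pi / tau -> hac S x ->
  exists2 u : nat -> H, (forall n, bessel_vector (hexp S tau) (u n)) &
    u @ \oo --> x.
Proof. by move=> tau0 mtau [E rE xac]; exact: (ac_bessel_approx rE). Qed.

End AbsoluteContinuity.

(** * The Kato-Rosenblum theorem *)

Section KatoRosenblum.
Variables (R : realType) (H : hilbert R).
Local Notation C := (Cplx R).
Local Notation Re := (@complex.Re R).
Implicit Types (x y g : H).

(** Test the Bessel bound on the coefficients conj <g, U^j x>: the sum s of squares equals <g, y>
    with |y|^2 <= c s, whence s^2 <= |g|^2 c s. *)
Lemma bessel_dual (U : H -> H) x : bessel_vector U x ->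
  exists2 c : R, 0 <= c & forall g m n,
    \sum_(m <= j < n) rnorm (ip g (iter j U x) : C) ^+ 2 <= c * rnorm g ^+ 2.
Proof.
(* The constant in [bessel_vector] carries no sign. *)
move=> [c hc]; exists `|c| => // g m n.
apply: le_trans (_ : \sum_(0 <= j < n) rnorm (ip g (iter j U x) : C) ^+ 2 <= _).
  have [mn|nm] := leqP m n; last first.
    by rewrite big_geq ?(ltnW nm)//; apply: sumr_ge0 => j _; exact: sqr_ge0.
  rewrite (big_cat_nat (leq0n m) mn)//= lerDr; apply: sumr_ge0 => j _; exact: sqr_ge0.
pose a j : C := (ip g (iter j U x))^*.
set s := \sum_(0 <= j < n) _.
have s0 : 0 <= s by apply: sumr_ge0 => j _; exact: sqr_ge0.
have aE : \sum_(0 <= j < n) rnorm (a j) ^+ 2 = s.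
  by apply: eq_bigr => j _; rewrite /a rnorm_conj.
have := hc n a; rewrite aE; set y := \sum_(0 <= j < n) _ => hy.
have sy : cofR s = ip g y.
  rewrite /y ip_sumr /s /cofR rmorph_sum; apply: eq_bigr => j _ /=.
  by rewrite ipZr /a sqr_rnorm_conj.
have h1 : s <= rnorm g * rnorm y.
  by apply: le_trans (ip_cauchy_schwarz g y); rewrite -sy rnorm_cofR ger0_norm.
have h2 : s ^+ 2 <= rnorm g ^+ 2 * (`|c| * s).
  apply: le_trans (ler_sqr_nneg s0 h1) _; rewrite exprMn ler_wpM2l ?sqr_ge0//.
  by apply: le_trans hy _; rewrite ler_wpM2r// ler_norm.
have [->|sn0] := eqVneq s 0; first by rewrite mulr_ge0// sqr_ge0.
have sp : 0 < s by rewrite lt_neqAle eq_sym sn0.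
by rewrite -(ler_pM2r sp) -expr2; apply: le_trans h2 _; rewrite mulrCA mulrA.
Qed.

Variables (e : nat -> H).
Hypothesis e1 : forall k, rnorm (e k) <= 1.
Hypothesis eE : forall x, (fun n => \sum_(0 <= k < n) ip (e k) x *: e k) @ \oo --> x.

(* A basis dependent substitute for the trace norm.  It behaves well under
   composition on the right only with operators that satisfy Schur's test in the
   basis [e]. *)
Definition summable_bound (K : H -> H) (b : R) :=
  forall n, \sum_(0 <= k < n) rnorm (K (e k)) <= b.

Lemma cvg_expansion (K : {linear H -> H}) (m : R) x : op_bound K m ->
  (fun n => \sum_(0 <= k < n) ip (e k) x *: K (e k)) @ \oo --> K x.
Proof.
move=> Km; have := cvg_bounded eventually_filter Km (@eE x); apply: cvg_trans.
apply: near_eq_cvg; near=> n; rewrite (linear_sum K); apply: eq_bigr => k _.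
by rewrite (hlinZ K).
Unshelve. all: by end_near. Qed.

Section Nuclear.
Variables (K : {linear H -> H}) (mK b : R).
Hypotheses (Km : op_bound K mK) (Kb : summable_bound K b).

(** Expanding x j in the basis turns the sum into one over k of sum_j <e k, x j> <y j, K (e k)>.
    Cauchy-Schwarz in j, with the Bessel bound for the y j tested on K (e k), extracts the factor |K
    (e k)|. *)
Lemma form_sum_le (m n : nat) (x y : nat -> H) (c B : R) : 0 <= c ->
  (forall g, \sum_(m <= j < n) rnorm (ip g (y j) : C) ^+ 2 <= c * rnorm g ^+ 2) ->
  (forall p, \sum_(0 <= k < p) rnorm (K (e k)) *
     Num.sqrt (\sum_(m <= j < n) rnorm (ip (e k) (x j) : C) ^+ 2) <= B) ->
  rnorm (\sum_(m <= j < n) ip (y j) (K (x j)) : C) <= Num.sqrt c * B.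
Proof.
move=> c0 hy hB.
have hl : (fun p => \sum_(m <= j < n)
    ip (y j) (\sum_(0 <= k < p) ip (e k) (x j) *: K (e k)) : C) @ \oo -->
    (\sum_(m <= j < n) ip (y j) (K (x j)) : C).
  apply: cvg_sumv => j _; exact: (cvg_ip _ (@cvg_expansion K mK (x j) Km)).
apply: (cvg_rnorm_le hl); exists 0%N => p _.
have -> : \sum_(m <= j < n) ip (y j) (\sum_(0 <= k < p) ip (e k) (x j) *: K (e k)) =
    \sum_(0 <= k < p) \sum_(m <= j < n) ip (e k) (x j) * ip (y j) (K (e k)) :> C.
  rewrite exchange_big; apply: eq_bigr => j _ /=; rewrite ip_sumr.
  by apply: eq_bigr => k _; rewrite ipZr.
apply: le_trans (rnormv_sum _ _ _) _.
apply: le_trans (_ : Num.sqrt c * (\sum_(0 <= k < p) rnorm (K (e k)) *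
     Num.sqrt (\sum_(m <= j < n) rnorm (ip (e k) (x j) : C) ^+ 2)) <= _); last first.
  by rewrite ler_wpM2l ?sqrtr_ge0.
rewrite mulr_sumr; apply: ler_sum => k _.
apply: le_trans (rnormv_sum _ _ _) _.
under eq_bigr do rewrite rnormM.
set A := \sum_(m <= j < n) rnorm (ip (e k) (x j) : C) ^+ 2.
set s := \sum_(m <= j < n) _.
have s0 : 0 <= s by apply: sumr_ge0 => j _; rewrite mulr_ge0 ?rnorm_ge0.
have A0 : 0 <= A by apply: sumr_ge0 => j _; exact: sqr_ge0.
rewrite -(@ler_pXn2r _ 2) ?nnegrE ?mulr_ge0 ?sqrtr_ge0 ?rnormv_ge0//.
apply: le_trans (cauchy_schwarz_sum _ _ _) _.
rewrite !exprMn !sqr_sqrtr// -/A mulrA mulrC ler_wpM2r//.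
apply: le_trans (hy (K (e k))); apply: ler_sum => j _.
by rewrite rnorm_ipC.
Qed.

(** Dominated convergence for the sum over k: each root tends to 0 as m grows, uniformly in n, and
    is at most sqrt c, while the |K (e k)| are summable. *)
Lemma bessel_tail (U : H -> H) phi : bessel_vector U phi ->
  forall ep : R, 0 < ep -> exists m0, forall m n p, (m0 <= m)%N ->
    \sum_(0 <= k < p) rnorm (K (e k)) *
      Num.sqrt (\sum_(m <= j < n) rnorm (ip (e k) (iter j U phi) : C) ^+ 2) <= ep.
Proof.
move=> /bessel_dual[c c0 hc].
pose t k m n := Num.sqrt (\sum_(m <= j < n) rnorm (ip (e k) (iter j U phi) : C) ^+ 2).
have t0 k m n : 0 <= t k m n by exact: sqrtr_ge0.
have tc k m n : t k m n <= Num.sqrt c.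
  rewrite ler_sqrt//; apply: le_trans (hc _ _ _) _.
  rewrite ler_piMr//; apply: le_trans (ler_sqr_nneg (rnormv_ge0 _) (e1 k)) _.
  by rewrite expr1n.
have tsmall k ep : 0 < ep -> exists m0, forall m n, (m0 <= m)%N -> t k m n <= ep.
  move=> ep0; pose u j := rnorm (ip (e k) (iter j U phi) : C) ^+ 2.
  have u0 j : 0 <= u j by exact: sqr_ge0.
  have cu : cvgn (series u).
    apply: nondecreasing_is_cvgn.
      by apply: nondecreasing_series => j _ _.
    exists (c * rnorm (e k) ^+ 2) => _ [n _ <-]; exact: hc.
  have /cauchy_cvgP/cauchy_seriesP := cu.
  have e20 : 0 < ep ^+ 2 by rewrite exprn_gt0.
  move=> /(_ _ e20) [[A B] /= [[a _ hA] [b' _ hB]] hAB].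
  exists (maxn a b') => m n mm.
  have [nm|mn] := leqP n m; first by rewrite /t big_geq// sqrtr0 ltW.
  rewrite -(@ler_pXn2r _ 2) ?nnegrE ?(ltW ep0)// /t sqr_sqrtr; last first.
    by apply: sumr_ge0 => j _; exact: sqr_ge0.
  apply: ltW; apply: le_lt_trans (hAB (m, n) _); first exact: ler_norm.
  split=> /=; [apply: hA|apply: hB] => /=.
    by apply: leq_trans mm; exact: leq_maxl.
  by apply: leq_trans (ltnW mn); apply: leq_trans mm; exact: leq_maxr.
have head p : forall ep : R, 0 < ep -> exists m0, forall m n, (m0 <= m)%N ->
    \sum_(0 <= k < p) rnorm (K (e k)) * t k m n <= ep.
  elim: p => [|p IH] ep ep0; first by exists 0%N => m n _; rewrite big_nil ltW.
  have e2 : 0 < ep / 2 by rewrite divr_gt0.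
  have [m1 h1] := IH _ e2.
  have kp : 0 < rnorm (K (e p)) + 1 by rewrite ltr_wpDl ?rnormv_ge0.
  have e3 : 0 < ep / 2 / (rnorm (K (e p)) + 1) by rewrite divr_gt0.
  have [m2 h2] := tsmall p _ e3.
  exists (maxn m1 m2) => m n mm; rewrite big_nat_recr//= [ep]splitr lerD//.
    by apply: h1; apply: leq_trans mm; exact: leq_maxl.
  apply: le_trans (_ : (rnorm (K (e p)) + 1) * t p m n <= _).
    by rewrite ler_wpM2r// lerDl.
  rewrite mulrC -ler_pdivlMr//; apply: h2.
  by apply: leq_trans mm; exact: leq_maxr.
move=> ep ep0.
pose u k := rnorm (K (e k)).
have u0 j : 0 <= u j by exact: rnormv_ge0.
have cu : cvgn (series u).
  apply: nondecreasing_is_cvgn.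
    by apply: nondecreasing_series => j _ _.
  by exists b => _ [n _ <-]; exact: Kb.
have /cauchy_cvgP/cauchy_seriesP := cu.
have sc : 0 < Num.sqrt c + 1 by rewrite ltr_wpDl ?sqrtr_ge0.
have e20 : 0 < ep / 2 / (Num.sqrt c + 1) by rewrite !divr_gt0.
move=> /(_ _ e20) [[A B] /= [[a _ hA] [b' _ hB]] hAB].
pose k0 := maxn a b'.
have ep2 : 0 < ep / 2 by rewrite divr_gt0.
have [m0 hm0] := head k0 _ ep2; exists m0 => m n p mm.
have [pk|kp] := leqP p k0.
  apply: le_trans (_ : \sum_(0 <= k < k0) rnorm (K (e k)) * t k m n <= _).
    rewrite [leRHS](big_cat_nat (leq0n p) pk)//= lerDl.
    by apply: sumr_ge0 => k _; rewrite mulr_ge0 ?rnormv_ge0.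
  by apply: le_trans (hm0 m n mm) _; rewrite ler_pdivrMr// ler_peMr ?(ltW ep0)// ler1n.
rewrite (big_cat_nat (leq0n k0) (ltnW kp))//= [ep]splitr lerD//; first exact: hm0.
apply: le_trans (_ : (\sum_(k0 <= k < p) u k) * (Num.sqrt c + 1) <= _).
  rewrite mulr_suml; apply: ler_sum => k _; rewrite ler_wpM2l ?rnormv_ge0//.
  by apply: le_trans (tc _ _ _) _; rewrite lerDl.
rewrite -ler_pdivlMr//; apply: ltW; apply: le_lt_trans (hAB (k0, p) _).
  exact: ler_norm.
split=> /=; [apply: hA|apply: hB] => /=; first exact: leq_maxl.
by apply: leq_trans (ltnW kp); exact: leq_maxr.
Qed.

End Nuclear.

(** * Discrete wave operators V^m U0^m on a Bessel vector *)

Section Discrete.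
Variables (U U0 V : {linear H -> H}) (b : R).
Hypotheses (UV : forall x, U (V x) = x) (VU : forall x, V (U x) = x)
  (adj : forall x y, ip x (U y) = ip (V x) y)
  (adjV : forall x y, ip x (V y) = ip (U x) y)
  (isoU : forall x, rnorm (U x) = rnorm x)
  (isoU0 : forall x, rnorm (U0 x) = rnorm x).
Let K : {linear H -> H} := linear_of (linearB2 U U0).
Hypothesis Kb : summable_bound K b.

Let KE x : K x = U x - U0 x. Proof. by []. Qed.

Let Km : op_bound K 2.
Proof.
move=> x; apply: le_trans (rnormvD _ _) _.
by rewrite rnormvN isoU isoU0 mulr_natl mulr2n.
Qed.

Lemma iter_adj n x y : ip x (iter n U y) = ip (iter n V x) y.
Proof. by elim: n x => // n IH x; rewrite iterS adj IH -iterSr. Qed.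

Lemma iter_adjV n x y : ip x (iter n V y) = ip (iter n U x) y.
Proof. by elim: n x => // n IH x; rewrite iterS adjV IH -iterSr. Qed.

Lemma iter_UV n x : iter n U (iter n V x) = x.
Proof. by elim: n x => // n IH x; rewrite iterSr [iter n.+1 V x]iterS UV IH. Qed.

Lemma ip_iter_iso n x y : ip (iter n U x) (iter n U y) = ip x y.
Proof.
by rewrite iter_adj; congr ip; elim: n x => // n IH x; rewrite iterSr [iter n.+1 U x]iterS VU IH.
Qed.

Variable phi : H.
Hypothesis bphi : bessel_vector U0 phi.
Let ph j := iter j U0 phi.
Let W m := iter m V (ph m).

Let rph j : rnorm (ph j) = rnorm phi.
Proof. by rewrite /ph; elim: j => //= j IH; rewrite isoU0. Qed.

Lemma rnorm_sqr_iterV n x : rnorm (iter n V x) ^+ 2 = rnorm x ^+ 2.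
Proof. by rewrite -!Re_ipxx -(ip_iter_iso n) iter_UV. Qed.

(** Expanding in the basis bounds |K (ph m)| by the sum in [bessel_tail] for the one-term window
    from m to m + 1. *)
Lemma defect_small (ep : R) : 0 < ep ->
  exists m0, forall m, (m0 <= m)%N -> rnorm (K (ph m)) <= ep.
Proof.
move=> ep0; have [m0 h] := bessel_tail Kb bphi ep0; exists m0 => m mm.
apply: (cvg_rnorm_le (@cvg_expansion K 2 (ph m) Km)); exists 0%N => p _.
apply: le_trans (rnormv_sum _ _ _) _; apply: le_trans (h m m.+1 p mm).
apply: ler_sum => k _; rewrite rnormvZ mulrC big_nat1 sqrtr_sqr ger0_norm//.
exact: rnormv_ge0.
Qed.

(* |W (m + d) - W m|^2 = 2 |phi|^2 - 2 F d m, and F d m - F d (m + 1) is a sum of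
   two terms that contain K = U - U0. *)
Let F d m : R := Re (ip (ph (m + d)) (iter d U (ph m))).

(** U^d (ph m) - ph (m + d) is built up from d defects K (ph (m + k)), each small for large m. The
    rank m0 depends on d. *)
Lemma overlap_limit d (ep : R) : 0 < ep ->
  exists m0, forall m, (m0 <= m)%N -> rnorm phi ^+ 2 - F d m <= ep.
Proof.
move=> ep0; pose c := d%:R * (rnorm phi + 1).
have ph1 : 0 < rnorm phi + 1 by rewrite ltr_wpDl ?rnormv_ge0.
have c0 : 0 <= c by rewrite mulr_ge0// ltW.
have e0 : 0 < ep / (c + 1) by rewrite divr_gt0// ltr_wpDl.
have [m0 h] := defect_small e0; exists m0 => m mm.
have diff k : rnorm (iter k U (ph m) - ph (m + k)) <= k%:R * (ep / (c + 1)).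
  elim: k => [|k IH]; first by rewrite addn0 subrr rnormv0 mul0r.
  have -> : iter k.+1 U (ph m) - ph (m + k.+1) =
      U (iter k U (ph m) - ph (m + k)) + K (ph (m + k)).
    by rewrite addnS KE (linearB U) /= addrA subrK.
  apply: le_trans (rnormvD _ _) _; rewrite isoU -natr1 mulrDl mul1r lerD//.
  by apply: h; exact: leq_trans mm (leq_addr _ _).
rewrite /F -{1}(rph (m + d)) -Re_ipxx -ReB -ipBr.
apply: le_trans (Re_ip_le _ _) _; rewrite rph rnormvB.
apply: le_trans (_ : (rnorm phi + 1) * (d%:R * (ep / (c + 1))) <= _).
  by apply: ler_pM; rewrite ?rnormv_ge0// lerDl.
have -> : (rnorm phi + 1) * (d%:R * (ep / (c + 1))) = c * (ep / (c + 1)).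
  by rewrite mulrCA mulrA.
rewrite mulrCA ler_piMr ?(ltW ep0)// ler_pdivrMr ?ltr_wpDl// mul1r lerDl.
exact: ler01.
Qed.

(** The bound involves neither d nor n. In each increment of F one factor is K applied to the orbit
    of phi, the other is handled by Bessel's inequality, and [form_sum_le] treats both families. *)
Lemma overlap_step d m n (B : R) : (m <= n)%N ->
  (forall p M N, (m <= M)%N -> \sum_(0 <= k < p) rnorm (K (e k)) *
    Num.sqrt (\sum_(M <= j < N) rnorm (ip (e k) (ph j) : C) ^+ 2) <= B) ->
  forall c : R, 0 <= c -> (forall g M N,
    \sum_(M <= j < N) rnorm (ip g (ph j) : C) ^+ 2 <= c * rnorm g ^+ 2) ->
  F d n - F d m <= 2 * (Num.sqrt c * B).
Proof.
move=> mn hB c c0 hc.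
pose y1 j := iter d U (ph j.+1); pose y2 j := iter d V (U (ph (j + d))).
(* Unitarity of U rewrites F d j with U in front of both orbit vectors; then U is replaced by U0 in
   one argument at a time. *)
have step j : F d j - F d j.+1 =
    Re (ip (y1 j) (K (ph (j + d)))) + Re (ip (y2 j) (K (ph j))).
  rewrite -ReD /F /y1 /y2 !KE; set a := ph (j + d); set x := ph j.
  have -> : ph j.+1 = U0 x by [].
  have -> : ph (j.+1 + d) = U0 a by [].
  rewrite (_ : ip a (iter d U x) = ip (U a) (iter d U (U x))); last first.
    by rewrite -iterSr iterS adj VU.
  rewrite !ipBr -(iter_adj d (U a)) -(iter_adj d (U a)) !ReD !ReN.
  rewrite (Re_ipC (iter d U (U0 x)) (U a)) (Re_ipC (iter d U (U0 x)) (U0 a)).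
  ring.
have tel : F d m - F d n =
    Re (\sum_(m <= j < n) ip (y1 j) (K (ph (j + d)))) +
    Re (\sum_(m <= j < n) ip (y2 j) (K (ph j))).
  rewrite !Re_sum -big_split /=.
  under [RHS]eq_bigr do rewrite -step.
  rewrite -[LHS]opprB -(telescope_sumr (F d) mn) -sumrN.
  by apply: eq_bigr => j _; rewrite opprB.
rewrite -opprB tel opprD mulrDl !mul1r.
have Rle (z : C) : - Re z <= rnorm z.
  by apply: le_trans (normr_Re z); rewrite -normrN ler_norm.
apply: lerD; apply: le_trans (Rle _) _.
  apply: (@form_sum_le K 2 Km m n (fun j => ph (j + d)) y1 c B c0) => [g|p].
    rewrite /y1; under eq_bigr do rewrite iter_adj.
    apply: le_trans (_ : c * rnorm (iter d V g) ^+ 2 <= _).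
      by have := hc (iter d V g) m.+1 n.+1; rewrite big_add1.
    by rewrite rnorm_sqr_iterV.
  (* The window moves right by d, so it still starts at or after m. *)
  have := hB p (m + d)%N (n + d)%N (leq_addr _ _); apply: le_trans.
  apply: ler_sum => k _; rewrite ler_wpM2l ?rnormv_ge0//.
  by rewrite big_addn addnK.
apply: (@form_sum_le K 2 Km m n ph y2 c B c0) => [g|p]; last exact: hB.
rewrite /y2; under eq_bigr do rewrite iter_adjV adj.
apply: le_trans (_ : c * rnorm (V (iter d U g)) ^+ 2 <= _).
  have := hc (V (iter d U g)) (m + d)%N (n + d)%N; apply: le_trans.
  by rewrite big_addn addnK.
have -> : V (iter d U g) = iter 1 V (iter d U g) by [].
by rewrite rnorm_sqr_iterV -!Re_ipxx ip_iter_iso.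
Qed.

(** m0 comes from [bessel_tail] alone, hence is uniform in d. For given d, [overlap_limit] supplies
    a far n at which the overlap is almost |phi|^2, and [overlap_step] leads back from n to m. *)
Lemma wave_cauchy (ep : R) : 0 < ep -> exists m0, forall m d, (m0 <= m)%N ->
  rnorm (W (m + d) - W m) <= ep.
Proof.
move=> ep0; have [c c0 hc] := bessel_dual bphi.
have e20 : 0 < ep ^+ 2 / 8 by rewrite divr_gt0// exprn_gt0.
have sc : 0 < Num.sqrt c + 1 by rewrite ltr_wpDl ?sqrtr_ge0.
have e30 : 0 < ep ^+ 2 / 8 / (Num.sqrt c + 1) by rewrite divr_gt0.
have [m0 hm0] := bessel_tail Kb bphi e30; exists m0 => m d mm.
have [m1 hm1] := overlap_limit d e20.
pose n := maxn m m1.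
have hB p M N : (m <= M)%N -> \sum_(0 <= k < p) rnorm (K (e k)) *
    Num.sqrt (\sum_(M <= j < N) rnorm (ip (e k) (ph j) : C) ^+ 2) <=
    ep ^+ 2 / 8 / (Num.sqrt c + 1).
  by move=> mM; apply: hm0; exact: leq_trans mm mM.
have h1 := overlap_step d (leq_maxl m m1) hB c0 hc.
have h2 := hm1 (maxn m m1) (leq_maxr _ _).
have h3 : Num.sqrt c * (ep ^+ 2 / 8 / (Num.sqrt c + 1)) <= ep ^+ 2 / 8.
  rewrite mulrCA ler_piMr ?(ltW e20)// ler_pdivrMr// mul1r lerDl; exact: ler01.
have h4 : rnorm (W (m + d) - W m) ^+ 2 = 2 * (rnorm phi ^+ 2 - F d m).
  rewrite rnormB_sqr /W !rnorm_sqr_iterV !rph /F.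
  rewrite (_ : ip (iter (m + d) V _) _ = ip (ph (m + d)) (iter d U (ph m))); last first.
    rewrite iter_adjV iterD iter_UV [RHS]iter_adj.
  by [].
  ring.
rewrite -(@ler_pXn2r _ 2) ?nnegrE ?rnormv_ge0 ?(ltW ep0)// h4.
lra.
Qed.
End Discrete.
End KatoRosenblum.

(** * Summability passes from T - T0 to the exponentials *)

Section SummableDifference.
Variables (R : realType) (H : hilbert R).
Local Notation C := (Cplx R).
Implicit Types (x y : H).
Variables (e : nat -> H).
Hypothesis eE : forall x, (fun n => \sum_(0 <= k < n) ip (e k) x *: e k) @ \oo --> x.
Variables (T0 : {linear H -> H}) (a : R).
Hypotheses (a0 : 0 <= a)
  (schur : forall l n, \sum_(0 <= j < n) rnorm (ip (e l) (T0 (e j)) : C) <= a).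

(** Expand T0 (e j) in the basis and exchange the sums: |K (e k)| is then multiplied by the k-th row
    sum of the matrix of T0, at most a. *)
Lemma summable_bound_comp (K : {linear H -> H}) (m b : R) : op_bound K m ->
  summable_bound e K b -> summable_bound e (K \o T0) (a * b).
Proof.
move=> Km Kb n.
have hj j : (fun p => rnorm (\sum_(0 <= k < p) ip (e k) (T0 (e j)) *: K (e k)))
    @ \oo --> rnorm (K (T0 (e j))).
  exact: (cvg_rnorm _ (@cvg_expansion _ _ e eE K m (T0 (e j)) Km)).
have hl : (fun p => \sum_(0 <= j < n)
    rnorm (\sum_(0 <= k < p) ip (e k) (T0 (e j)) *: K (e k))) @ \oo -->
    \sum_(0 <= j < n) rnorm (K (T0 (e j))).
  by apply: cvg_sumv => j _; exact: hj.
apply: (cvgr_to_le hl); near=> p.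
apply: le_trans (_ : \sum_(0 <= j < n) \sum_(0 <= k < p)
    rnorm (ip (e k) (T0 (e j)) : C) * rnorm (K (e k)) <= _).
  apply: ler_sum => j _; apply: le_trans (rnormv_sum _ _ _) _.
  by apply: ler_sum => k _; rewrite rnormvZ.
rewrite exchange_big /=; apply: le_trans (_ : \sum_(0 <= k < p) a * rnorm (K (e k)) <= _).
  by apply: ler_sum => k _; rewrite -mulr_suml ler_wpM2r ?rnormv_ge0.
by rewrite -mulr_sumr ler_wpM2l.
Unshelve. all: by end_near. Qed.

Variables (T : {linear H -> H}) (m b : R).
Hypotheses (m0 : 0 <= m) (Tm : op_bound T m) (T0m : op_bound T0 m).
Let v : {linear H -> H} := linear_of (linearB2 T T0).
Hypothesis vb : summable_bound e v b.

Let b0 : 0 <= b.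
Proof. by have := vb 0%N; rewrite big_nil. Qed.

Let vm : op_bound v (2 * m).
Proof.
move=> x; apply: le_trans (rnormvD _ _) _; rewrite rnormvN -mulrA mulr_natl mulr2n.
by apply: lerD.
Qed.

Lemma summable_bound_iter k : summable_bound e (fun x => v (iter k T0 x)) (a ^+ k * b).
Proof.
elim: k => [|k IH] n; first by rewrite expr0 mul1r.
pose vk : {linear H -> H} := linear_of (fun (c : C) x y =>
  etrans (congr1 v (iter_linear T0 k c x y)) (linearP v _ _ _)).
have vkm : op_bound vk (2 * m * m ^+ k).
  move=> x; apply: le_trans (vm (iter k T0 x)) _; rewrite -[leRHS]mulrA ler_wpM2l ?mulr_ge0//.
  exact: op_bound_iter.
have := @summable_bound_comp vk _ _ vkm IH n.
rewrite exprS mulrA; apply: le_trans; apply: ler_sum => j _.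
by rewrite iterSr.
Qed.

(** Induction on T^(k+1) - T0^(k+1) = T (T^k - T0^k) + v T0^k. The number m + a + 1 dominates m, a
    and 1. *)
Lemma summable_bound_pow k n : \sum_(0 <= j < n) rnorm (iter k T (e j) - iter k T0 (e j)) <=
  k%:R * (m + a + 1) ^+ k * b.
Proof.
set L := m + a + 1; have L1 : 1 <= L by rewrite lerDr addr_ge0.
have mL : m <= L by rewrite /L -addrA lerDl addr_ge0.
have aL : a <= L by rewrite /L [m + a]addrC -addrA lerDl addr_ge0.
elim: k => [|k IH].
  rewrite !mul0r big1// => j _; by rewrite subrr rnormv0.
apply: le_trans (_ : \sum_(0 <= j < n) (m * rnorm (iter k T (e j) - iter k T0 (e j)) +
    rnorm (v (iter k T0 (e j)))) <= _).
  apply: ler_sum => j _; rewrite !iterS.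
  have -> : T (iter k T (e j)) - T0 (iter k T0 (e j)) =
      T (iter k T (e j) - iter k T0 (e j)) + v (iter k T0 (e j)).
    by rewrite (linearB T) /= addrA subrK.
  by apply: le_trans (rnormvD _ _) _; rewrite lerD.
rewrite big_split /= -mulr_sumr -natr1 mulrDl mul1r mulrDl lerD//.
  rewrite exprS; apply: le_trans (ler_pM _ _ mL IH) _ => //.
    by apply: sumr_ge0 => j _; exact: rnormv_ge0.
  by rewrite le_eqVlt; apply/orP; left; apply/eqP; ring.
apply: le_trans (summable_bound_iter k n) _; rewrite ler_wpM2r//.
apply: le_trans (_ : L ^+ k <= _).
  by apply: lerXn2r; rewrite ?nnegrE// (le_trans a0).
by rewrite exprS ler_peMl// exprn_ge0// (le_trans ler01).
Qed.

(** Termwise in the exponential series; the factor k of [summable_bound_pow] is absorbed by 2^k. *)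
Lemma summable_bound_hexp t : summable_bound e
  (fun x => hexp T t x - hexp T0 t x) (expR (`|t| * (2 * (m + a + 1))) * b).
Proof.
move=> n; set L := m + a + 1; have L0 : 0 <= L by rewrite !addr_ge0.
have hj j : (fun p => rnorm (pexp T p ('i * cofR t) (e j) - pexp T0 p ('i * cofR t) (e j)))
    @ \oo --> rnorm (hexp T t (e j) - hexp T0 t (e j)).
  apply: cvg_rnorm; apply: cvgB.
    exact: (@cvg_hexp _ _ T m m0 Tm).
  exact: (@cvg_hexp _ _ T0 m m0 T0m).
have hl : (fun p => \sum_(0 <= j < n)
    rnorm (pexp T p ('i * cofR t) (e j) - pexp T0 p ('i * cofR t) (e j))) @ \oo -->
    \sum_(0 <= j < n) rnorm (hexp T t (e j) - hexp T0 t (e j)).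
  by apply: cvg_sumv => j _; exact: hj.
apply: (cvgr_to_le hl); near=> p.
apply: le_trans (_ : \sum_(0 <= j < n) \sum_(0 <= k < p)
    expc `|t| k * rnorm (iter k T (e j) - iter k T0 (e j)) <= _).
  apply: ler_sum => j _; rewrite /pexp -sumrB.
  apply: le_trans (rnormv_sum _ _ _) _; apply: ler_sum => k _.
  by rewrite -scalerBr rnormvZ rnorm_expc rnorm_imag.
rewrite exchange_big /=.
apply: le_trans (_ : \sum_(0 <= k < p) expc (`|t| * (2 * L)) k * b <= _); last first.
  by rewrite -mulr_suml ler_wpM2r// (sum_expc_le p)// !mulr_ge0.
apply: ler_sum => k _; rewrite -mulr_sumr.
apply: le_trans (_ : expc `|t| k * (k%:R * L ^+ k * b) <= _).
  by rewrite ler_wpM2l ?expc_ge0// summable_bound_pow.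
have -> : expc (`|t| * (2 * L)) k * b = expc `|t| k * (2 ^+ k * L ^+ k * b).
  by rewrite /expc !exprMn; ring.
rewrite ler_wpM2l ?expc_ge0// ler_wpM2r// ler_wpM2r ?exprn_ge0//.
by rewrite -natrX ler_nat ltnW// ltn_expl.
Unshelve. all: by end_near. Qed.

End SummableDifference.

(* The sign [sg] is 1 for the limit t -> +oo and -1 for t -> -oo. *)
Definition wave_limit (R : realType) (H : hilbert R) (sg : R) (T T0 : H -> H)
    (x l : H) := forall ep : R, 0 < ep -> exists t0 : R, forall t, t0 <= t ->
  rnorm (hexp T (sg * t) (hexp T0 (- (sg * t)) x) - l) <= ep.

Lemma hexp_linearB (R : realType) (H : hilbert R) (S : {linear H -> H}) (m t : R)
    (m0 : 0 <= m) (Sm : op_bound S m) (x y : H) :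
  hexp S t (x - y) = hexp S t x - hexp S t y.
Proof. exact: (linearB (linear_of (hexp_linear m0 Sm t))). Qed.

(** The unitary with time s = -(d - 1) tau turns forward powers into backward ones while reversing
    the coefficients, so the same constant works. *)
Lemma bessel_reverse (R : realType) (H : hilbert R) (S : {linear H -> H}) (m tau : R)
    (x : H) : 0 <= m -> op_bound S m -> hsymmetric S ->
  bessel_vector (hexp S tau) x -> bessel_vector (hexp S (- tau)) x.
Proof.
move=> m0 Sm sS [c hc]; exists c => d a.
pose b n := a (d - n.+1)%N.
have -> : \sum_(0 <= n < d) rnorm (a n) ^+ 2 = \sum_(0 <= n < d) rnorm (b n) ^+ 2.
  by rewrite big_nat_rev.
pose s := - ((d%:R - 1) * tau); pose L := linear_of (hexp_linear m0 Sm s).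
have -> : \sum_(0 <= n < d) a n *: iter n (hexp S (- tau)) x =
    L (\sum_(0 <= n < d) b n *: iter n (hexp S tau) x).
  rewrite linear_sum [RHS]big_nat_rev /= add0n big_nat_cond [RHS]big_nat_cond.
  apply: eq_bigr => n /andP[/andP[_ nd] _].
  rewrite -[hexp S s _]/(L _) (hlinZ L) /L /= /b subnSK// subKn ?(ltnW nd)//.
  rewrite -(hexp_iter m0 Sm n (- tau) x) -(hexp_iter m0 Sm (d - n.+1) tau x).
  rewrite -(hexpD m0 Sm s ((d - n.+1)%:R * tau) x) (natrB _ nd) -[n.+1%:R]natr1.
  by congr (_ *: hexp S _ x); rewrite /s; ring.
by rewrite /L /= (rnorm_hexp m0 Sm sS).
Qed.

(** * Wave limits in continuous time *)

Section WaveLimit.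
Variables (R : realType) (H : hilbert R).
Local Notation C := (Cplx R).
Implicit Types (x y l : H).
Variables (e : nat -> H).
Hypothesis e1 : forall k, rnorm (e k) <= 1.
Hypothesis eE : forall x, (fun n => \sum_(0 <= k < n) ip (e k) x *: e k) @ \oo --> x.
Variables (T T0 : {linear H -> H}) (m : R).
Hypotheses (m0 : 0 <= m) (Tm : op_bound T m) (T0m : op_bound T0 m).
Hypotheses (sT : hsymmetric T) (sT0 : hsymmetric T0).
Hypothesis Kb : forall t, exists b,
  summable_bound e (fun x => hexp T t x - hexp T0 t x) b.

Let w t x := hexp T t (hexp T0 (- t) x).

Let rw t x : rnorm (w t x) = rnorm x.
Proof. by rewrite /w (rnorm_hexp m0 Tm sT) (rnorm_hexp m0 T0m sT0). Qed.

Let wB t x y : w t (x - y) = w t x - w t y.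
Proof. by rewrite /w (hexp_linearB _ m0 T0m) (hexp_linearB _ m0 Tm). Qed.

Let w_grid n tau x :
  w (n%:R * tau) x = iter n (hexp T tau) (iter n (hexp T0 (- tau)) x).
Proof. by rewrite /w -mulrN (hexp_iter m0 T0m) (hexp_iter m0 Tm). Qed.

(** After isometries are stripped off, both one-parameter groups differ from the identity by at most
    exp(|r| m) - 1. *)
Let w_step s r x :
  rnorm (w (s + r) x - w s x) <= 2 * (expR (`|r| * m) - 1) * rnorm x.
Proof.
rewrite /w opprD [- s + _]addrC (hexpD m0 Tm) (hexpD m0 T0m).
set chi := hexp T0 (- s) x.
have rchi : rnorm chi = rnorm x by rewrite (rnorm_hexp m0 T0m sT0).
rewrite -(hexp_linearB _ m0 Tm) (rnorm_hexp m0 Tm sT).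
rewrite -{2}(hexpNK m0 Tm r chi) -(hexp_linearB _ m0 Tm) (rnorm_hexp m0 Tm sT).
apply: le_trans (rnormv_dist _ chi _) _; rewrite [X in _ + X]rnormvB -rchi.
have h1 := hexp_sub_id m0 T0m (- r) chi; have h2 := hexp_sub_id m0 Tm (- r) chi.
rewrite normrN in h1 h2.
by rewrite -mulrA mulr_natl mulr2n lerD.
Qed.

Variable sg : R.
Hypothesis sg1 : sg = 1 \/ sg = - 1.
Let sg2 : sg * sg = 1. Proof. by case: sg1 => ->; ring. Qed.

(** [wave_cauchy] is applied with time -(sg tau), because V^n U0^n must be exp(i n sg tau T) exp(- i
    n sg tau T0). For sg = 1 the Bessel property has to be reversed first. *)
Let w_grid_cauchy tau x : bessel_vector (hexp T0 tau) x ->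
  forall ep : R, 0 < ep -> exists n0, forall n d, (n0 <= n)%N ->
    rnorm (w (sg * ((n + d)%:R * tau)) x - w (sg * (n%:R * tau)) x) <= ep.
Proof.
move=> bx ep ep0; have bx' : bessel_vector (hexp T0 (- (sg * tau))) x.
  case: sg1 => ->; last by rewrite mulN1r opprK.
  by rewrite mul1r; exact: (bessel_reverse m0 T0m sT0).
pose LT t := linear_of (hexp_linear m0 Tm t).
pose LT0 t := linear_of (hexp_linear m0 T0m t).
have [b hb] := Kb (- (sg * tau)).
have [n0 hn0] := @wave_cauchy R H e e1 eE (LT (- (sg * tau))) (LT0 (- (sg * tau)))
  (LT (sg * tau)) b (hexpK m0 Tm _) (hexpNK m0 Tm _)
  (fun y z => etrans (ip_hexp m0 Tm sT _ y z) (congr1 (fun r => ip (hexp T r y) z) (opprK _)))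
  (ip_hexp m0 Tm sT _) (rnorm_hexp m0 Tm sT _)
  (rnorm_hexp m0 T0m sT0 _) hb x bx' ep ep0.
exists n0 => n d nn; have := hn0 n d nn.
by rewrite ![sg * (_ * tau)]mulrCA !w_grid.
Qed.

(** x is replaced by a Bessel vector phi and each time by the grid point below it. That costs two
    errors et for each of s and t, and the grid contributes a fifth, whence ep / 6. *)
Lemma wave_limit_cauchy x : hac T0 x -> forall ep : R, 0 < ep ->
  exists t0 : R, forall s t, t0 <= s -> t0 <= t ->
    rnorm (w (sg * s) x - w (sg * t) x) <= ep.
Proof.
move=> hx ep ep0; pose et := ep / 6; have et0 : 0 < et by rewrite divr_gt0.
have e5 : et + et + (et + (et + et)) <= ep by rewrite /et; lra.
pose q := et / (2 * (rnorm x + 1)).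
have x1 : 0 < rnorm x + 1 by rewrite ltr_wpDl ?rnormv_ge0.
have q0 : 0 < q by rewrite divr_gt0// mulr_gt0.
have m1 : 0 < m + 1 by rewrite ltr_wpDl.
have lq : 0 < ln (1 + q) by rewrite ln_gt0// ltrDl.
(* The first bound makes exp(tau m) - 1 at most q, which controls times between grid points; the
   second yields m < pi / tau for [hac_bessel_approx]. Dividing by m + 1 covers m = 0. *)
pose tau := Num.min (ln (1 + q) / (m + 1)) (pi / (m + 1)).
have tau0 : 0 < tau by rewrite lt_min !divr_gt0// pi_gt0.
have taupi : m < pi / tau.
  rewrite ltr_pdivlMr// mulrC; apply: le_lt_trans (_ : pi / (m + 1) * m < _).
    by rewrite ler_wpM2r// ge_min lexx orbT.
  by rewrite mulrAC ltr_pdivrMr// ltr_pM2l ?pi_gt0// ltrDl.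
have tauq : expR (tau * m) - 1 <= q.
  rewrite lerBlDl -[leRHS]lnK ?posrE ?addr_gt0// ler_expR.
  apply: le_trans (_ : ln (1 + q) / (m + 1) * m <= _).
    by rewrite ler_wpM2r// ge_min lexx.
  by rewrite mulrAC ler_pdivrMr// ler_pM2l// lerDl.
have [u hu ux] := hac_bessel_approx m0 T0m sT0 tau0 taupi hx.
have [n1 /(_ n1 (leqnn _)) hphi] := (cvgn_rnormP _ _).1 ux _ et0.
set phi := u n1 in hphi.
have [n0 hn0] := w_grid_cauchy (hu n1) et0.
have near t : n0%:R * tau <= t -> exists2 n, (n0 <= n)%N &
    rnorm (w (sg * t) x - w (sg * (n%:R * tau)) phi) <= et + et.
  move=> nt; pose n := Num.truncn (t / tau).
  have t0 : 0 <= t by apply: le_trans nt; rewrite mulr_ge0// ltW.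
  have tt0 : 0 <= t / tau by rewrite divr_ge0// ltW.
  exists n; first by rewrite Num.Theory.truncn_ge_nat// ler_pdivlMr.
  have /andP[h1 h2] : n%:R <= t / tau < n.+1%:R.
    by apply: Num.Theory.truncn_itv; rewrite divr_ge0// ltW.
  pose r := t - n%:R * tau.
  have r0 : 0 <= r by rewrite subr_ge0 -ler_pdivlMr.
  have rt : r <= tau.
    by rewrite lerBlDl -[X in _ + X]mul1r -mulrDl natr1 -ler_pdivrMr// ltW.
  have -> : sg * t = sg * (n%:R * tau) + sg * r by rewrite /r; ring.
  apply: le_trans (rnormv_dist _ (w (sg * (n%:R * tau)) x) _) _.
  apply: lerD; last by rewrite -wB rw rnormvB.
  apply: le_trans (w_step _ _ _) _.
  have sr : `|sg * r| = r.
    by rewrite normrM (ger0_norm r0); case: sg1 => ->; rewrite ?normrN normr1 mul1r.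
  apply: le_trans (_ : 2 * q * (rnorm x + 1) <= _); last first.
    have x1' : rnorm x + 1 != 0 by rewrite gt_eqF.
    by rewrite le_eqVlt; apply/orP; left; apply/eqP; rewrite /q; field.
  have hq : expR (`|sg * r| * m) - 1 <= q.
    by apply: le_trans tauq; rewrite lerD2r ler_expR sr ler_wpM2r.
  apply: le_trans (_ : 2 * q * rnorm x <= _).
    by rewrite ler_wpM2r ?rnormv_ge0// ler_pM2l.
  by apply: ler_wpM2l; rewrite ?lerDl// mulr_ge0// ltW.
exists (n0%:R * tau) => s t /near[n nn hn] /near[k kn hk].
have nk : rnorm (w (sg * (n%:R * tau)) phi - w (sg * (k%:R * tau)) phi) <= et.
  have [le|lt] := leqP n k.
    by rewrite rnormvB -(subnKC le); exact: hn0.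
  by rewrite -(subnKC (ltnW lt)); exact: hn0.
apply: le_trans (rnormv_dist _ (w (sg * (n%:R * tau)) phi) _) _.
apply: le_trans (lerD hn (rnormv_dist _ (w (sg * (k%:R * tau)) phi) _)) _.
rewrite [X in _ + (_ + X)]rnormvB.
by apply: le_trans e5; rewrite lerD2l; exact: lerD.
Qed.

Lemma wave_limit_ex x : hac T0 x -> exists l, wave_limit sg T T0 x l.
Proof.
move=> hx.
have [l hl] : exists l : H, (fun n : nat => w (sg * n%:R) x) @ \oo --> l.
  apply: hilbert_complete => ep ep0.
  have [t0 ht0] := wave_limit_cauchy hx ep0.
  exists (Num.bound `|t0|) => i j hi hj.
  have big k : (Num.bound `|t0| <= k)%N -> t0 <= k%:R.
    move=> hk; apply: le_trans (ler_norm _) _.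
    by apply: le_trans (ltW (archi_boundP (normr_ge0 _))) _; rewrite ler_nat.
  by apply: ht0; exact: big.
exists l => ep ep0; have ep2 : 0 < ep / 2 by rewrite divr_gt0.
have [t0 ht0] := wave_limit_cauchy hx ep2; exists t0 => t tt.
have [n1 hn1] := (cvgn_rnormP _ _).1 hl _ ep2.
pose n := maxn n1 (Num.bound `|t0|).
have tn : t0 <= n%:R.
  apply: le_trans (ler_norm _) _.
  apply: le_trans (ltW (archi_boundP (normr_ge0 _))) _; rewrite ler_nat.
  exact: leq_maxr.
apply: le_trans (rnormv_dist _ (w (sg * n%:R) x) _) _; rewrite [ep]splitr lerD//.
  exact: ht0.
by apply: hn1; exact: leq_maxl.
Qed.

Lemma wave_limit_dist x y k l : wave_limit sg T T0 x k -> wave_limit sg T T0 y l ->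
  rnorm (k - l) = rnorm (x - y).
Proof.
move=> hk hl; apply/eqP; rewrite -subr_eq0 -normr_le0.
apply/ler_addgt0Pl => ep ep0; rewrite addr0.
have ep2 : 0 < ep / 2 by rewrite divr_gt0.
have [s hs] := hk _ ep2; have [t ht] := hl _ ep2; pose r := Num.max s t.
have /hs h1 : s <= r by rewrite le_max lexx.
have /ht h2 : t <= r by rewrite le_max lexx orbT.
rewrite -(rw (sg * r) (x - y)) wB.
apply: le_trans (rnormv_lip _ _) _; rewrite -!/(w _ _) in h1 h2.
have -> : k - l - (w (sg * r) x - w (sg * r) y) =
    (w (sg * r) y - l) - (w (sg * r) x - k).
  by rewrite !opprB [LHS]addrACA [RHS]addrACA [k + _]addrC.
by apply: le_trans (rnormvD _ _) _; rewrite rnormvN [ep]splitr lerD.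
Qed.

Lemma wave_limit_unique x k l : wave_limit sg T T0 x k -> wave_limit sg T T0 x l ->
  k = l.
Proof.
move=> hk hl; apply/eqP; rewrite -subr_eq0 -rnormv_eq0.
by rewrite (wave_limit_dist hk hl) subrr rnormv0.
Qed.

Lemma wave_limitP (a : C) x y k l : wave_limit sg T T0 x k ->
  wave_limit sg T T0 y l -> wave_limit sg T T0 (a *: x + y) (a *: k + l).
Proof.
move=> hk hl ep ep0; have ep2 : 0 < ep / 2 by rewrite divr_gt0.
have a1 : 0 < rnorm a + 1 by rewrite ltr_wpDl ?rnormv_ge0.
have ea : 0 < ep / 2 / (rnorm a + 1) by rewrite divr_gt0.
have [s hs] := hk _ ea; have [t ht] := hl _ ep2.
exists (Num.max s t) => r; rewrite ge_max => /andP[/hs h1 /ht h2].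
rewrite (hexp_linear m0 T0m) (hexp_linear m0 Tm) opprD addrACA -scalerBr.
apply: le_trans (rnormvD _ _) _; rewrite [ep]splitr lerD// rnormvZ.
apply: le_trans (ler_wpM2l (rnormv_ge0 _) h1) _.
by rewrite mulrCA ler_piMr ?(ltW ep2)// ler_pdivrMr// mul1r lerDl.
Qed.

Lemma wave_limit0 : wave_limit sg T T0 0 0.
Proof.
move=> ep ep0; exists 0 => t _.
by rewrite (_ : rnorm _ = 0) ?(ltW ep0)// subr0 -/(w _ _) rw rnormv0.
Qed.

(** Intertwining: the approximant of the evolved vector at t is exp(i s T) applied to that of x at
    the shifted time t - sg s. *)
Lemma wave_limit_hexp s x l : wave_limit sg T T0 x l ->
  wave_limit sg T T0 (hexp T0 s x) (hexp T s l).
Proof.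
move=> h ep /h[t0 ht0]; exists (t0 + `|s|) => t tt.
have /ht0 : t0 <= t - sg * s.
  have : `|sg * s| = `|s| by rewrite normrM; case: sg1 => ->; rewrite ?normrN normr1 mul1r.
  by have := ler_norm (sg * s) => h1 h2; move: h1 tt; rewrite h2; lra.
have -> : sg * (t - sg * s) = sg * t - s by rewrite mulrBr mulrA sg2 mul1r.
have e0 : hexp T0 (- (sg * t)) (hexp T0 s x) = hexp T0 (- (sg * t - s)) x.
  by rewrite -(hexpD m0 T0m (- (sg * t)) s x) opprB [s - _]addrC.
have e2 y : hexp T (sg * t) y = hexp T s (hexp T (sg * t - s) y).
  by rewrite -(hexpD m0 Tm s (sg * t - s) y) addrC subrK.
rewrite e0 e2 -(hexp_linearB s m0 Tm) (rnorm_hexp m0 Tm sT); exact.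
Qed.

(** Linearity, isometry and intertwining carry the Riesz bound over with the same constant. *)
Lemma wave_limit_bessel tau x l : bessel_vector (hexp T0 tau) x ->
  wave_limit sg T T0 x l -> bessel_vector (hexp T tau) l.
Proof.
move=> [c hc] hl; exists c => d a; apply: le_trans (hc d a).
rewrite ler_sqr_nneg ?rnormv_ge0//.
have it n : wave_limit sg T T0 (iter n (hexp T0 tau) x) (iter n (hexp T tau) l).
  by elim: n => //= n; exact: wave_limit_hexp.
have sum : wave_limit sg T T0 (\sum_(0 <= n < d) a n *: iter n (hexp T0 tau) x)
    (\sum_(0 <= n < d) a n *: iter n (hexp T tau) l).
  elim: d => [|d IH]; first by rewrite !big_nil; exact: wave_limit0.
  rewrite !big_nat_recr//= addrC [X in wave_limit _ _ _ _ X]addrC.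
  exact: wave_limitP.
have := wave_limit_dist sum wave_limit0; rewrite !subr0 => ->.
exact: lexx.
Qed.

(** Limits of approximating Bessel vectors are Bessel vectors for T, they converge to l by isometry,
    and [hac T] is closed. *)
Lemma wave_limit_hac x l : hac T0 x -> wave_limit sg T T0 x l -> hac T l.
Proof.
move=> hx hl; have m1 : 0 < m + 1 by rewrite ltr_wpDl.
have tau0 : 0 < pi / (m + 1) by rewrite divr_gt0 ?pi_gt0.
have taupi : m < pi / (pi / (m + 1)).
  by rewrite invf_div mulrC divfK ?gt_eqF ?pi_gt0// ltrDl.
have [u hu ux] := hac_bessel_approx m0 T0m sT0 tau0 taupi hx.
have hac_u n : hac T0 (u n) by exact: (bessel_hac m0 T0m sT0 (hu n)).
have [k hk] := choice (fun n => wave_limit_ex (hac_u n)).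
apply: (cs_cvg (hac_closed m0 Tm sT) (u := k)) => [n|].
  exact: (bessel_hac m0 Tm sT (wave_limit_bessel (hu n) (hk n))).
apply/cvg_rnormP; under eq_fun do rewrite (wave_limit_dist (hk _) hl).
by apply/cvg_rnormP.
Qed.

(** The inverse unitary applied to the error preserves its norm. Completeness thus reduces to
    existence for the exchanged pair. *)
Lemma wave_limit_swap x l : wave_limit sg T T0 x l -> wave_limit sg T0 T l x.
Proof.
move=> h ep /h[t0 ht0]; exists t0 => t /ht0.
set u := sg * t; set a := hexp T (- u) l.
rewrite -(rnorm_hexp m0 Tm sT (- u) (_ - l)) (hexp_linearB (- u) m0 Tm) (hexpK m0 Tm u) -/a.
rewrite -(rnorm_hexp m0 T0m sT0 (- u) (hexp T0 u a - x)) (hexp_linearB (- u) m0 T0m).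
by rewrite (hexpK m0 T0m u) rnormvB.
Qed.

End WaveLimit.

(** For l in [hac T] the exchanged pair has a wave limit x in [hac T0]; swapping back and uniqueness
    of limits give W x = l. *)
Theorem kato_rosenblum (R : realType) (H : hilbert R) (e : nat -> H)
    (T T0 : {linear H -> H}) (m sg : R) :
  (forall k, rnorm (e k) <= 1) ->
  (forall x, (fun n => \sum_(0 <= k < n) ip (e k) x *: e k) @ \oo --> x) ->
  0 <= m -> op_bound T m -> op_bound T0 m -> hsymmetric T -> hsymmetric T0 ->
  (forall t, exists b, summable_bound e (fun x => hexp T t x - hexp T0 t x) b) ->
  sg = 1 \/ sg = - 1 ->
  exists2 W : H -> H, forall x, wave_limit sg T T0 (hproj (hac T0) x) (W x) &
    range W = hac T.
Proof.
move=> e1 eE m0 Tm T0m sT sT0 Kb sg1.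
have Kb' t : exists b, summable_bound e (fun x => hexp T0 t x - hexp T t x) b.
  have [b hb] := Kb t; exists b => n; apply: le_trans (hb n).
  by apply: ler_sum => k _; rewrite rnormvB.
have cac := hac_closed m0 T0m sT0.
have hP x : hac T0 (hproj (hac T0) x) by exact: (hprojP x cac).1.
have [W hW] := choice (fun x => wave_limit_ex e1 eE m0 Tm T0m sT sT0 Kb sg1 (hP x)).
exists W => //; apply/seteqP; split=> [_ [x _ <-]|l hl].
  exact: (wave_limit_hac e1 eE m0 Tm T0m sT sT0 Kb sg1 (hP x) (hW x)).
have [x hx] := wave_limit_ex e1 eE m0 T0m Tm sT0 sT Kb' sg1 hl.
have acx : hac T0 x := wave_limit_hac e1 eE m0 T0m Tm sT0 sT Kb' sg1 hl hx.
exists x => //; apply: (wave_limit_unique m0 Tm T0m sT sT0 (hW x)).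
by rewrite (hproj_id cac acx); exact: (wave_limit_swap m0 T0m Tm sT0 sT hx).
Qed.

(** * Toeplitz operators and the perturbation *)

Section OrthonormalBasis.
Variables (R : realType) (H : hilbert R).
Local Notation C := (Cplx R).
Local Notation Re := (@complex.Re R).
Implicit Types (x y : H).
Variables (e : nat -> H).
Hypothesis on : forall j k, ip (e j) (e k) = (j == k)%:R.
Hypothesis total : forall x, (forall k, ip (e k) x = 0) -> x = 0.

Let S n x := \sum_(0 <= k < n) ip (e k) x *: e k.
Let s n x : R := \sum_(0 <= k < n) rnorm (ip (e k) x : C) ^+ 2.

Let ip_eS k n x : ip (e k) (S n x) = if (k < n)%N then ip (e k) x else 0.
Proof.
rewrite /S ip_sumr; under eq_bigr do rewrite ipZr on.
case: ifPn => kn; last first.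
  rewrite big_nat_cond big1// => j /andP[/andP[_ jn] _].
  by rewrite gtn_eqF ?mulr0// (leq_trans jn)// leqNgt.
rewrite (bigD1_seq k) ?mem_index_iota ?iota_uniq//= eqxx mulr1 big1 ?addr0//.
by move=> j jk; rewrite eq_sym (negbTE jk) mulr0.
Qed.

Let ip_Sx n x y : (forall k, (k < n)%N -> ip (e k) y = ip (e k) x) ->
  ip (S n x) y = cofR (s n x).
Proof.
move=> h; rewrite /S ip_suml /s /cofR rmorph_sum big_nat_cond [RHS]big_nat_cond.
apply: eq_bigr => k /andP[/andP[_ kn] _].
by rewrite ipZl h// sqr_rnorm_conj.
Qed.

Let rnormS n x : rnorm (S n x) ^+ 2 = s n x.
Proof.
rewrite -Re_ipxx (@ip_Sx n x)// => k kn.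
by rewrite ip_eS kn.
Qed.

Let s_le n x : s n x <= rnorm x ^+ 2.
Proof.
have := sqr_ge0 (rnorm (S n x - x)); rewrite rnormB_sqr rnormS ip_Sx//=.
lra.
Qed.

Let S_dist m n x : (m <= n)%N -> rnorm (S n x - S m x) ^+ 2 = s n x - s m x.
Proof.
move=> mn; rewrite rnormvB rnormB_sqr !rnormS (@ip_Sx m x)/=; first by ring.
by move=> k km; rewrite ip_eS (leq_trans km mn).
Qed.

Lemma onb_rnorm k : rnorm (e k) = 1.
Proof.
have : rnorm (e k) ^+ 2 = 1 by rewrite -Re_ipxx on eqxx.
by move/eqP; rewrite sqrp_eq1 ?rnormv_ge0// => /eqP.
Qed.

(** Bessel's inequality makes the partial sums Cauchy; their limit has the coefficients of x, and
    totality identifies the two. *)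
Lemma onb_expansion x : (fun n => \sum_(0 <= k < n) ip (e k) x *: e k) @ \oo --> x.
Proof.
have cs : cvgn (fun n => s n x).
  apply: nondecreasing_is_cvgn.
    by apply: nondecreasing_series => k _ _; exact: sqr_ge0.
  by exists (rnorm x ^+ 2) => _ [n _ <-]; exact: s_le.
have [l hl] : exists l : H, (fun n => S n x) @ \oo --> l.
  apply: hilbert_complete => ep ep0.
  have e20 : 0 < ep ^+ 2 / 2 by rewrite divr_gt0 ?exprn_gt0.
  move/cvg_ex : cs => [/= c /cvgrPdist_le/(_ _ e20) [n0 _ hn0]].
  exists n0 => m n hm hn; rewrite -(@ler_pXn2r _ 2) ?nnegrE ?rnormv_ge0 ?(ltW ep0)//.
  have h1 := hn0 m hm; have h2 := hn0 n hn; move: h1 h2; rewrite !ler_norml.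
  move=> /andP[? ?] /andP[? ?].
  have [mn|nm] := leqP m n; first by rewrite rnormvB S_dist//; lra.
  by rewrite S_dist ?(ltnW nm)//; lra.
suff xl : x = l by rewrite [X in _ --> X]xl.
apply/eqP; rewrite -subr_eq0; apply/eqP/total => k.
have hk : (fun n => ip (e k) (S n x)) @ \oo --> (ip (e k) l : C).
  exact: (cvg_ip _ hl).
rewrite ipBr; apply/eqP; rewrite subr_eq0; apply/eqP.
apply: (cvg_unique (@norm_hausdorff _ C^o) _ hk).
apply/cvgn_rnormP => ep ep0; exists k.+1 => n kn.
by rewrite ip_eS kn subrr rnormv0 ltW.
Qed.

Lemma onb_symmetric (T : {linear H -> H}) (m : R) : op_bound T m ->
  (forall j k, ip (e j) (T (e k)) = ip (T (e j)) (e k)) -> hsymmetric T.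
Proof.
move=> Tm h.
have ext x x' y : (forall k, ip x (T (e k)) = ip x' (e k)) -> ip x (T y) = ip x' y.
  move=> hk.
  have c1 : (fun n => ip x (T (S n y))) @ \oo --> (ip x (T y) : C).
    exact: (cvg_ip _ (cvg_bounded _ Tm (@onb_expansion y))).
  have c2 : (fun n => ip x' (S n y)) @ \oo --> (ip x' y : C).
    exact: (cvg_ip _ (@onb_expansion y)).
  apply: (cvg_unique (@norm_hausdorff _ C^o) c1).
  suff -> : (fun n => ip x (T (S n y))) = (fun n => ip x' (S n y)) by [].
  apply/funext => n; rewrite /S (linear_sum T) !ip_sumr; apply: eq_bigr => k _.
  by rewrite (hlinZ T) !ipZr hk.
move=> x y; apply: (ext x (T x) y) => k; rewrite -(ip_conj (T (e k)) x) -(ip_conj (e k) (T x)).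
by rewrite (ext (e k) (T (e k)) x)// => j; exact: h.
Qed.

End OrthonormalBasis.

Section FiniteSupport.
Variables (R : realType) (N : nat).
Local Notation C := (Cplx R).
Local Notation H := (l2 R N).

Lemma finite_support_sqsummable (u : nat -> 'cV[C]_N) n :
  (forall k, (n <= k)%N -> u k = 0) -> u \in @sqsummable R N.
Proof.
move=> un; pose s := \sum_(0 <= k < n) enorm (u k) ^+ 2.
have s0 : 0 <= s by apply: sumr_ge0 => k _; exact: sqr_ge0.
apply: (@sqsummable_partial _ _ u (Num.sqrt s)) => [|K]; first exact: sqrtr_ge0.
rewrite sqr_sqrtr//; have [Kn|nK] := leqP K n.
  rewrite /s (big_cat_nat (leq0n K) Kn)//= lerDl.
  by apply: sumr_ge0 => k _; exact: sqr_ge0.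
rewrite (big_cat_nat (leq0n n) (ltnW nK))//= -/s gerDl big_nat_cond big1//.
move=> k /andP[/andP[nk _] _]; rewrite un// (_ : enorm 0 = 0) ?expr0n//.
by rewrite -(scale0r (0 : 'cV[C]_N)) enormZ rnormv0 mul0r.
Qed.

Lemma inner_single (phi psi : H) q : (forall k, k != q -> phi k = 0) ->
  inner phi psi = dot (phi q) (psi q).
Proof.
move=> h; apply: inner_unique; apply/cvgn_rnormP => ep ep0; exists q.+1 => n qn.
rewrite /series /= (bigD1_seq q) ?mem_index_iota ?iota_uniq//= big1 ?addr0.
  by rewrite subrr rnormv0 ltW.
move=> k kq; rewrite h// /dot big1// => i _.
by rewrite mxE rmorph0 mul0r.
Qed.

Lemma cvg_col (u : nat -> 'cV[C]_N) (l : 'cV[C]_N) :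
  (forall i, (fun n => u n i ord0) @ \oo --> (l i ord0 : C)) -> u @ \oo --> l.
Proof.
move=> h; have E (x : 'cV[C]_N) : x = \sum_(i < N) x i ord0 *: delta_mx i ord0.
  by rewrite {1}[x]matrix_sum_delta; apply: eq_bigr => i _; rewrite big_ord1.
rewrite (E l) (_ : u = fun n => \sum_(i < N) u n i ord0 *: delta_mx i ord0); last first.
  by apply/funext => n; exact: E.
by apply: cvg_sumv => i _; apply: cvgZl; exact: h.
Qed.

End FiniteSupport.

Section StandardBasis.
Variables (R : realType) (N : nat) (hN : (0 < N)%N).
Local Notation C := (Cplx R).
Local Notation H := (l2 R N).

(** Index k stands for component k mod N at site k div N. *)
Let comp k : 'I_N := Ordinal (ltn_pmod k hN).

Let single k : nat -> 'cV[C]_N :=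
  fun n => if n == (k %/ N)%N then delta_mx (comp k) ord0 else 0.

Lemma basis_vec_subproof k : single k \in @sqsummable R N.
Proof.
apply: (@finite_support_sqsummable _ _ _ (k %/ N).+1) => n kn.
by rewrite /single gtn_eqF.
Qed.

Definition basis_vec k : H := L2 (basis_vec_subproof k).

Lemma inner_basis k (psi : H) : inner (basis_vec k) psi = psi (k %/ N)%N (comp k) ord0.
Proof.
rewrite (@inner_single _ _ (basis_vec k) psi (k %/ N)%N) => [|n nk]; last by rewrite /= /single (negbTE nk).
rewrite /dot /= /single eqxx (bigD1 (comp k))//= big1 ?addr0.
  by rewrite mxE !eqxx rmorph1 mul1r.
by move=> i ik; rewrite mxE (negbTE ik) rmorph0 mul0r.
Qed.

Lemma basis_vec_orthonormal j k :
  inner (basis_vec j) (basis_vec k) = (j == k)%:R.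
Proof.
rewrite inner_basis /= /single.
have [->|jk] := eqVneq j k; first by rewrite eqxx mxE !eqxx.
case: ifPn => [/eqP jk'|_]; last by rewrite mxE.
rewrite mxE andbT -val_eqE /=; case: eqP => // jkm.
by move: jk; rewrite (divn_eq j N) (divn_eq k N) jk' jkm eqxx.
Qed.

Lemma basis_vec_total (psi : H) : (forall k, inner (basis_vec k) psi = 0) -> psi = 0.
Proof.
move=> h; apply/val_inj/funext => n; apply/matrixP => i j; rewrite (ord1 j) mxE.
have := h (n * N + i)%N; rewrite inner_basis divnMDl// divn_small ?addn0//.
rewrite (_ : comp _ = i)//; apply/val_inj => /=.
by rewrite modnMDl modn_small.
Qed.

Lemma sum_divn_modn (V : nmodType) (F : nat -> nat -> V) q :
  \sum_(0 <= k < q * N) F (k %/ N)%N (k %% N)%N =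
  \sum_(0 <= n < q) \sum_(0 <= i < N) F n i.
Proof.
elim: q => [|q IH]; first by rewrite mul0n !big_nil.
rewrite big_nat_recr//= -IH mulSn addnC.
rewrite (big_cat_nat (leq0n (q * N)) (leq_addr _ _))/=; congr (_ + _).
rewrite -{1}[(q * N)%N]add0n big_addn addKn.
rewrite big_nat_cond [RHS]big_nat_cond; apply: eq_bigr => i /andP[/andP[_ iN] _].
by rewrite addnC divnMDl// divn_small// addn0 modnMDl modn_small.
Qed.

End StandardBasis.

Section Toeplitz.
Variables (R : realType) (N : nat) (hN : (0 < N)%N).
Local Notation C := (Cplx R).
Local Notation H := (l2 R N).
Variable (A : int -> 'M[C]_N).
Hypothesis hA_sum : (\esum_(j in [set: int]) mxopnorm (A j) < +oo)%E.

Let kap j : R := fine (mxopnorm (A j)).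
Definition toeplitz_bound : R := fine (\esum_(j in [set: int]) mxopnorm (A j)).
Local Notation a := toeplitz_bound.

Let mxopnorm_ge0 j : (0 <= mxopnorm (A j))%E.
Proof.
apply: ereal_sup_ubound; exists 0 => /=.
  by rewrite -(scale0r (0 : 'cV[C]_N)) enormZ rnormv0 mul0r.
by rewrite mulmx0 -(scale0r (0 : 'cV[C]_N)) enormZ rnormv0 mul0r.
Qed.

Let kap_ge0 j : 0 <= kap j.
Proof. exact: fine_ge0. Qed.

Let esum_fin : (\esum_(j in [set: int]) mxopnorm (A j) \is a fin_num)%E.
Proof. by rewrite ge0_fin_numE// esum_ge0. Qed.

Let kap_sum_ereal (f : nat -> int) n : injective f ->
  (\sum_(0 <= k < n) mxopnorm (A (f k)) <= \esum_(j in [set: int]) mxopnorm (A j))%E.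
Proof.
move=> fi; apply: esum_ge; exists (f @` `I_n).
  by split=> //; exact: finite_image.
rewrite (@reindex_fsbig _ _ _ _ _ f `I_n); first by rewrite -fsbig_ord big_mkord.
split=> [k ?|j k _ _|x //]; [by exists k|exact: fi].
Qed.

Let kapE j : (kap j)%:E = mxopnorm (A j).
Proof.
rewrite fineK// ge0_fin_numE//; apply: le_lt_trans hA_sum.
apply: esum_ge; exists [set j]; first by split.
by rewrite fsbig_set1.
Qed.

Let kap_sum (f : nat -> int) n : injective f -> \sum_(0 <= k < n) kap (f k) <= a.
Proof.
move=> fi; rewrite -lee_fin fineK//; apply: le_trans (kap_sum_ereal n fi).
by rewrite -sumEFin; apply: lee_sum => k _; rewrite kapE.
Qed.

Lemma toeplitz_bound_ge0 : 0 <= a.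
Proof. by apply: fine_ge0; exact: esum_ge0. Qed.

Let enorm_kap j x : enorm (A j *m x) <= kap j * enorm x.
Proof.
have [x0|xn0] := eqVneq (enorm x) 0.
  by rewrite (enorm_eq0 x0) mulmx0 -(scale0r (0 : 'cV[C]_N)) enormZ rnormv0 mul0r mulr_ge0// enorm_ge0.
have xp : 0 < enorm x by rewrite lt_neqAle eq_sym xn0 enorm_ge0.
pose y := cofR (enorm x)^-1 *: x.
have ry : rnorm (cofR (enorm x)^-1 : C) = (enorm x)^-1.
  by rewrite rnorm_cofR ger0_norm// invr_ge0 enorm_ge0.
have : ((enorm (A j *m y))%:E <= mxopnorm (A j))%E.
  apply: ereal_sup_ubound; exists y => //=.
  by rewrite /y enormZ ry mulVf.
by rewrite -kapE lee_fin /y -scalemxAr enormZ ry mulrC ler_pdivrMr.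
Qed.

Let row (psi : nat -> 'cV[C]_N) (n : nat) : nat -> 'cV[C]_N :=
  series (fun m : nat => A (n%:Z - m%:Z) *m psi m).

Let injl (n : nat) : injective (fun m : nat => n%:Z - m%:Z).
Proof. by move=> j k /addrI/oppr_inj[]. Qed.

Let injr (m : nat) : injective (fun n : nat => n%:Z - m%:Z).
Proof. by move=> j k /addIr[]. Qed.

(** Summability of the coefficients and boundedness of psi give absolute convergence in each
    coordinate, so [limn] in [toeplitz] is a genuine limit. *)
Let row_coord (psi : H) n (i : 'I_N) :
  (fun M => row psi n M i ord0) @ \oo --> ((limn (row psi n) : 'cV[C]_N) i ord0 : C).
Proof.
move: i; have coord i : exists z : C, (fun M => row psi n M i ord0) @ \oo --> z.
  have cb : cvgn (series (fun m : nat => kap (n%:Z - m%:Z) * rnorm psi)).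
    apply: nondecreasing_is_cvgn.
      by apply: nondecreasing_series => m _ _; rewrite mulr_ge0 ?rnormv_ge0.
    exists (a * rnorm psi) => _ [M _ <-].
    by rewrite /series /= -mulr_suml ler_wpM2r ?rnormv_ge0// kap_sum.
  have := @is_cvg_series_rnorm R (fun m : nat => (A (n%:Z - m%:Z) *m psi m) i ord0) _ _ cb.
  move=> h; have {h}/cvg_ex[/= z hz] : cvgn (series (fun m : nat =>
      (A (n%:Z - m%:Z) *m psi m) i ord0 : C)).
    apply: h => m; apply: le_trans (rnorm_coord _ i) _.
    apply: le_trans (enorm_kap _ _) _; rewrite ler_wpM2l//; exact: enorm_le_rnorm.
  exists z; apply: cvg_trans hz; apply: near_eq_cvg; near=> M.
  by rewrite /row /series /= summxE.
have [z hz] := choice coord; move=> i.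
have -> : limn (row psi n) = \col_j z j.
  apply: cvg_lim; first exact: norm_hausdorff.
  by apply: cvg_col => j; rewrite mxE; exact: hz.
by rewrite mxE; exact: hz.
Unshelve. all: by end_near. Qed.

(** Schur's test: Cauchy-Schwarz with weights [kap], whose row sums and column sums are both at most
    a. *)
Let row_partial (psi : H) M P :
  \sum_(0 <= n < P) enorm (row psi n M) ^+ 2 <= (a * rnorm psi) ^+ 2.
Proof.
have a0 := toeplitz_bound_ge0.
have rowle n : enorm (row psi n M) ^+ 2 <=
    a * \sum_(0 <= m < M) kap (n%:Z - m%:Z) * enorm (psi m) ^+ 2.
  have h : enorm (row psi n M) <= \sum_(0 <= m < M) kap (n%:Z - m%:Z) * enorm (psi m).
    rewrite /row /series /=; elim: M => [|M IH].
      by rewrite !big_nil -(scale0r (0 : 'cV[C]_N)) enormZ rnormv0 mul0r.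
    rewrite !big_nat_recr//=; apply: le_trans (enormD _ _) _; exact: lerD.
  apply: le_trans (ler_sqr_nneg (enorm_ge0 _) h) _.
  have -> : \sum_(0 <= m < M) kap (n%:Z - m%:Z) * enorm (psi m) =
      \sum_(0 <= m < M) Num.sqrt (kap (n%:Z - m%:Z)) *
        (Num.sqrt (kap (n%:Z - m%:Z)) * enorm (psi m)).
    by apply: eq_bigr => m _; rewrite mulrA -expr2 sqr_sqrtr.
  apply: le_trans (cauchy_schwarz_sum _ _ _) _.
  under eq_bigr do rewrite sqr_sqrtr//.
  under [X in _ * X <= _]eq_bigr do rewrite exprMn sqr_sqrtr//.
  apply: ler_wpM2r; last exact: (kap_sum M (@injl n)).
  by apply: sumr_ge0 => m _; rewrite mulr_ge0// sqr_ge0.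
apply: le_trans (_ : \sum_(0 <= n < P)
    a * \sum_(0 <= m < M) kap (n%:Z - m%:Z) * enorm (psi m) ^+ 2 <= _).
  by apply: ler_sum => n _; exact: rowle.
rewrite -mulr_sumr exchange_big /= exprMn expr2 -mulrA ler_wpM2l//.
apply: le_trans (_ : \sum_(0 <= m < M) a * enorm (psi m) ^+ 2 <= _).
  apply: ler_sum => m _; rewrite -mulr_suml ler_wpM2r ?sqr_ge0//.
  exact: (kap_sum P (@injr m)).
by rewrite -mulr_sumr ler_wpM2l// sum_enorm_le.
Qed.

Let lim_partial (psi : H) P :
  \sum_(0 <= n < P) enorm (limn (row psi n)) ^+ 2 <= (a * rnorm psi) ^+ 2.
Proof.
have h : (fun M => \sum_(0 <= n < P) enorm (row psi n M) ^+ 2) @ \oo -->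
    \sum_(0 <= n < P) enorm (limn (row psi n)) ^+ 2.
  apply: cvg_sumv => n _; rewrite enorm_sqr.
  under eq_fun do rewrite enorm_sqr.
  apply: cvg_sumv => i _; under eq_fun do rewrite expr2.
  by rewrite expr2; apply: cvgM; apply: cvg_rnorm; exact: row_coord.
by apply: (cvgr_to_le h); apply: nearW => M; exact: row_partial.
Qed.

(** The bound [lim_partial] keeps [insubd] off its default value. *)
Lemma toeplitz_coord (psi : H) n : toeplitz A psi n = limn (row psi n).
Proof.
have a0 := toeplitz_bound_ge0.
have -> : l2seq (toeplitz A psi) = fun n => limn (row psi n).
  rewrite /toeplitz -[l2seq _]/(val _) insubdK//.
  apply: (@sqsummable_partial _ _ _ (a * rnorm psi)); last exact: lim_partial.
  by rewrite mulr_ge0 ?rnormv_ge0.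
by [].
Qed.

Lemma toeplitz_linear (c : C) (phi psi : H) :
  toeplitz A (c *: phi + psi) = c *: toeplitz A phi + toeplitz A psi.
Proof.
have coordD (x y : H) n i : (c *: x + y : H) n i ord0 = c * x n i ord0 + y n i ord0.
  by rewrite /= !mxE.
apply/val_inj/funext => n; apply/matrixP => i j; rewrite (ord1 j).
have key (x : H) : (fun M => row x n M i ord0) @ \oo --> (toeplitz A x n i ord0 : C).
  by rewrite toeplitz_coord; exact: row_coord.
suff e1 : toeplitz A (c *: phi + psi) n i ord0 =
    c * toeplitz A phi n i ord0 + toeplitz A psi n i ord0.
  exact: etrans e1 (esym (coordD (toeplitz A phi) (toeplitz A psi) n i)).
apply: (cvg_unique (@norm_hausdorff _ C^o) (key (c *: phi + psi))).
have -> : (fun M => row (c *: phi + psi : H) n M i ord0) =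
    (fun M => c * row phi n M i ord0 + row psi n M i ord0).
  apply/funext => M; rewrite /row /series /= !summxE mulr_sumr -big_split.
  apply: eq_bigr => m _ /=; rewrite !mxE mulr_sumr -big_split.
  by apply: eq_bigr => k _; rewrite /= !mxE mulrDr mulrCA.
by apply: cvgD; [apply: cvgMr|]; exact: key.
Qed.

Lemma toeplitz_bounded (psi : H) : rnorm (toeplitz A psi) <= a * rnorm psi.
Proof.
have a0 := toeplitz_bound_ge0.
apply: rnorm_le_partial => [|P]; first by rewrite mulr_ge0 ?rnormv_ge0.
under eq_bigr do rewrite toeplitz_coord.
exact: lim_partial.
Qed.

Lemma toeplitz_matrix l j :
  inner (basis_vec R hN l) (toeplitz A (basis_vec R hN j)) =
  A ((l %/ N)%:Z - (j %/ N)%:Z) (Ordinal (ltn_pmod l hN)) (Ordinal (ltn_pmod j hN)).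
Proof.
rewrite inner_basis toeplitz_coord; set n := (l %/ N)%N; set i := Ordinal _.
have h1 := @row_coord (basis_vec R hN j) n i.
apply: (cvg_unique (@norm_hausdorff _ C^o) h1).
apply/cvgn_rnormP => ep ep0; exists (j %/ N).+1 => M hM.
rewrite /row /series /= (bigD1_seq (j %/ N)%N) ?mem_index_iota ?iota_uniq//=.
rewrite eqxx big1 ?addr0; last by move=> k kj; rewrite (negbTE kj) mulmx0.
rewrite mxE (bigD1 (Ordinal (ltn_pmod j hN)))//= !mxE !eqxx mulr1 big1 ?addr0.
  by rewrite subrr rnormv0 ltW.
by move=> k kj; rewrite mxE (negbTE kj) mulr0.
Qed.

(** An entry is at most the norm of its block, and a scalar row meets each block N times. *)
Lemma toeplitz_schur l n :
  \sum_(0 <= j < n) rnorm (inner (basis_vec R hN l) (toeplitz A (basis_vec R hN j)) : C) <=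
  N%:R * a.
Proof.
have entry k i j : rnorm (A k i j : C) <= kap k.
  have d1 : enorm (delta_mx j ord0 : 'cV[C]_N) = 1.
    rewrite /enorm (bigD1 j)//= big1 => [|i' ij].
      by rewrite mxE !eqxx addr0 -(eis0 R) rnorm_eis expr1n sqrtr1.
    by rewrite mxE (negbTE ij) rnormv0 expr0n.
  have := enorm_kap k (delta_mx j ord0); rewrite d1 mulr1; apply: le_trans.
  apply: le_trans (rnorm_coord _ i); rewrite mxE (bigD1 j)//= !mxE !eqxx mulr1.
  by rewrite big1 ?addr0// => k' kj; rewrite mxE (negbTE kj) mulr0.
pose F q (i : nat) := kap ((l %/ N)%:Z - q%:Z).
apply: le_trans (_ : \sum_(0 <= j < n) F (j %/ N)%N (j %% N)%N <= _).
  by apply: ler_sum => j _; rewrite toeplitz_matrix; exact: entry.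
have nN : (n <= n * N)%N by rewrite leq_pmulr.
apply: le_trans (_ : \sum_(0 <= j < n * N) F (j %/ N)%N (j %% N)%N <= _).
  rewrite [leRHS](big_cat_nat (leq0n n) nN)/= lerDl.
  by apply: sumr_ge0 => j _; exact: kap_ge0.
rewrite (sum_divn_modn hN F n).
under eq_bigr do rewrite sumr_const_nat subn0 -mulr_natl.
rewrite -mulr_sumr ler_wpM2l//; exact: (kap_sum n (@injl (l %/ N)%N)).
Qed.

Lemma toeplitz_symmetric_matrix l j : (forall k, A (- k) = map_mx Num.conj (A k)^T) ->
  inner (basis_vec R hN l) (toeplitz A (basis_vec R hN j)) =
  inner (toeplitz A (basis_vec R hN l)) (basis_vec R hN j).
Proof.
move=> hA; rewrite -[RHS]inner_conj !toeplitz_matrix.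
by rewrite -opprB hA !mxE.
Qed.

End Toeplitz.

(** * From the integrability condition to a trace condition *)

Section TraceClass.
Variables (R : realType) (N : nat) (hN : (0 < N)%N).
Local Notation C := (Cplx R).
Local Notation H := (l2 R N).
Local Notation leb := (@lebesgue_measure R).
Local Notation ek := (basis_vec R hN).

Lemma compact_op_bounded (v : {linear H -> H}) : compact_op v ->
  exists2 m : R, 0 <= m & forall psi, rnorm (v psi) <= m * rnorm psi.
Proof.
rewrite /compact_op precompactE => cK.
have cn : continuous (fun x : H => rnorm x) 
  by move=> x; apply: (@cvg_rnorm _ H H (nbhs x) _ id x); exact: cvg_id.
have /compact_bounded[M [_ hM]] := @continuous_compact _ _ _ _ (continuous_subspaceT cn) cK.
pose m := `|M| + 1; have m0 : 0 <= m by rewrite addr_ge0.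
have hm (psi : H) : rnorm psi <= 1 -> rnorm (v psi) <= m.
  move=> h; have Mm : M < m by rewrite /m ltr_pwDr// ler_norm.
  apply: le_trans (ler_norm _) _; apply: (hM m Mm (rnorm (v psi))).
  by exists (v psi) => //; apply: subset_closure; exists psi.
exists m => // psi; have [->|p0] := eqVneq psi 0.
  by rewrite linear0 !rnormv0 mulr0.
have rp : 0 < rnorm psi by rewrite lt_neqAle rnormv_ge0 andbT eq_sym rnormv_eq0.
have rc : rnorm (cofR (rnorm psi)^-1 : C) = (rnorm psi)^-1.
  by rewrite rnorm_cofR ger0_norm// invr_ge0 ltW.
have := hm (cofR (rnorm psi)^-1 *: psi); rewrite rnormvZ rc mulVf ?gt_eqF//.
by rewrite (linearZZ v) rnormvZ rc => /(_ (lexx _)); rewrite mulrC ler_pdivrMr.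
Qed.

(** The integral of a nonnegative function is a supremum over simple functions below it, which is
    monotone whatever the measurability. *)
Lemma ge0_le_integral_nonmeasurable (D : set (measurableTypeR R))
    (f g : R -> \bar R) : (forall x, D x -> (0 <= f x)%E) ->
  (forall x, D x -> (f x <= g x)%E) ->
  (\int[leb]_(x in D) f x <= \int[leb]_(x in D) g x)%E.
Proof.
move=> f0 fg; have g0 x : D x -> (0 <= g x)%E.
  by move=> Dx; apply: le_trans (fg x Dx); exact: f0.
rewrite !ge0_integralE//; apply: ge_ereal_sup => _ [h hf <-].
apply: ereal_sup_ubound; exists h => // x; apply: le_trans (hf x) _.
by rewrite /patch; case: ifPn => // /set_mem; exact: fg.
Qed.

(* F is not known to be measurable. *)
Lemma sum_steps_le_integral (F : R -> \bar R) (b : nat -> R) K :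
  (forall r, (0 <= F r)%E) -> (forall n, 0 <= b n) ->
  (forall n r, (5 <= n)%N -> 2 / 3 * n%:R < r -> r <= 2 / 3 * n.+1%:R ->
    ((b n)%:E <= F r)%E) ->
  ((\sum_(5 <= n < K) 2 / 3 * b n)%:E <= \int[leb]_(r in `[1%R, +oo[) F r)%E.
Proof.
move=> F0 b0 hF.
pose J n : set R := `]2 / 3 * n%:R, 2 / 3 * n.+1%:R]%classic.
have mJ n : measurable (J n : set (measurableTypeR R)) by exact: measurable_itv.
pose g n r := (b n * \1_(J n) r)%:E : \bar R.
have g0 n r : (0 <= g n r)%E by rewrite lee_fin mulr_ge0.
have mg n : measurable_fun (`[1%R, +oo[%classic : set (measurableTypeR R)) (g n).
  apply/measurable_EFinP; apply: measurable_funM; first exact: measurable_cst.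
  by apply: measurable_indic; exact: mJ.
have mD : measurable (`[1%R, +oo[%classic : set (measurableTypeR R)) by exact: measurable_itv.
apply: le_trans (_ : (\int[leb]_(r in `[1%R, +oo[) \sum_(5 <= n < K) g n r <= _)%E).
  rewrite ge0_integral_sum// -sumEFin; rewrite big_nat_cond [leRHS]big_nat_cond.
  apply: lee_sum => n /andP[/andP[n5 _] _].
  rewrite /g; under eq_integral do rewrite EFinM.
  rewrite ge0_integralZl_EFin//; last first.
    by apply/measurable_EFinP; apply: measurable_indic; exact: mJ.
  rewrite integral_indic//.
  (* For n >= 5 the cell starts beyond 1. *)
  have -> : J n `&` `[1%R, +oo[%classic = J n.
    apply/seteqP; split=> [r []//|r]; rewrite /J /= !in_itv/= andbT => /andP[h1 h2].
    split; first by rewrite h1.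
    have : (5%:R : R) <= n%:R by rewrite ler_nat.
    by move: h1; lra.
  have lJ : leb (J n) = (2 / 3)%:E.
    rewrite /J lebesgue_measure_itv /= lte_fin ltr_pM2l ?divr_gt0// ltr_nat leqnn.
    by rewrite -EFinD -[n.+1%:R]natr1; congr EFin; ring.
  rewrite -[X in (_ * X)%E]/(leb (J n)) lJ -EFinM lee_fin mulrC.
  exact: lexx.
apply: ge0_le_integral_nonmeasurable => r _; first by apply: sume_ge0.
have [[n [n5 nK Jr]]|none] := pselect (exists n, [/\ (5 <= n)%N, (n < K)%N & J n r]).
  rewrite (bigD1_seq n) ?mem_index_iota ?n5 ?iota_uniq//= big1 ?adde0.
    rewrite /g indicE mem_set// mulr1; move: Jr; rewrite /J /= in_itv/= => /andP[h1 h2].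
    exact: hF.
  move=> k kn; rewrite /g indicE memNset ?mulr0// => Jk.
  move: Jr Jk; rewrite /J /= !in_itv/= => /andP[h1 h2] /andP[h3 h4].
  have p : (0 : R) < 2 / 3 by rewrite divr_gt0.
  have := lt_le_trans h1 h4; have := lt_le_trans h3 h2.
  rewrite !ltr_pM2l// !ltr_nat !ltnS => kn' nk'.
  by move: kn; rewrite eqn_leq kn' nk'.
rewrite big_nat_cond big1// => n /andP[/andP[n5 nK] _].
by rewrite /g indicE memNset ?mulr0// => Jn; apply: none; exists n.
Qed.

Lemma test_function_lower (theta : R -> R) : test_function theta ->
  (forall x : R, 1 < x < 2 -> 0 < theta x) ->
  exists2 c : R, 0 < c & forall x, 5 / 4 <= x <= 7 / 4 -> c <= theta x.
Proof.
move=> [dth _] pos; have ct : continuous theta.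
  move=> x; have /derivable1_diffP := dth 0%N x.
  exact: differentiable_continuous.
have le57 : (5 / 4 : R) <= 7 / 4 by lra.
have [c cI hc] := EVT_min le57 (continuous_subspaceT ct).
exists (theta c); last by move=> x hx; apply: hc; rewrite in_itv.
apply: pos; move: cI; rewrite in_itv/= => /andP[? ?].
by apply/andP; split; lra.
Qed.

(** 7/6 is 7/4 times 2/3: for r > 2n/3 the quotient by r stays below 7/4. *)
Lemma japanese_bounds (n : nat) : (n%:R : R) <= japanese n%:R /\
  ((2 <= n)%N -> japanese n%:R <= 7 / 6 * n%:R :> R).
Proof.
have n0 : 0 <= n%:R :> R by exact: ler0n.
split; first by rewrite /japanese -[leLHS]ger0_norm// -sqrtr_sqr ler_sqrt ?lerDr ?addr_ge0 ?sqr_ge0.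
move=> n2; have n2' : (2 : R) <= n%:R by rewrite ler_nat.
have p0 : 0 <= 7 / 6 * n%:R :> R by rewrite mulr_ge0.
rewrite /japanese -[leRHS]ger0_norm// -sqrtr_sqr ler_sqrt ?sqr_ge0//.
by rewrite exprMn; move: (n%:R : R) n2' => x x2; nra.
Qed.

Lemma fun_number_op_coord (f : R -> R) (n0 : nat) (psi : H) j :
  (forall k : nat, (n0 <= k)%N -> f k%:R = 0) ->
  fun_number_op f psi j = cofR (f j%:R) *: psi j.
Proof.
move=> h; have sq : weight_seq (fun k => f k%:R) psi \in @sqsummable R N.
  apply: (@finite_support_sqsummable _ _ _ n0) => k kn.
  by rewrite /weight_seq h// /cofR rmorph0 scale0r.
have -> : l2seq (fun_number_op f psi) = weight_seq (fun k => f k%:R) psi.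
  by rewrite /fun_number_op /weight_op -[l2seq _]/(val _) insubdK.
by [].
Qed.

(* By symmetry of v, for u = v (ek k), theta |u| is the modulus of the component
   along [ek k] of the image of u / |u|. *)
Lemma opnorm_lower (theta : R -> R) (v : {linear H -> H}) (r : R) k :
  (forall x : R, 0 <= theta x) -> (forall x : R, 2 <= x -> theta x = 0) ->
  symmetric_op v -> 0 < r ->
  ((theta (japanese (k %/ N)%:R / r) * rnorm (v (ek k)))%:E <=
   opnorm (fun psi : H => fun_number_op (fun x : R => (theta (japanese x / r))%R) (v psi)))%E.
Proof.
move=> th0 th2 sv r0; set q := (k %/ N)%N; set u := v (ek k).
have supp (j : nat) : (Num.bound (2 * r) <= j)%N -> theta (japanese j%:R / r) = 0.
  move=> hj; apply: th2; rewrite ler_pdivlMr//; apply: le_trans (japanese_bounds j).1.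
  apply: le_trans (ltW (archi_boundP _)) _; first by rewrite mulr_ge0// ltW.
  by rewrite ler_nat.
have [u0|un0] := eqVneq u 0.
  rewrite u0 rnormv0 mulr0; apply: le_trans (_ : _ <= (rnorm (fun_number_op
    (fun x : R => (theta (japanese x / r))%R) (v 0)))%:E)%E _.
    by rewrite lee_fin rnormv_ge0.
  apply: ereal_sup_ubound; exists (0 : H) => //=; first by rewrite rnormv0.
have rp : 0 < rnorm u by rewrite lt_neqAle rnormv_ge0 andbT eq_sym rnormv_eq0.
have rc : rnorm (cofR (rnorm u)^-1 : C) = (rnorm u)^-1.
  by rewrite rnorm_cofR ger0_norm// invr_ge0 ltW.
pose y : H := cofR (rnorm u)^-1 *: u.
apply: le_trans (_ : _ <= (rnorm (fun_number_op
    (fun x : R => (theta (japanese x / r))%R) (v y)))%:E)%E _; last first.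
  apply: ereal_sup_ubound; exists y => //=.
  by rewrite /y rnormvZ rc mulVf ?gt_eqF.
rewrite lee_fin.
have uy : rnorm (inner (ek k) (v y) : C) = rnorm u.
  rewrite sv -/u /y -[X in inner u X]addr0 innerDZr.
  have -> : inner u (0 : H) = 0 by exact: (@ip0r _ (l2_hilbert R N) u).
  rewrite addr0 innerxx rnormM rc rnorm_cofR ger0_norm ?sqr_ge0//.
  by rewrite expr2 mulKf ?gt_eqF.
apply: le_trans (_ : enorm (fun_number_op
    (fun x : R => (theta (japanese x / r))%R) (v y) q) <= _); last exact: enorm_le_rnorm.
rewrite (fun_number_op_coord _ _ supp) enormZ rnorm_cofR ger0_norm// ler_wpM2l//.
by rewrite -uy inner_basis; exact: rnorm_coord.
Qed.

(* The intervals ]2n/3, 2(n+1)/3] are disjoint, and for n >= 5 the quotient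
   japanese n / r stays in [5/4, 7/4] when r runs through the n-th one. *)
Lemma trace_class (theta : R -> R) (v : {linear H -> H}) :
  test_function theta -> (forall x : R, 1 < x < 2 -> 0 < theta x) ->
  (forall x : R, ~~ (1 < x < 2) -> theta x = 0) -> symmetric_op v ->
  (\int[leb]_(r in `[1%R, +oo[) opnorm (fun psi : H =>
     fun_number_op (fun x : R => (theta (japanese x / r))%R) (v psi)) < +oo)%E ->
  exists B : R, forall n, \sum_(0 <= k < n) rnorm (v (ek k)) <= B.
Proof.
move=> tf pos zero sv; set F := fun r : R => opnorm _ => hint.
have th0 x : 0 <= theta x.
  by have [h|h] := boolP (1 < x < 2); [exact/ltW/pos|rewrite zero].
have th2 x : 2 <= x -> theta x = 0.
  by move=> x2; apply: zero; rewrite negb_and -!leNgt x2 orbT.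
have F0 r : (0 <= F r)%E.
  apply: le_trans (_ : (rnorm (fun_number_op
    (fun x : R => (theta (japanese x / r))%R) (v 0)))%:E <= _)%E.
    by rewrite lee_fin rnormv_ge0.
  by apply: ereal_sup_ubound; exists (0 : H) => //=; rewrite rnormv0.
have [c c0 hc] := test_function_lower tf pos.
pose I := fine (\int[leb]_(r in `[1%R, +oo[) F r)%E.
have IE : I%:E = (\int[leb]_(r in `[1%R, +oo[) F r)%E.
  by rewrite fineK// ge0_fin_numE//; apply: integral_ge0.
have I0 : 0 <= I by apply: fine_ge0; apply: integral_ge0.
pose b i n := rnorm (v (ek (n * N + i)%N)).
have b0 i n : 0 <= b i n by exact: rnormv_ge0.
(* The factor 3/2 inverts the cell length 2/3, and 1/c the lower bound of theta. *)
have tail i K : (i < N)%N -> \sum_(5 <= n < K) b i n <= 3 / 2 * I / c.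
  move=> iN; have : ((\sum_(5 <= n < K) 2 / 3 * (c * b i n))%:E <= I%:E)%E.
    rewrite IE; apply: (@sum_steps_le_integral F (fun n => c * b i n) K F0) => [n|n r n5 h1 h2].
      by rewrite mulr_ge0// ltW.
    have n5' : (5 : R) <= n%:R by rewrite ler_nat.
    have r0 : 0 < r by apply: le_lt_trans h1; rewrite mulr_ge0.
    have := @opnorm_lower theta v r (n * N + i)%N th0 th2 sv r0.
    rewrite divnMDl// divn_small// addn0; apply: le_trans.
    rewrite lee_fin ler_wpM2r//; apply: hc.
    have [j1 j2] := japanese_bounds n; have {}j2 := j2 (ltnW (ltnW (ltnW n5))).
    (* At the right end r = 2(n + 1)/3 the inequality n / r >= 5/4 amounts to n >= 5. *)
    rewrite ler_pdivlMr// ler_pdivrMr//.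
    move: h2; rewrite -[n.+1%:R]natr1 => h2.
    by move: h1 h2 j1 j2 n5'; move: (n%:R : R) (japanese _) => x y *; apply/andP; split; lra.
  rewrite lee_fin -mulr_sumr -mulr_sumr => h.
  rewrite ler_pdivlMr// mulrC; move: h; move: (c * _) => X; lra.
pose B i := \sum_(0 <= n < 5) b i n + 3 / 2 * I / c.
have Bi i K : (i < N)%N -> \sum_(0 <= n < K) b i n <= B i.
  move=> iN; have [K5|K5] := leqP K 5.
    apply: le_trans (_ : \sum_(0 <= n < 5) b i n <= _).
      rewrite [leRHS](big_cat_nat (leq0n K) K5)/= lerDl.
      by apply: sumr_ge0.
    by rewrite lerDl divr_ge0 ?(ltW c0)// mulr_ge0.
  by rewrite (big_cat_nat (leq0n 5) (ltnW K5))/= lerD2l; exact: tail.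
exists (\sum_(0 <= i < N) B i) => n.
have nN : (n <= n * N)%N by rewrite leq_pmulr.
apply: le_trans (_ : \sum_(0 <= k < n * N) rnorm (v (ek k)) <= _).
  rewrite [leRHS](big_cat_nat (leq0n n) nN)/= lerDl.
  by apply: sumr_ge0 => k _; exact: rnormv_ge0.
have -> : \sum_(0 <= k < n * N) rnorm (v (ek k)) =
    \sum_(0 <= k < n * N) rnorm (v (ek (k %/ N * N + k %% N)%N)).
  by apply: eq_bigr => k _; rewrite -divn_eq.
rewrite (sum_divn_modn hN (fun q i => rnorm (v (ek (q * N + i)%N))) n).
rewrite exchange_big /= big_nat_cond [leRHS]big_nat_cond.
by apply: ler_sum => i /andP[/andP[_ iN] _]; exact: Bi.
Qed.

End TraceClass.

(** * Return to the definitions of the statement *)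

Section Conversion.
Variables (R : realType) (N : nat).
Local Notation C := (Cplx R).
Local Notation HH := (l2_hilbert R N).
Local Notation H := (l2 R N).
Local Notation leb := (@lebesgue_measure R).

Lemma spectral_measure_resolution (S : H -> H) (E : set R -> {linear H -> H}) :
  spectral_measure_of S E <-> @resolution R HH S E.
Proof.
by split=> -[h1 h2 h3 h4]; split.
Qed.

(** The scalar spectral measure of B is |E B x|^2, so it vanishes exactly when E B x does. *)
Lemma ac_subspace_hac (S : H -> H) : ac_subspace S = @hac R HH S.
Proof.
have eq0 (E : set R -> {linear HH -> HH}) (x : HH) (B : set (measurableTypeR R)) :
    @resolution R HH S E -> measurable B ->
    (scalar_spectral E x B = 0%E <-> E B x = 0).
  move=> rE mB; have pP : orth_projector (E B).
    split; first exact: (res_sym rE mB).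
    by move=> y; rewrite -(res_I rE mB mB) setIid.
  rewrite (_ : scalar_spectral E x B = (rnorm (E B x) ^+ 2)%:E); last first.
    by rewrite (projector_rnorm x pP).
  split=> [[/eqP]|->]; last by rewrite rnormv0 expr0n.
  by rewrite sqrf_eq0 rnormv_eq0 => /eqP.
apply/seteqP; split=> x [E].
  move=> /spectral_measure_resolution rE /null_content_dominatesP h; exists E => //.
  by move=> A mA lA; apply/(eq0 E x A rE mA); exact: h.
move=> rE h; exists E; first exact/spectral_measure_resolution.
by apply/null_content_dominatesP => A mA lA; apply/(eq0 E x A rE mA); exact: h.
Qed.

Lemma wave_limit_cvg_pinfty (T T0 : H -> H) (x l : H) :
  @wave_limit R HH 1 T T0 x l ->
  exp_itop T t (exp_itop T0 (- t) x) @[t --> +oo] --> l.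
Proof.
move=> h; apply/cvg_rnormP/cvgrPdist_le => ep ep0.
have [t0 ht0] := h _ ep0; near=> t.
rewrite sub0r normrN ger0_norm ?rnormv_ge0//.
have := ht0 t; rewrite mul1r; apply.
by near: t; apply: nbhs_pinfty_ge; exact: num_real.
Unshelve. all: by end_near. Qed.

Lemma wave_limit_cvg_ninfty (T T0 : H -> H) (x l : H) :
  @wave_limit R HH (- 1) T T0 x l ->
  exp_itop T t (exp_itop T0 (- t) x) @[t --> -oo] --> l.
Proof.
move=> h; apply/cvg_rnormP/cvgrPdist_le => ep ep0.
have [t0 ht0] := h _ ep0; near=> t.
rewrite sub0r normrN ger0_norm ?rnormv_ge0//.
have := ht0 (- t); rewrite mulrNN mul1r; apply.
by rewrite lerNr; near: t; apply: nbhs_ninfty_le; exact: num_real.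
Unshelve. all: by end_near. Qed.

End Conversion.

Theorem corollary1p2 (R : realType) (N : nat) (hN : (0 < N)%N)
  (theta : R -> R) (htheta : test_function theta)
  (htheta_pos : forall x : R, 1 < x < 2 -> 0 < theta x)
  (htheta_0 : forall x : R, ~~ (1 < x < 2) -> theta x = 0)
  (A : int -> 'M[Cplx R]_N)
  (hA_sum : (\esum_(j in [set: int]) mxopnorm (A j) < +oo)%E)
  (hA_adj : forall j : int, A (- j) = map_mx Num.conj (A j)^T)
  (hA_hol : exists2 r : R, 1 < r & symbol_extends_holomorphically A r)
  (v : {linear l2 R N -> l2 R N})
  (hv_compact : compact_op v)
  (hv_sym : symmetric_op v)
  (hv_int : (\int[@lebesgue_measure R]_(r in `[1%R, +oo[)
     opnorm (fun psi : l2 R N =>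
       fun_number_op (fun x : R => (theta (japanese x / r))%R) (v psi))
     < +oo)%E)
  (hv_ext : extends_to_Kplus v) :
  let T0 : l2 R N -> l2 R N := toeplitz A in
  let T : l2 R N -> l2 R N := fun psi => T0 psi + v psi in
  (exists2 W : l2 R N -> l2 R N,
     is_wave_operator (pinfty_nbhs R) T T0 W & range W = ac_subspace T) /\
  (exists2 W : l2 R N -> l2 R N,
     is_wave_operator (ninfty_nbhs R) T T0 W & range W = ac_subspace T).
Proof.
pose HH := l2_hilbert R N; move=> T0 T.
pose a := toeplitz_bound A; have a0 : 0 <= a := toeplitz_bound_ge0 A.
have [mv mv0 vm] := compact_op_bounded hv_compact.
pose e : nat -> HH := basis_vec R hN.
pose T0L : {linear HH -> HH} := @linear_of R HH T0 (toeplitz_linear hA_sum).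
pose vL : {linear HH -> HH} := v.
pose TL : {linear HH -> HH} := linear_of (linearD2 T0L vL).
have on : forall j k, ip (e j) (e k) = (j == k)%:R := basis_vec_orthonormal R hN.
have total : forall x : HH, (forall k, ip (e k) x = 0) -> x = 0 :=
  @basis_vec_total R N hN.
have e1 k : rnorm (e k) <= 1 by rewrite (onb_rnorm on).
have eE := onb_expansion on total.
have T0a : op_bound T0L a := toeplitz_bounded hA_sum.
have sT0 : hsymmetric T0L.
  apply: (onb_symmetric on total T0a) => j k.
  exact: (toeplitz_symmetric_matrix hN hA_sum j k hA_adj).
have sT : hsymmetric TL.
  move=> x y; rewrite [LHS](ipDr x (T0L y) (vL y)) [RHS](ipDl (T0L x) (vL x) y).
  by rewrite (sT0 x y); congr (_ + _); exact: hv_sym.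
have TLm : op_bound TL (a + mv).
  move=> x; apply: le_trans (rnormvD _ _) _; rewrite mulrDl.
  by apply: lerD; [exact: T0a|exact: vm].
have T0m : op_bound T0L (a + mv) by apply: op_boundW T0a; rewrite lerDl.
have m0 : 0 <= a + mv by rewrite addr_ge0.
have [b vb] := trace_class hN htheta htheta_pos htheta_0 hv_sym hv_int.
have vb' : summable_bound e (linear_of (linearB2 TL T0L)) b.
  move=> n; apply: le_trans (vb n); apply: ler_sum => k _.
  by rewrite /= addrC addrA [- _ + _]addrC subrr add0r.
have Na0 : 0 <= N%:R * a by rewrite mulr_ge0.
have schur : forall l n, \sum_(0 <= j < n) rnorm (ip (e l) (T0L (e j)) : Cplx R) <=
    N%:R * a := toeplitz_schur hN hA_sum.
have Kb t : exists b', summable_bound e (fun x => hexp TL t x - hexp T0L t x) b'.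
  exists (expR (`|t| * (2 * ((a + mv) + N%:R * a + 1))) * b).
  exact: (@summable_bound_hexp R HH e eE T0L (N%:R * a) Na0 schur TL (a + mv) b m0 TLm T0m vb' t).
have KR := @kato_rosenblum R HH e TL T0L (a + mv) _ e1 eE m0 TLm T0m sT sT0 Kb.
have acE : ac_subspace T0 = @hac R HH T0L by exact: ac_subspace_hac.
split.
  have [W hW rW] := KR 1 (or_introl erefl); exists W; last by rewrite rW -ac_subspace_hac.
  move=> psi; rewrite /ac_proj acE; apply: wave_limit_cvg_pinfty; exact: hW.
have [W hW rW] := KR (- 1) (or_intror erefl); exists W; last by rewrite rW -ac_subspace_hac.
move=> psi; rewrite /ac_proj acE; apply: wave_limit_cvg_ninfty; exact: hW.
Qed.
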